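(* Let $\mathbb{K}$ be a ring with unit and $(U,V)$ a linear set over $\mathbb{K}$. (1) The data $(U^{\overline{\{1\}}},U^{\{1\}},U\times\mathbb{K}^2,U\times\mathbb{K},\pi,\partial,z,\ast,\bullet)$ described in the context define a small double category, denoted by $\mathbf{U}^{\overline{\{1\}}}$, with $C_{11}=U^{\overline{\{1\}}}$, $C_{10}=U^{\{1\}}$, $C_{01}=U\times\mathbb{K}^2$, $C_{00}=U\times\mathbb{K}$. (2) For a $\mathbb{K}$-module $W$, morphisms of double categories $\mathbf{f}:\mathbf{U}^{\overline{\{1\}}}\to\mathbf{W}^{\overline{\{1\}}}$ which are trivial on $\mathbb{K}$ are in 1:1-correspondence with maps $f:U\to W$ together with a difference factorizer $f^{[1]}$ of $f$ satisfying, for all $s,t\in\mathbb{K}$ and whenever defined, $$f^{[1]}(x,v+v',t)=f^{[1]}(x+vt,v',t)+f^{[1]}(x,v,t),\qquad f^{[1]}(x,vs,t)=f^{[1]}(x,v,st)\,s .$$ (3) The unique map $U\to 0$ induces a canonical morphism of the $\bullet$-category to the left action category of $(\mathbb{K},\cdot)$; that is, the maps $U^{\overline{\{1\}}}\to U\times\mathbb{K}\times\mathbb{K}\to\mathbb{K}\times\mathbb{K}$ (projection on $(s,t)$) and $U^{\{1\}}\to U\times\mathbb{K}\to\mathbb{K}$ (projection on $t$) are compatible with $\partial$ and $\bullet$. (4) The maps $j(x,v;s,t):=(x+vst,-v;s,t)$, $j(x,v;t):=(x+vt,-v;t)$, $j(x;s,t)=(x;s,t)$, and $j(x;t)=(x;t)$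 define an isomorphism of double categories $(\ast,\bullet)\to(\ast^{op},\bullet)$. (5) The inverse image of the left action category $((\mathbb{K}^\times)^2,\mathbb{K}^\times)$ under the projections from Item (3) forms a double groupoid, denoted by $(\mathbf{U}^{\overline{\{1\}}})^\times$, which is isomorphic to the double groupoid given by the direct product of the categories $U\times U$ (pair groupoid) and $\mathbb{K}^\times\times\mathbb{K}^\times$ (pair groupoid). (6) If $\mathbb{K}$ is a topological ring with dense unit group and $M$ is a Hausdorff $C^1_{\mathbb{K}}$-manifold modelled on a Hausdorff topological $\mathbb{K}$-module $V$, then there is a continuous double category $M^{\overline{\{1\}}}$ over $M\times\mathbb{K}$ (with $C_{11}=M^{\overline{\{1\}}}$, $C_{10}=M^{\{1\}}$, $C_{01}=M\times\mathbb{K}^2$, $C_{00}=M\times\mathbb{K}$, obtained by gluing the local double categories of chart domains). Moreover: (i) every $C^1_{\mathbb{K}}$-map $f:U\to W$, with $U\subset V$ open and $W$ a Hausdorff topological $\mathbb{K}$-module, induces a morphism of double categories $\mathbf{U}^{\overline{\{1\}}}\to\mathbf{W}^{\overline{\{1\}}}$; (ii) with respect to $\ast$, $M^{\overline{\{1\}}}$ is a bundle of continuous groupoids over $\mathbb{K}^2$ with object set $M$ in each fiber; the fiber over $(s,t)$ is the tangent bundle $TM$ if $st=0$ and is isomorphic to the pair groupoid of $M$ if $st\in\mathbb{K}^\times$; (iii) the part of $M^{\overline{\{1\}}}$ lying over $(\mathbb{K}^\times)^2$ is a double groupoid naturally isomorphic to the direct product of the pair groupoid of $M$ and the pair groupoid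 of $\mathbb{K}^\times$; if $\mathbb{K}$ is a field, the $\ast$-groupoid $M^{\overline{\{1\}}}$ is the disjoint union of its part over $\{st=0\}$ and its part over $(\mathbb{K}^\times)^2$; (iv) for Hausdorff $C^1_{\mathbb{K}}$-manifolds $M,N$ there is a natural homeomorphism $(M\times N)^{\overline{\{1\}}}\cong M^{\overline{\{1\}}}\times_{\mathbb{K}^2}N^{\overline{\{1\}}}$ of bundles over $M\times N\times\mathbb{K}^2$. Continuous morphisms $M^{\overline{\{1\}}}\to N^{\overline{\{1\}}}$ of double categories which are trivial on $\mathbb{K}$ are in bijection with maps $f:M\to N$ of class $C^1_{\mathbb{K}}$.
   Context: $\mathbb{K}$ is a unital ring, not assumed commutative; modules are right $\mathbb{K}$-modules. A linear set is a pair $(U,V)$ with $V$ a $\mathbb{K}$-module and $\emptyset\neq U\subset V$; $0$ denotes the linear set $(\{0\},\{0\})$. A small category has composition $g\ast f$ defined when the target of $f$ is the source of $g$. Sets: $U^{\{1\}}=U^{[1]}=\{(x,v;t)\in V^2\times\mathbb{K}\mid x\in U,\ x+vt\in U\}$, $U^{\overline{\{1\}}}=\{(x,v;s,t)\in V^2\times\mathbb{K}^2\mid x\in U,\ x+vst\in U\}$. Projections (index $0$ = source, $1$ = target): $\partial_0(x,v;s,t)=(x,v;st)$, $\partial_1(x,v;s,t)=(x,vs;t)$ from $U^{\overline{\{1\}}}$ to $U^{\{1\}}$; $\partial_0(x;s,t)=(x;st)$, $\partial_1(x;s,t)=(x;t)$ from $U\times\mathbb{K}^2$ to $U\times\mathbb{K}$;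 $\pi_0(x,v;s,t)=(x;s,t)$, $\pi_1(x,v;s,t)=(x+vst;s,t)$ from $U^{\overline{\{1\}}}$ to $U\times\mathbb{K}^2$; $\pi_0(x,v;t)=(x;t)$, $\pi_1(x,v;t)=(x+vt;t)$ from $U^{\{1\}}$ to $U\times\mathbb{K}$. Unit sections: $z_\pi(x;t)=(x,0;t)$, $z_\pi(x;s,t)=(x,0;s,t)$, $z_\partial(x;t)=(x;1,t)$, $z_\partial(x,v;t)=(x,v;1,t)$. Products: $(x',v';s,t)\ast(x,v;s,t)=(x,v+v';s,t)$ if $x'=x+vst$; $(x',v';t)\ast(x,v;t)=(x,v+v';t)$ if $x'=x+vt$; $(x,v';s',t')\bullet(x,v;s,t)=(x,v;ss',t')$ if $v'=vs$, $t=s't'$; $(x;s',t')\bullet(x;s,t)=(x;ss',t')$ if $t=s't'$. A small double category is given by sets $C_{11},C_{10},C_{01},C_{00}$ with small category structures $(\pi,z_\pi,\ast)$ on $C_{11}\rightrightarrows C_{01}$ and $C_{10}\rightrightarrows C_{00}$, and $(\partial,z_\partial,\bullet)$ on $C_{11}\rightrightarrows C_{10}$ and $C_{01}\rightrightarrows C_{00}$, such that $\partial_i\pi_j=\pi_j\partial_i$, $z_\pi z_\partial=z_\partial z_\pi$, $\partial_i z_\pi=z_\pi\partial_i$, $\pi_i z_\partial=z_\partial\pi_i$, all $\partial_i$ and $z_\partial$ preserve $\ast$, all $\pi_i$ and $z_\pi$ preserve $\bullet$, and the interchange law $(a\ast b)\bullet(c\ast d)=(a\bullet c)\ast(b\bullet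 d)$ holds whenever both sides are defined. A morphism is given by four maps defining a functor on each of the four edge categories. A double groupoid is a small double category whose four edge categories are groupoids. $(\ast^{op},\bullet)$ denotes the double category in which the two $\ast$-categories are replaced by their opposites. A double category is continuous if its four sets are topological spaces and its structure maps are continuous. A morphism $\mathbf{U}^{\overline{\{1\}}}\to\mathbf{W}^{\overline{\{1\}}}$ (or $M^{\overline{\{1\}}}\to N^{\overline{\{1\}}}$) is trivial on $\mathbb{K}$ if its components on $C_{00}$ and $C_{01}$ are $f\times\mathrm{id}_{\mathbb{K}}$ and $f\times\mathrm{id}_{\mathbb{K}}\times\mathrm{id}_{\mathbb{K}}$ for a base map $f$. A difference factorizer of $f:U\to W$ is a map $f^{[1]}:U^{[1]}\to W$ with $f(x+vt)-f(x)=f^{[1]}(x,v,t)\,t$ for all $(x,v,t)\in U^{[1]}$; in (2) the pair $(f,f^{[1]})$ corresponds to $f^{\{1\}}(x,v;t)=(f(x),f^{[1]}(x,v,t);t)$ and $f^{\overline{\{1\}}}(x,v;s,t)=(f(x),f^{[1]}(x,v,st);s,t)$. The left action category of $(\mathbb{K},\cdot)$ has objects $\mathbb{K}$, morphisms $\mathbb{K}\times\mathbb{K}$, $\partial_0(s,t)=st$, $\partial_1(s,t)=t$, units $(1,t)$, and $(s',t')\bullet(s,t)=(ss',t')$ if $t=s't'$; similarly with $\mathbb{K}^\times$. The pair groupoid of a set $A$ has objects $A$, morphisms $A\times A$, source $(x,y)\mapsto y$, target $(x,y)\mapsto x$, $(x,y)\circ(y,z)=(x,z)$. In (5) and (iii)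 the direct product double category of groupoids $A\times A\rightrightarrows A$ and $B\times B\rightrightarrows B$ has $C_{11}=A^2\times B^2$, $C_{10}=A^2\times B$, $C_{01}=A\times B^2$, $C_{00}=A\times B$. For (6): for $U$ open in $V$, $f:U\to W$ is $C^1_{\mathbb{K}}$ if it admits a continuous difference factorizer (unique since $\mathbb{K}^\times$ is dense). A Hausdorff $C^1_{\mathbb{K}}$-manifold modelled on $V$ is a Hausdorff space with a maximal atlas of charts $\phi_i:U_i\to V_i$ onto open subsets $V_i\subset V$ (chart domains nonempty, possibly disconnected) with $C^1_{\mathbb{K}}$ transition maps $\phi_{ij}=\phi_i\circ\phi_j^{-1}$; $C^1_{\mathbb{K}}$-maps of manifolds are continuous maps that are $C^1_{\mathbb{K}}$ in charts. $M^{\{1\}}$ (resp. $M^{\overline{\{1\}}}$) is obtained by gluing the spaces $V_i^{\{1\}}$ (resp. $V_i^{\overline{\{1\}}}$) along the maps $\phi_{ij}^{\{1\}}$ (resp. $\phi_{ij}^{\overline{\{1\}}}$), with topology generated by the images of open subsets of these spaces; the structure maps are those given in charts.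
   Formalization: Item (6) also assumes that every nonempty finite set of points of each manifold lies in one chart domain; without this it fails (K = R, V = 0, M two points). For V ≠ 0 over a topological division ring with continuous inversion this is proved to be automatic. *)

(* Defs.v *)
From HB Require Import structures.
From mathcomp Require Import all_boot all_order all_algebra.
From mathcomp Require Import all_classical topology pseudometric_normed_Zmodule.

Set Implicit Arguments.
Unset Strict Implicit.
Unset Printing Implicit Defensive.

Import GRing.Theory.

Local Open Scope classical_set_scope.
Local Open Scope ring_scope.

(* A right K-module is a left module over the converse ring K^c. *)
Definition rscale (K : pzRingType) (V : lmodType K^c) (v : V) (a : K) : V :=
  (a : K^c) *: v.
Notation "v ⋅ a" := (rscale v a) (at level 40, left associativity).

Lemma rscaleA (K : pzRingType) (V : lmodType K^c) (v : V) (a b : K) :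
  v ⋅ a ⋅ b = v ⋅ (a * b).
Proof. by rewrite /rscale scalerA. Qed.

Lemma rscale0l (K : pzRingType) (V : lmodType K^c) (a : K) :
  (0 : V) ⋅ a = 0.
Proof. by rewrite /rscale scaler0. Qed.

Lemma rscale1 (K : pzRingType) (V : lmodType K^c) (v : V) : v ⋅ (1 : K) = v.
Proof. exact: (@scale1r K^c V v). Qed.

Lemma rscaleNl (K : pzRingType) (V : lmodType K^c) (v : V) (a : K) :
  (- v) ⋅ a = - (v ⋅ a).
Proof. by rewrite /rscale scalerN. Qed.

Definition units (K : pzRingType) : set K :=
  [set a | exists b, a * b = 1 /\ b * a = 1].
Arguments units K : clear implicits.

Definition is_field (K : pzRingType) : Prop :=
  [/\ forall a b : K, a * b = b * a,
      (1 : K) <> 0 &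
      forall a : K, a <> 0 -> units K a].

HB.mixin Record isTopologicalRing K & Topological K & GRing.PzRing K := {
  ringB_continuous : continuous (fun p : K * K => p.1 - p.2) ;
  ringM_continuous : continuous (fun p : K * K => p.1 * p.2) ;
}.

#[short(type="topologicalRingType")]
HB.structure Definition TopologicalRing :=
  {K of Topological K & GRing.PzRing K & isTopologicalRing K}.

HB.mixin Record isTopologicalRmodule (K : topologicalRingType) V
    & Topological V & GRing.Lmodule K^c V := {
  modB_continuous : continuous (fun p : V * V => p.1 - p.2) ;
  modZ_continuous : continuous (fun p : V * K => (p.2 : K^c) *: p.1) ;
}.

#[short(type="topologicalRmodType")]
HB.structure Definition TopologicalRmodule (K : topologicalRingType) :=
  {V of Topological V & GRing.Lmodule K^c V & isTopologicalRmodule K V}.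


Lemma pair_continuous (X Y Z : topologicalType) (f : X -> Y) (g : X -> Z) :
  continuous f -> continuous g -> continuous (fun x => (f x, g x)).
Proof. by move=> cf cg x; apply: cvg_pair; [exact: cf|exact: cg]. Qed.

Section ProductRmodule.
Variables (K : topologicalRingType) (V W : topologicalRmodType K).

Lemma prod_modB_continuous :
  continuous (fun p : (V * W) * (V * W) => p.1 - p.2).
Proof.
have fstC (X Y : topologicalType) : continuous (@fst X Y).
  by move=> ?; exact: cvg_fst.
have sndC (X Y : topologicalType) : continuous (@snd X Y).
  by move=> ?; exact: cvg_snd.
pose f1 (q : (V * W) * (V * W)) := q.1.1 - q.2.1.
pose f2 (q : (V * W) * (V * W)) := q.1.2 - q.2.2.
have c1 : continuous f1.
  move=> q; apply: (@continuous_comp _ _ _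
    (fun q : (V * W) * (V * W) => (q.1.1, q.2.1)) (fun q : V * V => q.1 - q.2)).
    apply: pair_continuous => {}q; apply: continuous_comp;
    [exact: fstC|exact: fstC|exact: sndC|exact: fstC].
  exact: modB_continuous.
have c2 : continuous f2.
  move=> q; apply: (@continuous_comp _ _ _
    (fun q : (V * W) * (V * W) => (q.1.2, q.2.2)) (fun q : W * W => q.1 - q.2)).
    apply: pair_continuous => {}q; apply: continuous_comp;
    [exact: fstC|exact: sndC|exact: sndC|exact: sndC].
  exact: modB_continuous.
exact: (pair_continuous c1 c2).
Qed.

Lemma prod_modZ_continuous :
  continuous (fun p : (V * W) * K => (p.2 : K^c) *: p.1).
Proof.
have fstC (X Y : topologicalType) : continuous (@fst X Y).
  by move=> ?; exact: cvg_fst.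
have sndC (X Y : topologicalType) : continuous (@snd X Y).
  by move=> ?; exact: cvg_snd.
pose f1 (q : (V * W) * K) := (q.2 : K^c) *: q.1.1.
pose f2 (q : (V * W) * K) := (q.2 : K^c) *: q.1.2.
have c1 : continuous f1.
  move=> q; apply: (@continuous_comp _ _ _
    (fun q : (V * W) * K => (q.1.1, q.2))
    (fun q : V * K => (q.2 : K^c) *: q.1)).
    apply: pair_continuous => {}q; last exact: sndC.
    by apply: continuous_comp; [exact: fstC|exact: fstC].
  exact: modZ_continuous.
have c2 : continuous f2.
  move=> q; apply: (@continuous_comp _ _ _
    (fun q : (V * W) * K => (q.1.2, q.2))
    (fun q : W * K => (q.2 : K^c) *: q.1)).
    apply: pair_continuous => {}q; last exact: sndC.
    by apply: continuous_comp; [exact: fstC|exact: sndC].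
  exact: modZ_continuous.
exact: (pair_continuous c1 c2).
Qed.

HB.instance Definition _ := isTopologicalRmodule.Build K (V * W)%type
  prod_modB_continuous prod_modZ_continuous.

End ProductRmodule.

(* The partial composition is a ternary relation: [comp C g f h] means that
   the composite of g after f is defined and equals h. *)
Record catData (C1 C0 : Type) := CatData {
  src : C1 -> C0 ;
  tgt : C1 -> C0 ;
  idt : C0 -> C1 ;
  comp : C1 -> C1 -> C1 -> Prop }.

Section Categories.
Variables C1 C0 : Type.

Record is_cat (C : catData C1 C0) : Prop := IsCat {
  comp_def : forall g f, (exists h, comp C g f h) <-> tgt C f = src C g ;
  comp_uniq : forall g f h h', comp C g f h -> comp C g f h' -> h = h' ;
  comp_src : forall g f h, comp C g f h -> src C h = src C f ;
  comp_tgt : forall g f h, comp C g f h -> tgt C h = tgt C g ;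
  idt_src : forall x, src C (idt C x) = x ;
  idt_tgt : forall x, tgt C (idt C x) = x ;
  comp_idr : forall f, comp C f (idt C (src C f)) f ;
  comp_idl : forall f, comp C (idt C (tgt C f)) f f ;
  comp_assoc : forall h g f hg gf k l,
    comp C h g hg -> comp C g f gf ->
    comp C h gf k -> comp C hg f l -> k = l }.

Definition is_inverse (C : catData C1 C0) (f g : C1) : Prop :=
  comp C g f (idt C (src C f)) /\ comp C f g (idt C (tgt C f)).

Definition is_groupoid (C : catData C1 C0) : Prop :=
  is_cat C /\ forall f, exists g, is_inverse C f g.

Definition op_cat (C : catData C1 C0) : catData C1 C0 :=
  CatData (tgt C) (src C) (idt C) (fun g f h => comp C f g h).

End Categories.

Definition is_functor (C1 C0 D1 D0 : Type)
    (C : catData C1 C0) (D : catData D1 D0)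
    (F1 : C1 -> D1) (F0 : C0 -> D0) : Prop :=
  [/\ forall f, src D (F1 f) = F0 (src C f),
      forall f, tgt D (F1 f) = F0 (tgt C f),
      forall x, F1 (idt C x) = idt D (F0 x) &
      forall g f h, comp C g f h -> comp D (F1 g) (F1 f) (F1 h)].

Definition is_cat_iso (C1 C0 D1 D0 : Type)
    (C : catData C1 C0) (D : catData D1 D0)
    (F1 : C1 -> D1) (F0 : C0 -> D0) : Prop :=
  is_functor C D F1 F0 /\
  exists (G1 : D1 -> C1) (G0 : D0 -> C0),
    [/\ is_functor D C G1 G0, cancel F1 G1, cancel G1 F1,
        cancel F0 G0 & cancel G0 F0].

Definition pair_groupoid (A : Type) : catData (A * A) A :=
  CatData (fun p => p.2) (fun p => p.1) (fun x => (x, x))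
    (fun g f h => f.1 = g.2 /\ h = (g.1, f.2)).

Definition left_action_cat (K : pzRingType) : catData (K * K) K :=
  CatData (fun p => p.1 * p.2) (fun p => p.2) (fun t => (1, t))
    (fun g f h => f.2 = g.1 * g.2 /\ h = (f.1 * g.1, g.2)).

(* X x C and C x X, for a set X viewed as a category with only identities. *)
Definition cat_prodl (X C1 C0 : Type) (C : catData C1 C0) :
    catData (X * C1) (X * C0) :=
  CatData (fun f => (f.1, src C f.2)) (fun f => (f.1, tgt C f.2))
    (fun x => (x.1, idt C x.2))
    (fun g f h => [/\ f.1 = g.1, h.1 = g.1 & comp C g.2 f.2 h.2]).

Definition cat_prodr (C1 C0 X : Type) (C : catData C1 C0) :
    catData (C1 * X) (C0 * X) :=
  CatData (fun f => (src C f.1, f.2)) (fun f => (tgt C f.1, f.2))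
    (fun x => (idt C x.1, x.2))
    (fun g f h => [/\ f.2 = g.2, h.2 = g.2 & comp C g.1 f.1 h.1]).

Definition is_restriction (C1 C0 : Type) (C : catData C1 C0)
    (P1 : set C1) (P0 : set C0) (E : catData P1 P0) : Prop :=
  [/\ forall f, \val (src E f) = src C (\val f),
      forall f, \val (tgt E f) = tgt C (\val f),
      forall x, \val (idt E x) = idt C (\val x) &
      forall g f h, comp E g f h <-> comp C (\val g) (\val f) (\val h)].

(* star1 and star0 carry the structures (pi, z_pi, star), bul1 and bul0 the
   structures (partial, z_partial, bullet). *)
Record dcatData (C11 C10 C01 C00 : Type) := DcatData {
  star1 : catData C11 C01 ;
  star0 : catData C10 C00 ;
  bul1 : catData C11 C10 ;
  bul0 : catData C01 C00 }.

Section DoubleCategories.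
Variables C11 C10 C01 C00 : Type.

(* The functor conditions spell out that the partial_i and z_partial commute
   with pi_j and z_pi and preserve star, and that the pi_i and z_pi commute
   with partial_j and z_partial and preserve bullet. *)
Record is_dcat (D : dcatData C11 C10 C01 C00) : Prop := IsDcat {
  star1_cat : is_cat (star1 D) ;
  star0_cat : is_cat (star0 D) ;
  bul1_cat : is_cat (bul1 D) ;
  bul0_cat : is_cat (bul0 D) ;
  src_bul_functor :
    is_functor (star1 D) (star0 D) (src (bul1 D)) (src (bul0 D)) ;
  tgt_bul_functor :
    is_functor (star1 D) (star0 D) (tgt (bul1 D)) (tgt (bul0 D)) ;
  idt_bul_functor :
    is_functor (star0 D) (star1 D) (idt (bul1 D)) (idt (bul0 D)) ;
  src_star_functor :
    is_functor (bul1 D) (bul0 D) (src (star1 D)) (src (star0 D)) ;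
  tgt_star_functor :
    is_functor (bul1 D) (bul0 D) (tgt (star1 D)) (tgt (star0 D)) ;
  idt_star_functor :
    is_functor (bul0 D) (bul1 D) (idt (star1 D)) (idt (star0 D)) ;
  interchange : forall a b c d ab cd ac bd x y,
    comp (star1 D) a b ab -> comp (star1 D) c d cd ->
    comp (bul1 D) ab cd x ->
    comp (bul1 D) a c ac -> comp (bul1 D) b d bd ->
    comp (star1 D) ac bd y -> x = y }.

Definition is_dgroupoid (D : dcatData C11 C10 C01 C00) : Prop :=
  is_dcat D /\
  [/\ is_groupoid (star1 D), is_groupoid (star0 D),
      is_groupoid (bul1 D) & is_groupoid (bul0 D)].

Definition dcat_star_op (D : dcatData C11 C10 C01 C00) :
    dcatData C11 C10 C01 C00 :=
  DcatData (op_cat (star1 D)) (op_cat (star0 D)) (bul1 D) (bul0 D).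

End DoubleCategories.

Record dmap (C11 C10 C01 C00 D11 D10 D01 D00 : Type) := Dmap {
  m11 : C11 -> D11 ;
  m10 : C10 -> D10 ;
  m01 : C01 -> D01 ;
  m00 : C00 -> D00 }.

Section DoubleMorphisms.
Variables C11 C10 C01 C00 D11 D10 D01 D00 : Type.
Variables (C : dcatData C11 C10 C01 C00) (D : dcatData D11 D10 D01 D00).

Definition is_dmor (F : dmap C11 C10 C01 C00 D11 D10 D01 D00) : Prop :=
  [/\ is_functor (star1 C) (star1 D) (m11 F) (m01 F),
      is_functor (star0 C) (star0 D) (m10 F) (m00 F),
      is_functor (bul1 C) (bul1 D) (m11 F) (m10 F) &
      is_functor (bul0 C) (bul0 D) (m01 F) (m00 F)].

End DoubleMorphisms.

Definition is_diso (C11 C10 C01 C00 D11 D10 D01 D00 : Type)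
    (C : dcatData C11 C10 C01 C00) (D : dcatData D11 D10 D01 D00)
    (F : dmap C11 C10 C01 C00 D11 D10 D01 D00) : Prop :=
  is_dmor C D F /\
  exists G : dmap D11 D10 D01 D00 C11 C10 C01 C00,
    [/\ is_dmor D C G,
        cancel (m11 F) (m11 G) /\ cancel (m11 G) (m11 F),
        cancel (m10 F) (m10 G) /\ cancel (m10 G) (m10 F),
        cancel (m01 F) (m01 G) /\ cancel (m01 G) (m01 F) &
        cancel (m00 F) (m00 G) /\ cancel (m00 G) (m00 F)].

Definition dcat_prod (G1 A H1 B : Type)
    (G : catData G1 A) (H : catData H1 B) :
    dcatData (G1 * H1) (G1 * B) (A * H1) (A * B) :=
  DcatData (cat_prodr H1 G) (cat_prodr B G) (cat_prodl G1 H) (cat_prodl A H).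

Definition is_drestriction (C11 C10 C01 C00 : Type)
    (D : dcatData C11 C10 C01 C00)
    (P11 : set C11) (P10 : set C10) (P01 : set C01) (P00 : set C00)
    (E : dcatData P11 P10 P01 P00) : Prop :=
  [/\ is_restriction (star1 D) (star1 E), is_restriction (star0 D) (star0 E),
      is_restriction (bul1 D) (bul1 E) & is_restriction (bul0 D) (bul0 E)].

Definition one_to_one (X Y : Type) (A : set X) (B : set Y)
    (R : X -> Y -> Prop) : Prop :=
  (forall x, A x -> exists! y, B y /\ R x y) /\
  (forall y, B y -> exists! x, A x /\ R x y).

Section OverK.
Variables (K : pzRingType) (X C11 C10 : Type).
Variable D : dcatData C11 C10 (X * (K * K)) (X * K).

(* The value of (s,t) on C11 and of t on C10 is read off at the source. *)
Definition unit_part11 : set C11 :=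
  [set a | units K (src (star1 D) a).2.1 /\ units K (src (star1 D) a).2.2].
Definition unit_part10 : set C10 :=
  [set a | units K (src (star0 D) a).2].
Definition unit_part01 : set (X * (K * K)) :=
  [set x | units K x.2.1 /\ units K x.2.2].
Definition unit_part00 : set (X * K) := [set x | units K x.2].

Definition is_unit_part
    (E : dcatData unit_part11 unit_part10 unit_part01 unit_part00) : Prop :=
  is_drestriction D E.

(* E is the fiber over (s,t) of the star-category C11 => X x K^2. *)
Definition is_fiber (s t : K)
    (E : catData [set a | (src (star1 D) a).2 = (s, t)] X) : Prop :=
  [/\ forall a, src (star1 D) (\val a) = (src E a, (s, t)),
      forall a, tgt (star1 D) (\val a) = (tgt E a, (s, t)),
      forall x, \val (idt E x) = idt (star1 D) (x, (s, t)) &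
      forall b a c, comp E b a c <->
        comp (star1 D) (\val b) (\val a) (\val c)].

Definition dmap_to_pairs : Type :=
  dmap unit_part11 unit_part10 unit_part01 unit_part00
    ((X * X) * (units K * units K)) ((X * X) * units K)
    (X * (units K * units K)) (X * units K).

Definition pairs_dcat :=
  dcat_prod (pair_groupoid X) (pair_groupoid (units K)).

(* The map sending an arrow to its target and source; on scalars,
   (s,t) goes to the pair with target t and source st. *)
Definition is_anchor (F : dmap_to_pairs) : Prop :=
  [/\ forall a, (m11 F a).1 =
        ((tgt (star1 D) (\val a)).1, (src (star1 D) (\val a)).1) /\
        let st := (src (star1 D) (\val a)).2 in
        \val (m11 F a).2.1 = st.2 /\ \val (m11 F a).2.2 = st.1 * st.2,
      forall a, (m10 F a).1 =
        ((tgt (star0 D) (\val a)).1, (src (star0 D) (\val a)).1) /\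
        \val (m10 F a).2 = (src (star0 D) (\val a)).2,
      forall x, (m01 F x).1 = (\val x).1 /\
        \val (m01 F x).2.1 = (\val x).2.2 /\
        \val (m01 F x).2.2 = (\val x).2.1 * (\val x).2.2 &
      forall x, (m00 F x).1 = (\val x).1 /\ \val (m00 F x).2 = (\val x).2].

End OverK.

Arguments unit_part01 K X : clear implicits.
Arguments unit_part00 K X : clear implicits.
Arguments is_unit_part {K X C11 C10} D E.
Arguments is_fiber {K X C11 C10} D s t E.
Arguments is_anchor {K X C11 C10} D F.

Definition trivial_over (K X Y C11 C10 D11 D10 : Type) (f : X -> Y)
    (F : dmap C11 C10 (X * (K * K)) (X * K) D11 D10 (Y * (K * K)) (Y * K)) :
    Prop :=
  (forall x, m01 F x = (f x.1, x.2)) /\ (forall x, m00 F x = (f x.1, x.2)).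

Definition trivial_on_K (K X Y C11 C10 D11 D10 : Type)
    (F : dmap C11 C10 (X * (K * K)) (X * K) D11 D10 (Y * (K * K)) (Y * K)) :
    Prop :=
  exists f : X -> Y, trivial_over f F.

Definition to_sub (T : Type) (A : set T) (x : T) (h : A x) : A :=
  exist _ x (mem_set h).

Section LinearSet.
Variables (K : pzRingType) (V : lmodType K^c) (U : set V).

(* The triple (x,v;t) is ((x, v), t), the quadruple (x,v;s,t) is
   ((x, v), (s, t)). *)
Definition ext1 : set (V * V * K) :=
  [set a | U a.1.1 /\ U (a.1.1 + a.1.2 ⋅ a.2)].

Definition ext11 : set (V * V * (K * K)) :=
  [set a | U a.1.1 /\ U (a.1.1 + a.1.2 ⋅ a.2.1 ⋅ a.2.2)].

Lemma ext1_source (a : ext1) : U (\val a).1.1.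
Proof. by case: (set_valP a). Qed.

Lemma ext1_target (a : ext1) : U ((\val a).1.1 + (\val a).1.2 ⋅ (\val a).2).
Proof. by case: (set_valP a). Qed.

Lemma ext11_source (a : ext11) : U (\val a).1.1.
Proof. by case: (set_valP a). Qed.

Lemma ext11_target (a : ext11) :
  U ((\val a).1.1 + (\val a).1.2 ⋅ (\val a).2.1 ⋅ (\val a).2.2).
Proof. by case: (set_valP a). Qed.

Definition start1 (a : ext1) : U := to_sub (ext1_source a).
Definition end1 (a : ext1) : U := to_sub (ext1_target a).
Definition start11 (a : ext11) : U := to_sub (ext11_source a).
Definition end11 (a : ext11) : U := to_sub (ext11_target a).

Lemma partial0_subproof (a : ext11) :
  ext1 ((\val a).1, (\val a).2.1 * (\val a).2.2).
Proof. by split=> /=; [exact: ext11_source|rewrite -rscaleA; exact: ext11_target]. Qed.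

Lemma partial1_subproof (a : ext11) :
  ext1 (((\val a).1.1, (\val a).1.2 ⋅ (\val a).2.1), (\val a).2.2).
Proof. by split=> /=; [exact: ext11_source|exact: ext11_target]. Qed.

Lemma zpi1_subproof (x : U * K) : ext1 ((\val x.1, 0), x.2).
Proof. by split=> /=; rewrite ?rscale0l ?addr0; exact: set_valP. Qed.

Lemma zpi11_subproof (x : U * (K * K)) : ext11 ((\val x.1, 0), x.2).
Proof. by split=> /=; rewrite ?rscale0l ?addr0; exact: set_valP. Qed.

Lemma zpartial_subproof (a : ext1) : ext11 ((\val a).1, (1, (\val a).2)).
Proof.
by split=> /=; [exact: ext1_source|rewrite rscale1; exact: ext1_target].
Qed.

Definition partial0 (a : ext11) : ext1 := to_sub (partial0_subproof a).
Definition partial1 (a : ext11) : ext1 := to_sub (partial1_subproof a).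

Definition lin_star1 : catData ext11 (U * (K * K)) :=
  CatData (fun a => (start11 a, (\val a).2)) (fun a => (end11 a, (\val a).2))
    (fun x => to_sub (zpi11_subproof x))
    (fun a' a b =>
       [/\ \val (start11 a') = \val (end11 a),
           (\val a').2 = (\val a).2 &
           \val b = (((\val a).1.1, (\val a).1.2 + (\val a').1.2),
                     (\val a).2)]).

Definition lin_star0 : catData ext1 (U * K) :=
  CatData (fun a => (start1 a, (\val a).2)) (fun a => (end1 a, (\val a).2))
    (fun x => to_sub (zpi1_subproof x))
    (fun a' a b =>
       [/\ \val (start1 a') = \val (end1 a),
           (\val a').2 = (\val a).2 &
           \val b = (((\val a).1.1, (\val a).1.2 + (\val a').1.2),
                     (\val a).2)]).

Definition lin_bul1 : catData ext11 ext1 :=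
  CatData partial0 partial1 (fun a => to_sub (zpartial_subproof a))
    (fun a' a b =>
       let: ((x', v'), (s', t')) := \val a' in
       let: ((x, v), (s, t)) := \val a in
       [/\ x' = x, v' = v ⋅ s, t = s' * t' &
           \val b = ((x, v), (s * s', t'))]).

Definition lin_bul0 : catData (U * (K * K)) (U * K) :=
  cat_prodl U (left_action_cat K).

Definition lin_dcat : dcatData ext11 ext1 (U * (K * K)) (U * K) :=
  DcatData lin_star1 lin_star0 lin_bul1 lin_bul0.

Lemma inv1_subproof (a : ext1) :
  ext1 ((\val (end1 a), - (\val a).1.2), (\val a).2).
Proof.
by split=> /=; [exact: ext1_target|rewrite rscaleNl addrK; exact: ext1_source].
Qed.

Lemma inv11_subproof (a : ext11) :
  ext11 ((\val (end11 a), - (\val a).1.2), (\val a).2).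
Proof.
split=> /=; first exact: ext11_target.
by rewrite !rscaleNl addrK; exact: ext11_source.
Qed.

Definition lin_inversion :
    dmap ext11 ext1 (U * (K * K)) (U * K) ext11 ext1 (U * (K * K)) (U * K) :=
  Dmap (fun a => to_sub (inv11_subproof a)) (fun a => to_sub (inv1_subproof a))
    id id.

Variable W : lmodType K^c.

Definition difference_factorizer (f : U -> W) (f1 : ext1 -> W) : Prop :=
  forall a, f (end1 a) - f (start1 a) = f1 a ⋅ (\val a).2.

(* f^{1}(x,v;t) and f^{11}(x,v;s,t). *)
Definition ext1_fun (f : U -> W) (f1 : ext1 -> W) (a : ext1) : W * W * K :=
  ((f (start1 a), f1 a), (\val a).2).

Definition ext11_fun (f : U -> W) (f1 : ext1 -> W) (a : ext11) :
    W * W * (K * K) :=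
  ((f (start11 a), f1 (partial0 a)), (\val a).2).

Definition factorizer_additive (f1 : ext1 -> W) : Prop :=
  forall (x v v' : V) (t : K) (a b c : ext1),
    \val a = ((x, v), t) -> \val b = ((x + v ⋅ t, v'), t) ->
    \val c = ((x, v + v'), t) -> f1 c = f1 b + f1 a.

Definition factorizer_homogeneous (f1 : ext1 -> W) : Prop :=
  forall (x v : V) (s t : K) (a b : ext1),
    \val a = ((x, v), s * t) -> \val b = ((x, v ⋅ s), t) ->
    f1 b = f1 a ⋅ s.

End LinearSet.

Definition lin_dmap (K : pzRingType) (V W : lmodType K^c)
    (U : set V) (U' : set W) : Type :=
  dmap (ext11 U) (ext1 U) (U * (K * K)) (U * K)
    (ext11 U') (ext1 U') (U' * (K * K)) (U' * K).

Definition to_setT (X W : Type) (f : X -> W) : X -> [set: W] :=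
  fun x => to_sub (I : [set: W] (f x)).

(* F is the morphism into the full linear set W given by (f, f1). *)
Definition given_by (K : pzRingType) (V W : lmodType K^c) (U : set V)
    (f : U -> W) (f1 : ext1 U -> W) (F : lin_dmap U [set: W]) : Prop :=
  [/\ trivial_over (to_setT f) F,
      forall a, \val (m10 F a) = ext1_fun f f1 a &
      forall a, \val (m11 F a) = ext11_fun f f1 a].

Definition homeomorphism (X Y : topologicalType) (h : X -> Y) : Prop :=
  continuous h /\
  exists g : Y -> X, [/\ continuous g, cancel h g & cancel g h].

Definition continuous_cat (C1 C0 : topologicalType) (C : catData C1 C0) :
    Prop :=
  [/\ continuous (src C), continuous (tgt C), continuous (idt C) &
      exists m : [set gf : C1 * C1 | tgt C gf.2 = src C gf.1] -> C1,
        continuous m /\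
        forall gf, comp C (\val gf).1 (\val gf).2 (m gf)].

Definition continuous_groupoid (C1 C0 : topologicalType) (C : catData C1 C0) :
    Prop :=
  [/\ is_groupoid C, continuous_cat C &
      exists i : C1 -> C1, continuous i /\ forall f, is_inverse C f (i f)].

Definition continuous_dcat (C11 C10 C01 C00 : topologicalType)
    (D : dcatData C11 C10 C01 C00) : Prop :=
  [/\ continuous_cat (star1 D), continuous_cat (star0 D),
      continuous_cat (bul1 D) & continuous_cat (bul0 D)].

Definition continuous_dmap (C11 C10 C01 C00 D11 D10 D01 D00 : topologicalType)
    (F : dmap C11 C10 C01 C00 D11 D10 D01 D00) : Prop :=
  [/\ continuous (m11 F), continuous (m10 F), continuous (m01 F) &
      continuous (m00 F)].

(* The pieces X i are glued along the transition relations R i j; a point of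
   the glued space is the class of all (j, b) with R i j a b. *)
Section Gluing.
Variables (I : Type) (T : topologicalType) (X : I -> set T).
Variable R : I -> I -> T -> T -> Prop.

Definition glue_class (i : I) (a : T) : set (I * T) :=
  [set jb | X jb.1 jb.2 /\ R i jb.1 a jb.2].

Definition glued : Type :=
  {C : set (I * T) | exists (i : I) (a : X i), C = glue_class i (\val a)}.

Definition glue (i : I) (a : X i) : glued :=
  exist _ (glue_class i (\val a)) (ex_intro _ i (ex_intro _ a erefl)).

HB.instance Definition _ := gen_eqMixin glued.
HB.instance Definition _ := gen_choiceMixin glued.

(* The topology generated by the images of the open sets of the pieces. *)
HB.instance Definition _ := isSubBaseTopological.Build glued
  [set O | exists (i : I) (P : set (X i)), open P /\ O = @glue i @` P] id.

End Gluing.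

Definition C1 (K : topologicalRingType) (V W : topologicalRmodType K)
    (U : set V) (f : U -> W) : Prop :=
  exists f1 : ext1 U -> W, difference_factorizer f f1 /\ continuous f1.

(* The values of the two maps outside of the domain and codomain are
   irrelevant. *)
Record chart (M V : Type) := Chart {
  cdom : set M ;
  ccod : set V ;
  cfun : M -> V ;
  cinv : V -> M }.

Definition prod_chart (M V N W : Type) (c : chart M V) (d : chart N W) :
    chart (M * N) (V * W) :=
  Chart (cdom c `*` cdom d) (ccod c `*` ccod d)
    (fun p => (cfun c p.1, cfun d p.2)) (fun x => (cinv c x.1, cinv d x.2)).

Section Manifolds.
Variables (K : topologicalRingType) (V : topologicalRmodType K).
Variable M : topologicalType.

Record is_chart (c : chart M V) : Prop := IsChart {
  cdom_neq0 : cdom c !=set0 ;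
  cdom_open : open (cdom c) ;
  ccod_open : open (ccod c) ;
  cfun_cod : forall p, cdom c p -> ccod c (cfun c p) ;
  cinv_dom : forall x, ccod c x -> cdom c (cinv c x) ;
  cfunK : forall p, cdom c p -> cinv c (cfun c p) = p ;
  cinvK : forall x, ccod c x -> cfun c (cinv c x) = x ;
  cfun_continuous : {within cdom c, continuous (cfun c)} ;
  cinv_continuous : {within ccod c, continuous (cinv c)} }.

Definition trans_dom (c d : chart M V) : set V :=
  [set x | ccod c x /\ cdom d (cinv c x)].

Definition trans (c d : chart M V) (x : trans_dom c d) : V :=
  cfun d (cinv c (\val x)).

Definition compatible (c d : chart M V) : Prop :=
  C1 (@trans c d) /\ C1 (@trans d c).

Record is_manifold (A : set (chart M V)) : Prop := IsManifold {
  manifold_hausdorff : hausdorff_space M ;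
  atlas_chart : forall c, A c -> is_chart c ;
  atlas_cover : forall p, exists2 c, A c & cdom c p ;
  atlas_compatible : forall c d, A c -> A d -> compatible c d ;
  atlas_maximal : forall c, is_chart c ->
    (forall d, A d -> compatible c d) -> A c }.

(* Composing arrows p -> q -> r of the glued double category in a chart needs a
   (possibly disconnected) chart domain containing p, q and r. Over a general
   topological ring C^1 is not a local condition (the disjoint union of two
   C^1-maps need not be C^1), so that such charts do not come for free. *)
Definition finitely_charted (A : set (chart M V)) : Prop :=
  forall S : set M, finite_set S -> S !=set0 ->
    exists2 c, A c & S `<=` cdom c.

(* (c,a) and (d,b) represent the same point: b is the image of a under the
   extension of the transition map. *)
Definition trans1 (c d : chart M V) (a b : V * V * K) : Prop :=
  exists g : ext1 (trans_dom c d) -> V,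
    [/\ difference_factorizer (@trans c d) g, continuous g &
        exists2 a' : ext1 (trans_dom c d), \val a' = a &
          b = ext1_fun (@trans c d) g a'].

Definition trans11 (c d : chart M V) (a b : V * V * (K * K)) : Prop :=
  exists g : ext1 (trans_dom c d) -> V,
    [/\ difference_factorizer (@trans c d) g, continuous g &
        exists2 a' : ext11 (trans_dom c d), \val a' = a &
          b = ext11_fun (@trans c d) g a'].

(* The tangent map (x,v) |-> (phi(x), d phi(x) v), d phi(x) v being the value
   of the factorizer at (x,v,0). *)
Definition transT (c d : chart M V) (a b : V * V) : Prop :=
  exists g : ext1 (trans_dom c d) -> V,
    [/\ difference_factorizer (@trans c d) g, continuous g &
        exists2 a' : ext1 (trans_dom c d), \val a' = (a, 0) &
          b = (trans (start1 a'), g a')].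

Variable A : set (chart M V).

Definition tangent_piece (U : set V) : set (V * V) := [set a | U a.1].

Definition piece1 (c : A) : set (V * V * K) := ext1 (ccod (\val c)).
Definition piece11 (c : A) : set (V * V * (K * K)) := ext11 (ccod (\val c)).
Definition pieceT (c : A) : set (V * V) := tangent_piece (ccod (\val c)).

Definition M1 : Type :=
  glued piece1 (fun c d : A => trans1 (\val c) (\val d)).
Definition M11 : Type :=
  glued piece11 (fun c d : A => trans11 (\val c) (\val d)).
Definition TM : Type :=
  glued pieceT (fun c d : A => transT (\val c) (\val d)).

HB.instance Definition _ := Topological.copy M1 (glued _ _).
HB.instance Definition _ := Topological.copy M11 (glued _ _).
HB.instance Definition _ := Topological.copy TM (glued _ _).

Definition chart1 (c : A) (a : ext1 (ccod (\val c))) : M1 :=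
  @glue _ _ piece1 _ c a.
Definition chart11 (c : A) (a : ext11 (ccod (\val c))) : M11 :=
  @glue _ _ piece11 _ c a.
Definition chartT (c : A) (a : tangent_piece (ccod (\val c))) : TM :=
  @glue _ _ pieceT _ c a.

Definition mdcatData : Type := dcatData M11 M1 (M * (K * K)) (M * K).

Definition chart_dmap (c : A) :=
  Dmap (@chart11 c) (@chart1 c)
    (fun x : ccod (\val c) * (K * K) => (cinv (\val c) (\val x.1), x.2))
    (fun x : ccod (\val c) * K => (cinv (\val c) (\val x.1), x.2)).

(* D is the double category over M x K glued from those of the charts. *)
Definition is_glued_dcat (D : mdcatData) : Prop :=
  is_dcat D /\
  forall c : A, is_dmor (lin_dcat (ccod (\val c))) D (chart_dmap c).

(* The bundle U x V => U of additive groups. *)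
Lemma tangent_zero_subproof (U : set V) (x : U) :
  tangent_piece U (\val x, 0).
Proof. exact: set_valP. Qed.

Definition tangent_start (U : set V) (a : tangent_piece U) : U :=
  to_sub (set_valP a : U (\val a).1).

Definition tangent_cat (U : set V) : catData (tangent_piece U) U :=
  CatData (@tangent_start U) (@tangent_start U)
    (fun x => to_sub (tangent_zero_subproof x))
    (fun b a c => (\val b).1 = (\val a).1 /\
       \val c = ((\val a).1, (\val a).2 + (\val b).2)).

(* T is the tangent bundle TM as a bundle of additive groups over M. *)
Definition is_tangent_bundle (T : catData TM M) : Prop :=
  is_cat T /\
  forall c : A, is_functor (tangent_cat (ccod (\val c))) T (@chartT c)
    (fun x => cinv (\val c) (\val x)).

End Manifolds.

Section ManifoldMaps.
Variable K : topologicalRingType.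
Variables (V W : topologicalRmodType K) (M N : topologicalType).
Variables (A : set (chart M V)) (B : set (chart N W)).

Definition local_dom (f : M -> N) (c : chart M V) (d : chart N W) : set V :=
  [set x | ccod c x /\ cdom d (f (cinv c x))].

Definition local_map (f : M -> N) (c : chart M V) (d : chart N W)
    (x : local_dom f c d) : W :=
  cfun d (f (cinv c (\val x))).

Definition C1_manifold (f : M -> N) : Prop :=
  continuous f /\
  forall c d, A c -> B d -> C1 (@local_map f c d).

Definition mdmap : Type :=
  dmap (M11 A) (M1 A) (M * (K * K)) (M * K)
    (M11 B) (M1 B) (N * (K * K)) (N * K).

Definition is_cont_mor (DA : mdcatData A) (DB : mdcatData B) (F : mdmap) :
    Prop :=
  is_dmor DA DB F /\ continuous_dmap F.

(* F is given in the charts c and d by the extensions of the local map. *)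
Definition given_in_charts (f : M -> N) (F : mdmap) : Prop :=
  forall (c : A) (d : B) (g : ext1 (local_dom f (\val c) (\val d)) -> W),
    difference_factorizer (@local_map f (\val c) (\val d)) g ->
    continuous g ->
    (forall (a : ext1 (local_dom f (\val c) (\val d)))
        (a' : ext1 (ccod (\val c))) (b : ext1 (ccod (\val d))),
      \val a' = \val a ->
      \val b = ext1_fun (@local_map f (\val c) (\val d)) g a ->
      m10 F (chart1 a') = chart1 b) /\
    (forall (a : ext11 (local_dom f (\val c) (\val d)))
        (a' : ext11 (ccod (\val c))) (b : ext11 (ccod (\val d))),
      \val a' = \val a ->
      \val b = ext11_fun (@local_map f (\val c) (\val d)) g a ->
      m11 F (chart11 a') = chart11 b).

Definition fiber_product (DA : mdcatData A) (DB : mdcatData B) :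
    set (M11 A * M11 B) :=
  [set ab | (src (star1 DA) ab.1).2 = (src (star1 DB) ab.2).2].

End ManifoldMaps.

(* Theta is the isomorphism of bundles over M x N x K^2 whose components are
   induced by the two projections. *)
Definition is_product_iso (K : topologicalRingType)
    (V W : topologicalRmodType K) (M N : topologicalType)
    (A : set (chart M V)) (B : set (chart N W))
    (P : set (chart (M * N)%type (V * W)%type))
    (DA : mdcatData A) (DB : mdcatData B) (DP : mdcatData P)
    (Theta : M11 P -> fiber_product DA DB) : Prop :=
  [/\ homeomorphism Theta,
      forall z, src (star1 DP) z =
        (((src (star1 DA) (\val (Theta z)).1).1,
          (src (star1 DB) (\val (Theta z)).2).1),
         (src (star1 DA) (\val (Theta z)).1).2),
      forall z, tgt (star1 DP) z =
        (((tgt (star1 DA) (\val (Theta z)).1).1,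
          (tgt (star1 DB) (\val (Theta z)).2).1),
         (tgt (star1 DA) (\val (Theta z)).1).2) &
      exists (F1 : mdmap P A) (F2 : mdmap P B),
        [/\ is_cont_mor DP DA F1 /\ trivial_over fst F1,
            is_cont_mor DP DB F2 /\ trivial_over snd F2 &
            forall z, \val (Theta z) = (m11 F1 z, m11 F2 z)]].

Arguments is_product_iso {K V W M N A B P} DA DB DP Theta.

(* Main.v *)
(** Everything rests on the continuous difference factorizer of a map on an open
    set being unique: it is determined where t is a unit, and such t are dense.
    Additivity, homogeneity and the chain rule for factorizers follow in the
    same way, so that transition maps are functors between the double categories
    of chart domains. Moreover C^1 is a property of pairs of points x, x + vt,
    hence charts containing any finitely many given points suffice to compose
    arrows, to compare atlases, and to recover a C^1-map from a morphism.
    All of M11 is controlled by M1: an arrow of M11 is an arrow of M1 with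
    parameter st together with (s,t), so M11 = M1 x_K K^2, and TM is the part of
    M1 over 0. Where the parameter u is a unit, an arrow from x to y exists and
    is unique, v being (y - x) u^-1; this gives the pair groupoids. *)
Require Import Defs.
From HB Require Import structures.
From mathcomp Require Import all_boot all_order all_algebra.
From mathcomp Require Import all_classical topology pseudometric_normed_Zmodule.

Set Implicit Arguments.
Unset Strict Implicit.
Unset Printing Implicit Defensive.

Import GRing.Theory.

Local Open Scope classical_set_scope.
Local Open Scope ring_scope.

Local Notation comp := Defs.comp.

(** * Categories and groupoids *)

(** Factorizers have domains that change with every chart and every restriction. The calculus is
    therefore done with total functions and continuity at a point, and the subtypes of the
    definitions are reached through a few bridging lemmas. A structure map of a glued space is
    typically not descended through a quotient: a value is exhibited that satisfies the coordinate
    formula in all charts at once, choice turns this into a function, and continuity is checked in a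
    single chart. The assertions concern an arbitrary double category glued from charts. Such a
    structure is unique, because not only arrows but also composable pairs of arrows are visible in
    a single chart; so everything is proved for one explicit model. Over a topological division ring
    the difference quotient is continuous for nonzero [t], which makes C^1 a local property. A chart
    around finitely many points can then be assembled from restrictions of charts with disjoint
    domains, after translating their images apart; room for the translation exists because a nonzero
    Hausdorff module over such a ring is infinite. *)

Lemma val_sub_inj (T : Type) (A : set T) (x y : A) : \val x = \val y -> x = y.
Proof. exact: val_inj. Qed.

Lemma prod_eq (A B : Type) (p q : A * B) : p.1 = q.1 -> p.2 = q.2 -> p = q.
Proof. by case: p q => [a b] [c d] /= -> ->. Qed.

Lemma choiceP (A B : Type) (R : A -> B -> Prop) :
  (forall x, exists y, R x y) -> exists f, forall x, R x (f x).
Proof. by move=> /boolp.choice [f fP]; exists f. Qed.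

(** One inclusion between the composition relations suffices: composability depends only on sources
    and targets, which agree, and composites in [D] are unique, so every composite of [D] already is
    one of [C]. *)
Lemma catData_eq (C1 C0 : Type) (C D : catData C1 C0) :
  is_cat C -> is_cat D -> (forall f, src C f = src D f) ->
  (forall f, tgt C f = tgt D f) -> (forall x, idt C x = idt D x) ->
  (forall g f h, comp C g f h -> comp D g f h) -> C = D.
Proof.
case: C => s t i c; case: D => s' t' i' c' hC hD /= es et ei ec.
have E : s = s' by apply/funext => f; exact: es.
have F : t = t' by apply/funext => f; exact: et.
have G : i = i' by apply/funext => f; exact: ei.
subst s' t' i'; congr CatData; apply/funext => g; apply/funext => f.
apply/funext => h; apply/propext; split; first exact: ec.
move=> H; have : t f = s g by apply/(comp_def hD); exists h.
move/(comp_def hC) => /= [k Hk]; move: (Hk) => /ec /=.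
by move=> /(comp_uniq hD H) ->.
Qed.

Section CategoryLemmas.
Variables (C1 C0 D1 D0 : Type) (C : catData C1 C0) (D : catData D1 D0).

(** Injectivity on objects makes [g] and [f] composable, and injectivity on arrows then identifies
    their composite with [h]. *)
Lemma functor_reflect_comp (F1 : C1 -> D1) (F0 : C0 -> D0) g f h :
  is_cat C -> is_cat D -> is_functor C D F1 F0 -> injective F1 ->
  injective F0 -> comp D (F1 g) (F1 f) (F1 h) -> comp C g f h.
Proof.
move=> hC hD [Fs Ft Fi Fc] i1 i0 H.
have : tgt C f = src C g.
  by apply: i0; rewrite -Fs -Ft; apply/(comp_def hD); exists (F1 h).
by move=> /(comp_def hC) [k kP]; rewrite -(i1 _ _ (comp_uniq hD (Fc _ _ _ kP) H)).
Qed.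

(** An isomorphism of categories needs an inverse of the underlying maps only: since compositions
    are reflected, the inverse maps form a functor by themselves. *)
Lemma functor_inv (F1 : C1 -> D1) (F0 : C0 -> D0) (G1 : D1 -> C1)
    (G0 : D0 -> C0) :
  is_cat C -> is_cat D -> is_functor C D F1 F0 ->
  cancel F1 G1 -> cancel G1 F1 -> cancel F0 G0 -> cancel G0 F0 ->
  is_functor D C G1 G0.
Proof.
move=> hC hD F FG1 GF1 FG0 GF0; have [Fs Ft Fi Fc] := F.
split.
- by move=> f; apply: (can_inj FG0); rewrite -Fs GF1 GF0.
- by move=> f; apply: (can_inj FG0); rewrite -Ft GF1 GF0.
- by move=> x; apply: (can_inj FG1); rewrite Fi GF1 GF0.
- move=> g f h H; apply: (functor_reflect_comp hC hD F); try exact: can_inj.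
  by rewrite !GF1.
Qed.

Lemma groupoid_transport (F1 : C1 -> D1) (F0 : C0 -> D0) (G1 : D1 -> C1)
    (G0 : D0 -> C0) :
  is_cat C -> is_groupoid D -> is_functor C D F1 F0 ->
  cancel F1 G1 -> cancel G1 F1 -> cancel F0 G0 -> cancel G0 F0 ->
  is_groupoid C.
Proof.
move=> hC [hD inv] F FG1 GF1 FG0 GF0; split=> // f.
have [Gs Gt Gi Gc] := functor_inv hC hD F FG1 GF1 FG0 GF0.
have [g [gf fg]] := inv (F1 f); exists (G1 g).
split.
  by move/Gc: gf; rewrite FG1 Gi -Gs FG1.
by move/Gc: fg; rewrite FG1 Gi -Gt FG1.
Qed.

(** Pulls the category axioms back along an injection whose image is closed under composition. This
    is how unit parts, the tangent bundle and the fibers become categories. *)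
Lemma functor_inj_cat (F1 : C1 -> D1) (F0 : C0 -> D0) :
  is_cat D ->
  (forall f, src D (F1 f) = F0 (src C f)) ->
  (forall f, tgt D (F1 f) = F0 (tgt C f)) ->
  (forall x, F1 (idt C x) = idt D (F0 x)) ->
  (forall g f h, comp C g f h <-> comp D (F1 g) (F1 f) (F1 h)) ->
  (forall g f h, comp D (F1 g) (F1 f) h -> exists k, h = F1 k) ->
  injective F1 -> injective F0 -> is_cat C.
Proof.
move=> hD Fs Ft Fi Fc Fcl i1 i0; split.
- move=> g f; split.
    move=> [h /Fc H]; apply: i0; rewrite -Fs -Ft.
    by apply/(comp_def hD); exists (F1 h).
  move=> e; have : tgt D (F1 f) = src D (F1 g) by rewrite Fs Ft e.
  move=> /(comp_def hD) [h H]; have [k kE] := Fcl _ _ _ H.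
  by exists k; apply/Fc; rewrite -kE.
- by move=> g f h h' /Fc H /Fc H'; apply: i1; exact: comp_uniq H H'.
- by move=> g f h /Fc /(comp_src hD); rewrite !Fs => /i0.
- by move=> g f h /Fc /(comp_tgt hD); rewrite !Ft => /i0.
- by move=> x; apply: i0; rewrite -Fs Fi (idt_src hD).
- by move=> x; apply: i0; rewrite -Ft Fi (idt_tgt hD).
- by move=> f; apply/Fc; rewrite Fi -Fs; exact: comp_idr.
- by move=> f; apply/Fc; rewrite Fi -Ft; exact: comp_idl.
- move=> h g f hg gf k l /Fc a /Fc b /Fc c /Fc d; apply: i1.
  exact: (comp_assoc hD a b c d).
Qed.

Lemma functor_comp (E1 E0 : Type) (E : catData E1 E0) (F1 : C1 -> D1)
    (F0 : C0 -> D0) (G1 : D1 -> E1) (G0 : D0 -> E0) :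
  is_functor C D F1 F0 -> is_functor D E G1 G0 ->
  is_functor C E (G1 \o F1) (G0 \o F0).
Proof.
move=> [a b c d] [a' b' c' d']; split=> /=.
- by move=> f; rewrite a' a.
- by move=> f; rewrite b' b.
- by move=> f; rewrite c c'.
- by move=> g f h /d /d'.
Qed.

End CategoryLemmas.

Lemma pair_groupoid_groupoid (A : Type) : is_groupoid (pair_groupoid A).
Proof.
split.
  split=> /=.
  - by move=> g f; split=> [[h []//]|e]; exists (g.1, f.2).
  - by move=> g f h h' [_ ->] [_ ->].
  - by move=> g f h [_ ->].
  - by move=> g f h [_ ->].
  - by [].
  - by [].
  - by case.
  - by case.
  - by move=> h g f hg gf k l [_ ->] [_ ->] [_ ->] [_ ->].
by move=> [x y]; exists (y, x); split.
Qed.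

Lemma cat_prodl_cat (X C1 C0 : Type) (C : catData C1 C0) :
  is_cat C -> is_cat (cat_prodl X C).
Proof.
move=> hC; split=> /=.
- move=> g f; split.
    move=> [h [e1 e2 H]]; rewrite e1; congr pair.
    by apply/(comp_def hC); exists h.2.
  move=> [e1 e]; have /(comp_def hC) [h H] := e.
  by exists (g.1, h).
- move=> g f [x h] [x' h'] /= [_ -> H] [_ -> H']; congr pair.
  exact: comp_uniq H H'.
- by move=> g f h [<- -> /(comp_src hC) ->].
- by move=> g f h [_ -> /(comp_tgt hC) ->].
- by move=> [x y] /=; rewrite (idt_src hC).
- by move=> [x y] /=; rewrite (idt_tgt hC).
- by move=> [x f]; split=> //=; exact: comp_idr.
- by move=> [x f]; split=> //=; exact: comp_idl.
- move=> h g f [y hg] [z gf] [x k] [x' l] /= [e1 e2 a] [e3 e4 b] [e5 e6 c].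
  by move=> [e7 e8 d]; rewrite e6 e8 e2 (comp_assoc hC a b c d).
Qed.

Lemma cat_prodr_cat (X C1 C0 : Type) (C : catData C1 C0) :
  is_cat C -> is_cat (cat_prodr X C).
Proof.
move=> hC; split=> /=.
- move=> g f; split.
    move=> [h [e1 e2 H]]; rewrite e1; congr pair.
    by apply/(comp_def hC); exists h.1.
  move=> [e e1]; have /(comp_def hC) [h H] := e.
  by exists (h, g.2).
- move=> g f [h x] [h' x'] /= [_ -> H] [_ -> H']; congr pair.
  exact: comp_uniq H H'.
- by move=> g f h [<- -> /(comp_src hC) ->].
- by move=> g f h [_ -> /(comp_tgt hC) ->].
- by move=> [x y] /=; rewrite (idt_src hC).
- by move=> [x y] /=; rewrite (idt_tgt hC).
- by move=> [x f]; split=> //=; exact: comp_idr.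
- by move=> [x f]; split=> //=; exact: comp_idl.
- move=> h g f [hg y] [gf z] [k x] [l x'] /= [e1 e2 a] [e3 e4 b] [e5 e6 c].
  by move=> [e7 e8 d]; rewrite e6 e8 e2 (comp_assoc hC a b c d).
Qed.

Lemma cat_prodl_groupoid (X C1 C0 : Type) (C : catData C1 C0) :
  is_groupoid C -> is_groupoid (cat_prodl X C).
Proof.
move=> [hC inv]; split; first exact: cat_prodl_cat.
by move=> [x f]; have [g [a b]] := inv f; exists (x, g); split.
Qed.

Lemma cat_prodr_groupoid (X C1 C0 : Type) (C : catData C1 C0) :
  is_groupoid C -> is_groupoid (cat_prodr X C).
Proof.
move=> [hC inv]; split; first exact: cat_prodr_cat.
by move=> [f x]; have [g [a b]] := inv f; exists (g, x); split.
Qed.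

Lemma left_action_cat_cat (K : pzRingType) : is_cat (left_action_cat K).
Proof.
split=> /=.
- by move=> g f; split=> [[h []]//|e]; exists (f.1 * g.1, g.2).
- by move=> g f h h' [_ ->] [_ ->].
- by move=> [s' t'] [s t] h /= [-> ->] /=; rewrite mulrA.
- by move=> g f h [_ ->].
- by move=> t; rewrite mul1r.
- by [].
- by move=> [s t] /=; rewrite mul1r.
- by move=> [s t] /=; rewrite mulr1 mul1r.
- move=> h g f hg gf k l [_ ->] [_ ->] [_ ->] [_ ->] /=.
  by rewrite mulrA.
Qed.

(** * Invertible scalars and their action on right modules *)

Section Units.
Variable K : pzRingType.
Implicit Types a b : K.

Lemma units1 : units K 1.
Proof. by exists 1; rewrite mulr1. Qed.

Lemma unitsM a b : units K a -> units K b -> units K (a * b).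
Proof.
move=> [a' [aa' a'a]] [b' [bb' b'b]]; exists (b' * a'); split.
  by rewrite mulrA -(mulrA a) bb' mulr1.
by rewrite mulrA -(mulrA b') a'a mulr1.
Qed.

(** The ring is not commutative: the inverse of [b] is [a * c] with [c] the inverse of [b * a], and
    for the second law [b] is first rewritten as [(b * a) * a']. *)
Lemma units_divr a b : units K a -> units K (b * a) -> units K b.
Proof.
move=> [a' [aa' a'a]] [c [H1 H2]]; exists (a * c); split.
  by rewrite mulrA.
have -> : b = (b * a) * a' by rewrite -mulrA aa' mulr1.
by rewrite mulrA -(mulrA a) H2 mulr1.
Qed.

Lemma units_mulI a b c : units K a -> b * a = c * a -> b = c.
Proof.
by move=> [a' [aa' _]] /(congr1 ( *%R^~ a')); rewrite -!mulrA aa' !mulr1.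
Qed.

Lemma units_solve a b : units K a -> exists c, c * a = b.
Proof. by move=> [a' [_ e]]; exists (b * a'); rewrite -mulrA e mulr1. Qed.

Variable V : lmodType K^c.
Implicit Types v w : V.

Lemma rscaleI a v w : units K a -> v ⋅ a = w ⋅ a -> v = w.
Proof.
move=> [b [ab _]] /(congr1 (fun u => u ⋅ b)).
by rewrite !rscaleA ab !rscale1.
Qed.

Lemma rscale_solve a v : units K a -> exists w, w ⋅ a = v.
Proof. by move=> [b [_ ba]]; exists (v ⋅ b); rewrite rscaleA ba rscale1. Qed.

Lemma rscaleDl v w a : (v + w) ⋅ a = v ⋅ a + w ⋅ a.
Proof. by rewrite /rscale scalerDr. Qed.

Lemma rscale0r v : v ⋅ (0 : K) = 0.
Proof. by rewrite /rscale scale0r. Qed.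

End Units.

(** * The double category of a linear set *)

Section LinearDoubleCategory.
Variables (K : pzRingType) (V : lmodType K^c) (U : set V).

Lemma ext1_eq (a b : ext1 U) : (\val a).1.1 = (\val b).1.1 ->
  (\val a).1.2 = (\val b).1.2 -> (\val a).2 = (\val b).2 -> a = b.
Proof.
by move=> h1 h2 h3; apply: val_sub_inj; apply: prod_eq => //; exact: prod_eq.
Qed.

Lemma ext11_eq (a b : ext11 U) : (\val a).1.1 = (\val b).1.1 ->
  (\val a).1.2 = (\val b).1.2 -> (\val a).2 = (\val b).2 -> a = b.
Proof.
by move=> h1 h2 h3; apply: val_sub_inj; apply: prod_eq => //; exact: prod_eq.
Qed.

Lemma lin_star1_cat : is_cat (lin_star1 U).
Proof.
split.
- move=> g f; split=> [[h [e1 e2 _]]|[e1 e2]] /=.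
    by rewrite e2; congr pair; apply: val_sub_inj; rewrite e1.
  have H : ext11 U (((\val f).1.1, (\val f).1.2 + (\val g).1.2), (\val f).2).
    split=> /=; first exact: ext11_source.
    rewrite !rscaleDl addrA e2; have := ext11_target g.
    by rewrite -e1 e2.
  by exists (to_sub H).
- by move=> g f h h' [_ _ e] [_ _ e']; apply: val_sub_inj; rewrite e e'.
- move=> g f h [_ _ e] /=; apply: prod_eq => /=; last by rewrite e.
  by apply: val_sub_inj; rewrite /= e.
- move=> g f h [/= e1 e2 e] /=; apply: prod_eq => /=; last by rewrite e e2.
  by apply: val_sub_inj; rewrite /= e /= e1 e2 !rscaleDl addrA.
- by move=> [x p]; apply: prod_eq => //; exact: val_sub_inj.
- move=> [x p]; apply: prod_eq => //; apply: val_sub_inj => /=.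
  by rewrite !rscale0l addr0.
- by move=> f; split=> //=; rewrite ?rscale0l ?addr0 ?add0r //; case: (\val f) => [[]].
- by move=> f; split=> //=; rewrite ?rscale0l ?addr0 ?add0r //; case: (\val f) => [[]].
- move=> h g f hg gf k l [a1 a2 a3] [b1 b2 b3] [c1 c2 c3] [d1 d2 d3].
  apply: val_sub_inj; rewrite c3 d3 b3 a3 /= addrA //.
Qed.

Lemma lin_star0_cat : is_cat (lin_star0 U).
Proof.
split.
- move=> g f; split=> [[h [e1 e2 _]]|[e1 e2]] /=.
    by rewrite e2; congr pair; apply: val_sub_inj; rewrite e1.
  have H : ext1 U (((\val f).1.1, (\val f).1.2 + (\val g).1.2), (\val f).2).
    split=> /=; first exact: ext1_source.
    rewrite !rscaleDl addrA e2; have := ext1_target g.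
    by rewrite -e1 e2.
  by exists (to_sub H).
- by move=> g f h h' [_ _ e] [_ _ e']; apply: val_sub_inj; rewrite e e'.
- move=> g f h [_ _ e] /=; apply: prod_eq => /=; last by rewrite e.
  by apply: val_sub_inj; rewrite /= e.
- move=> g f h [/= e1 e2 e] /=; apply: prod_eq => /=; last by rewrite e e2.
  by apply: val_sub_inj; rewrite /= e /= e1 e2 !rscaleDl addrA.
- by move=> [x p]; apply: prod_eq => //; exact: val_sub_inj.
- move=> [x p]; apply: prod_eq => //; apply: val_sub_inj => /=.
  by rewrite !rscale0l addr0.
- by move=> f; split=> //=; rewrite ?rscale0l ?addr0 ?add0r //; case: (\val f) => [[]].
- by move=> f; split=> //=; rewrite ?rscale0l ?addr0 ?add0r //; case: (\val f) => [[]].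
- move=> h g f hg gf k l [a1 a2 a3] [b1 b2 b3] [c1 c2 c3] [d1 d2 d3].
  apply: val_sub_inj; rewrite c3 d3 b3 a3 /= addrA //.
Qed.

(** Trades the pattern matching of the definition for projections, so that the four conditions can
    be used for rewriting. *)
Lemma lin_bul1E (g f h : ext11 U) : comp (lin_bul1 U) g f h <->
  [/\ (\val g).1.1 = (\val f).1.1, (\val g).1.2 = (\val f).1.2 ⋅ (\val f).2.1,
      (\val f).2.2 = (\val g).2.1 * (\val g).2.2 &
      \val h = ((\val f).1, ((\val f).2.1 * (\val g).2.1, (\val g).2.2))].
Proof.
rewrite /lin_bul1 /=.
by case: (\val g) => [[x' v'] [s' t']]; case: (\val f) => [[x v] [s t]].
Qed.

Lemma lin_bul1_cat : is_cat (lin_bul1 U).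
Proof.
split.
- move=> g f; split=> [[h /lin_bul1E [e1 e2 e3 e4]]|/(congr1 \val) E].
    exact: ext1_eq.
  have e1 : (\val f).1.1 = (\val g).1.1 := congr1 (fun a => a.1.1) E.
  have e2 : _ = (\val g).1.2 := congr1 (fun a => a.1.2) E.
  have e3 : (\val f).2.2 = _ := congr1 snd E.
  rewrite /= in e2 e3.
  have H : ext11 U ((\val f).1, ((\val f).2.1 * (\val g).2.1, (\val g).2.2)).
    split=> /=; first exact: ext11_source.
    by rewrite -rscaleA e1 e2; exact: ext11_target.
  by exists (to_sub H); apply/lin_bul1E.
- move=> g f h h' /lin_bul1E [_ _ _ e] /lin_bul1E [_ _ _ e'].
  by apply: val_sub_inj; rewrite e e'.
- move=> g f h /lin_bul1E [_ _ e1 e]; apply: ext1_eq; rewrite /= e //=.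
  by rewrite e1 mulrA.
- by move=> g f h /lin_bul1E [e1 e2 e3 e]; apply: ext1_eq; rewrite /= e //= e2 rscaleA.
- by move=> a; apply: ext1_eq => //=; rewrite mul1r.
- by move=> a; apply: ext1_eq => //=; rewrite rscale1.
- move=> f; apply/lin_bul1E; split=> //=; rewrite ?rscale1 ?mul1r //.
  by case: (\val f) => [[x v] [s t]].
- move=> f; apply/lin_bul1E; split=> //=; rewrite ?rscale1 ?mul1r ?mulr1 //.
  by case: (\val f) => [[x v] [s t]].
- move=> h g f hg gf k l /lin_bul1E [a1 a2 a3 a4] /lin_bul1E [b1 b2 b3 b4].
  move=> /lin_bul1E [c1 c2 c3 c4] /lin_bul1E [d1 d2 d3 d4].
  by apply: val_sub_inj; rewrite c4 d4 b4 a4 /= mulrA.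
Qed.

(** Two module laws carry the compatibilities: [v ⋅ s ⋅ t = v ⋅ (s * t)] makes the endpoints
    independent of the bullet projection, and additivity of [v ⋅ s] in [v] lets the bullet target
    preserve star. *)
Lemma lin_dcat_is_dcat : is_dcat (lin_dcat U).
Proof.
split.
- exact: lin_star1_cat.
- exact: lin_star0_cat.
- exact: lin_bul1_cat.
- exact: cat_prodl_cat (left_action_cat_cat K).
- split.
  + by move=> f; congr pair; exact: val_sub_inj.
  + by move=> f; congr pair; apply: val_sub_inj; rewrite /= rscaleA.
  + by move=> x; exact: ext1_eq.
  + by move=> g f h [/= e1 e2 e3]; split; rewrite /= ?e3 ?e1 ?e2 ?rscaleA.
- split.
  + by move=> f; congr pair; exact: val_sub_inj.
  + by move=> f; congr pair; apply: val_sub_inj.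
  + by move=> x; apply: ext1_eq => //=; rewrite rscale0l.
  + by move=> g f h [/= e1 e2 e3]; split; rewrite /= ?e3 ?e1 ?e2 ?rscaleDl.
- split.
  + by move=> f; congr pair; exact: val_sub_inj.
  + by move=> f; congr pair; apply: val_sub_inj; rewrite /= rscale1.
  + by move=> x; exact: ext11_eq.
  + by move=> g f h [/= e1 e2 e3]; split; rewrite /= ?e3 ?e1 ?e2 ?rscale1.
- split.
  + by move=> f; congr pair; exact: val_sub_inj.
  + by move=> f; congr pair; exact: val_sub_inj.
  + by move=> f; congr pair; exact: val_sub_inj.
  + move=> g f h /lin_bul1E [e1 e2 e3 e4]; split=> /=; rewrite ?e4 //.
      by apply: val_sub_inj.
    by apply: val_sub_inj; rewrite /= e1 e4.
- split.
  + by move=> f; congr pair; apply: val_sub_inj; rewrite /= rscaleA.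
  + by move=> f; congr pair; exact: val_sub_inj.
  + by move=> f; congr pair; apply: val_sub_inj; rewrite /= rscale1.
  + move=> g f h /lin_bul1E [e1 e2 e3 e4]; split=> /=; rewrite ?e4 //.
      by apply: val_sub_inj; rewrite /= e1 e2 e3 -!rscaleA.
    by apply: val_sub_inj; rewrite /= e1 e4 /= e2 -!rscaleA.
- split.
  + by move=> [x p]; exact: ext1_eq.
  + by move=> [x p]; apply: ext1_eq => //=; rewrite rscale0l.
  + by move=> [x p]; exact: ext11_eq.
  + move=> [x p] [y q] [z r] [/= -> -> [e1 ->]].
    by case: p q e1 => [s' t'] [s t] /= ->; rewrite rscale0l.
(* Both sides keep the vectors of [c] and [d]: star adds them, and bullet changes the scalars
   only. *)
- move=> a b c d ab cd ac bd x y [a1 a2 a3] [b1 b2 b3] /lin_bul1E[c1 c2 c3 c4].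
  move=> /lin_bul1E[d1 d2 d3 d4] /lin_bul1E[e1 e2 e3 e4] [f1 f2 f3].
  by apply: val_sub_inj; rewrite c4 f3 b3 a3 e4 d4 //=.
Qed.

Lemma diso_of_bij (C11 C10 C01 C00 D11 D10 D01 D00 : Type)
    (C : dcatData C11 C10 C01 C00) (D : dcatData D11 D10 D01 D00)
    (F : dmap C11 C10 C01 C00 D11 D10 D01 D00)
    (G : dmap D11 D10 D01 D00 C11 C10 C01 C00) :
  is_dcat C -> is_dcat D -> is_dmor C D F ->
  [/\ cancel (m11 F) (m11 G) /\ cancel (m11 G) (m11 F),
        cancel (m10 F) (m10 G) /\ cancel (m10 G) (m10 F),
        cancel (m01 F) (m01 G) /\ cancel (m01 G) (m01 F) &
        cancel (m00 F) (m00 G) /\ cancel (m00 G) (m00 F)] ->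
  is_diso C D F.
Proof.
move=> hC hD hF [[a a'] [b b'] [c c'] [d d']].
split=> //; exists G; split=> //.
case: hC => hC1 hC2 hC3 hC4 _ _ _ _ _ _ _.
case: hD => hD1 hD2 hD3 hD4 _ _ _ _ _ _ _.
case: hF => f1 f2 f3 f4.
split.
- exact: (functor_inv hC1 hD1 f1).
- exact: (functor_inv hC2 hD2 f2).
- exact: (functor_inv hC3 hD3 f3).
- exact: (functor_inv hC4 hD4 f4).
Qed.

Lemma op_cat_cat (C1 C0 : Type) (C : catData C1 C0) :
  is_cat C -> is_cat (op_cat C).
Proof.
move=> hC; split=> /=.
- by move=> g f; rewrite (comp_def hC); split.
- by move=> g f h h'; exact: comp_uniq.
- by move=> g f h; exact: comp_tgt.
- by move=> g f h; exact: comp_src.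
- by move=> x; exact: idt_tgt.
- by move=> x; exact: idt_src.
- by move=> f; exact: comp_idl.
- by move=> f; exact: comp_idr.
- move=> h g f hg gf k l a b c d; apply/esym.
  exact: (comp_assoc hC b a d c).
Qed.

Lemma op_functor (C1 C0 D1 D0 : Type) (C : catData C1 C0)
    (D : catData D1 D0) (F1 : C1 -> D1) (F0 : C0 -> D0) :
  is_functor C D F1 F0 -> is_functor (op_cat C) (op_cat D) F1 F0.
Proof. by move=> [a b c d]; split=> //= g f h; exact: d. Qed.

Lemma lin_inversion_diso :
  is_diso (lin_dcat U) (dcat_star_op (lin_dcat U)) (lin_inversion U).
Proof.
have hU := lin_dcat_is_dcat.
have E1 (a : ext1 U) : m10 (lin_inversion U) (m10 (lin_inversion U) a) = a.
  by apply: ext1_eq; rewrite //= ?rscaleNl ?addrK ?opprK.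
have E11 (a : ext11 U) : m11 (lin_inversion U) (m11 (lin_inversion U) a) = a.
  by apply: ext11_eq; rewrite //= ?rscaleNl ?addrK ?opprK.
have F : is_dmor (lin_dcat U) (dcat_star_op (lin_dcat U)) (lin_inversion U).
  split; split=> //=.
  - by move=> f; congr pair; apply: val_sub_inj; rewrite /= !rscaleNl addrK.
  - by move=> f; congr pair; exact: val_sub_inj.
  - by move=> x; apply: ext11_eq; rewrite //= ?rscale0l ?addr0 ?oppr0.
  - move=> g f h [/= e1 e2 e3]; rewrite e3 e2 e1 /=; split=> //.
      by rewrite !rscaleNl addrK.
    by rewrite !rscaleDl addrA opprD [- _ - _]addrC.
  - by move=> f; congr pair; apply: val_sub_inj; rewrite /= !rscaleNl addrK.
  - by move=> f; congr pair; exact: val_sub_inj.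
  - by move=> x; apply: ext1_eq; rewrite //= ?rscale0l ?addr0 ?oppr0.
  - move=> g f h [/= e1 e2 e3]; rewrite e3 e2 e1 /=; split=> //.
      by rewrite !rscaleNl addrK.
    by rewrite !rscaleDl addrA opprD [- _ - _]addrC.
  - by move=> f; apply: ext1_eq => //=; rewrite rscaleA.
  - by move=> f; apply: ext1_eq => //=; rewrite rscaleNl.
  - by move=> f; apply: ext11_eq => //=; rewrite rscale1.
  - move=> g f h /lin_bul1E [e1 e2 e3 e4].
    suff : comp (lin_bul1 U) (m11 (lin_inversion U) g)
      (m11 (lin_inversion U) f) (m11 (lin_inversion U) h) by [].
    apply/lin_bul1E; split=> //=.
    + by rewrite e1 e2 e3 -!rscaleA.
    + by rewrite e2 rscaleNl.
    + by rewrite e4 /= e3 /= -!rscaleA.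
(* Inversion is an involution and hence its own inverse. What remains is that reversing both
   star-categories yields a double category again. *)
apply: (diso_of_bij (G := lin_inversion U)) => //.
case: hU => h1 h2 h3 h4 h5 h6 h7 h8 h9 h10 h11; split=> //.
- exact: op_cat_cat.
- exact: op_cat_cat.
- exact: op_functor h5.
- exact: op_functor h6.
- exact: op_functor h7.
- move=> a b c d ab cd ac bd x y /= H1 H2 H3 H4 H5 H6.
  exact: (h11 _ _ _ _ _ _ _ _ _ _ H1 H2 H3 H5 H4 H6).
Qed.

Lemma lin_bul1_action : is_functor (lin_bul1 U) (left_action_cat K)
  (fun a => (\val a).2) (fun a => (\val a).2).
Proof.
by split=> //= g f h /lin_bul1E [e1 e2 e3 e4]; rewrite e4.
Qed.

Lemma lin_bul0_action : is_functor (lin_bul0 U) (left_action_cat K) snd snd.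
Proof. by split=> //= g f h [_ _ [e1 ->]]. Qed.

End LinearDoubleCategory.

(** * Morphisms and difference factorizers *)

Lemma dmap_eq (C11 C10 C01 C00 D11 D10 D01 D00 : Type)
    (F G : dmap C11 C10 C01 C00 D11 D10 D01 D00) :
  (forall x, m11 F x = m11 G x) -> (forall x, m10 F x = m10 G x) ->
  (forall x, m01 F x = m01 G x) -> (forall x, m00 F x = m00 G x) -> F = G.
Proof.
case: F => a b c d; case: G => a' b' c' d' /= e1 e2 e3 e4.
by congr Dmap; apply/funext.
Qed.

Section LinearMorphisms.
Variables (K : pzRingType) (V W : lmodType K^c) (U : set V).

Definition factorizer_dmap (f : U -> W) (f1 : ext1 U -> W) :
    lin_dmap U [set: W] :=
  Dmap (fun a => to_sub (conj I I : ext11 [set: W] (ext11_fun f f1 a)))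
    (fun a => to_sub (conj I I : ext1 [set: W] (ext1_fun f f1 a)))
    (fun x => (Defs.to_setT f x.1, x.2)) (fun x => (Defs.to_setT f x.1, x.2)).

Lemma factorizer_dmap_given (f : U -> W) (f1 : ext1 U -> W) :
  given_by f f1 (factorizer_dmap f f1).
Proof. by split. Qed.

Lemma given_by_uniq (f : U -> W) (f1 : ext1 U -> W) (F G : lin_dmap U [set: W]) :
  given_by f f1 F -> given_by f f1 G -> F = G.
Proof.
move=> [[a b] c d] [[a' b'] c' d']; apply: dmap_eq => x.
- by apply: val_sub_inj; rewrite d d'.
- by apply: val_sub_inj; rewrite c c'.
- by rewrite a a'.
- by rewrite b b'.
Qed.

(** Each condition on [f1] matches one part of functoriality: the factorizer identity matches
    targets, additivity matches star and its units, homogeneity matches the bullet target. *)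
Lemma factorizer_dmap_mor (f : U -> W) (f1 : ext1 U -> W) :
  difference_factorizer f f1 -> factorizer_additive f1 ->
  factorizer_homogeneous f1 ->
  is_dmor (lin_dcat U) (lin_dcat [set: W]) (factorizer_dmap f f1).
Proof.
move=> df add hom.
(* Additivity with all three arrows equal to the zero arrow gives [f1 a = f1 a + f1 a]; this is what
   preserves the units of star. *)
have f0 (a : ext1 U) : (\val a).1.2 = 0 -> f1 a = 0.
  case Ea : (\val a) => [[x v] t] /= v0; subst v.
  have /(add x 0 0 t a a a) : \val a = ((x, 0), t) by [].
  rewrite rscale0l !addr0 => /(_ Ea Ea) /eqP.
  by rewrite -[X in X == _]addr0 (inj_eq (addrI _)) eq_sym => /eqP.
have end_eq (a b : U) : \val a = \val b -> f a = f b by move=> /val_sub_inj ->.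
have dE (a : ext1 U) x y : \val x = \val (start1 a) ->
    \val y = \val (end1 a) -> f x + f1 a ⋅ (\val a).2 = f y.
  by move=> /val_sub_inj -> /val_sub_inj ->; rewrite -df addrC subrK.
split; split=> //=.
- by move=> a; congr pair; apply: val_sub_inj.
- move=> a; congr pair; apply: val_sub_inj => /=.
  by rewrite rscaleA (dE (partial0 a) _ (end11 a)) //= -rscaleA.
- move=> x; apply: ext11_eq => //=; first by apply: end_eq.
  by rewrite f0.
- move=> g h k [/= e1 e2 e3]; split=> //=.
    by rewrite rscaleA (dE (partial0 h) _ (start11 g)) //= e1 -rscaleA.
  rewrite /ext11_fun /= e3; congr (_, _, _).
    by apply: end_eq; rewrite /= e3.
  rewrite addrC; apply: (add (\val h).1.1 (\val h).1.2 (\val g).1.2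
    ((\val h).2.1 * (\val h).2.2)) => //=.
  - by case: (\val h) => [[]].
  - rewrite -e2; apply: prod_eq => //=; apply: prod_eq => //=.
    by rewrite e1 e2 rscaleA.
  - by rewrite e3.
- by move=> a; congr pair; apply: val_sub_inj.
- move=> a; congr pair; apply: val_sub_inj => /=.
  by rewrite (dE a _ (end1 a)).
- move=> x; apply: ext1_eq => //=; first by apply: end_eq.
  by rewrite f0.
- move=> g h k [/= e1 e2 e3]; split=> //=.
    by rewrite (dE h _ (start1 g)).
  rewrite /ext1_fun /= e3; congr (_, _, _).
    by apply: end_eq; rewrite /= e3.
  rewrite addrC; apply: (add (\val h).1.1 (\val h).1.2 (\val g).1.2
    (\val h).2) => //=.
  - by case: (\val h) => [[]].
  - rewrite -e2; apply: prod_eq => //=; apply: prod_eq => //=.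
    by rewrite e1 e2.
- by move=> a; apply: ext1_eq => //=; apply: end_eq.
- move=> a; apply: ext1_eq => //=; first by apply: end_eq.
  apply/esym; apply: (hom (\val a).1.1 (\val a).1.2 (\val a).2.1 (\val a).2.2).
    by rewrite /=; case: (\val a) => [[]].
  by [].
- move=> a; apply: ext11_eq => //=; first by apply: end_eq.
  by congr f1; apply: ext1_eq => //=; rewrite mul1r.
- move=> g h k /lin_bul1E [e1 e2 e3 e4].
  suff : comp (lin_bul1 [set: W]) (m11 (factorizer_dmap f f1) g)
      (m11 (factorizer_dmap f f1) h) (m11 (factorizer_dmap f f1) k) by [].
  apply/lin_bul1E; split=> //=.
  + by apply: end_eq.
  + apply: (hom (\val h).1.1 (\val h).1.2 (\val h).2.1 (\val h).2.2).
      by rewrite /=; case: (\val h) => [[]].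
    by apply: prod_eq; [apply: prod_eq|]; rewrite /= ?e1 ?e2 ?e3.
  + rewrite /ext11_fun /= e4; congr (_, _, _); first by apply: end_eq; rewrite /= e4.
    by congr f1; apply: ext1_eq; rewrite /= e4 //= e3 mulrA.
- by move=> g h k [e1 e2 [e3 e4]]; rewrite e1 e2.
Qed.

(** The factorizer is the vector component of [m10 F]. Compatibility with the bullet source
    determines [m11 F] from [m10 F]; the star target gives the factorizer identity, star composition
    gives additivity, and the bullet target gives homogeneity. *)
Lemma morphism_factorizer (F : lin_dmap U [set: W]) :
  is_dmor (lin_dcat U) (lin_dcat [set: W]) F -> trivial_on_K F ->
  exists f f1, [/\ difference_factorizer f f1, factorizer_additive f1,
    factorizer_homogeneous f1 & given_by f f1 F].
Proof.
move=> [s1 s0 b1 b0] [f0 [t1 t0]].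
pose f x := \val (f0 x); pose f1 a := (\val (m10 F a)).1.2.
have s0s a : src (lin_star0 _) (m10 F a) = (f0 (start1 a), (\val a).2).
  by case: s0 => + _ _ _ => ->; rewrite t0.
have s0t a : tgt (lin_star0 _) (m10 F a) = (f0 (end1 a), (\val a).2).
  by case: s0 => _ + _ _ => ->; rewrite t0.
have E10 a : \val (m10 F a) = ext1_fun f f1 a.
  have /= e1 := congr1 (fun p => \val p.1) (s0s a).
  have /= e2 := congr1 snd (s0s a).
  by apply: prod_eq => //=; apply: prod_eq.
have E11 a : \val (m11 F a) = ext11_fun f f1 a.
  case: b1 => bs _ _ _; case: s1 => ss _ _ _.
  have e2 := congr1 snd (ss a); rewrite t1 /= in e2.
  have e1 : (\val (m11 F a)).1 = (\val (m10 F (partial0 a))).1.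
    by rewrite -[partial0 a]/(src (bul1 (lin_dcat U)) a) -bs.
  rewrite /ext11_fun; apply: prod_eq => //=; rewrite e1 E10 /=.
  by congr pair; congr f; exact: val_sub_inj.
exists f, f1; split.
- move=> a; have /= := congr1 (fun p => \val p.1) (s0t a).
  rewrite E10 /= => e.
  by rewrite -[f (end1 a)]e addrC addKr.
- move=> x v v' t a b c Ea Eb Ec.
  have /= : comp (star0 (lin_dcat U)) b a c by rewrite /= Ea Eb Ec.
  case: s0 => _ _ _ sc /sc [_ _]; rewrite !E10 /= => -[_ -> _].
  by rewrite addrC.
- move=> x v s t a b Ea Eb.
  (* The quadruple [(x,v;s,t)] has [a] as its bullet source and [b] as its bullet target. *)
  have H : ext11 U ((x, v), (s, t)).
    have [h1 h2] := set_valP a; rewrite Ea /= in h1 h2; split=> //=.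
    by rewrite rscaleA.
  case: b1 => bs bt _ _.
  have -> : a = partial0 (to_sub H) by apply: ext1_eq; rewrite Ea.
  have -> : b = partial1 (to_sub H) by apply: ext1_eq; rewrite Eb.
  have := congr1 (fun p => (\val p).1.2) (bt (to_sub H)).
  by rewrite -[m10 F _]/(m10 F (partial1 _)) E10 /= E11 /= => ->.
- split=> //; split=> x; rewrite ?t1 ?t0; congr pair; exact: val_sub_inj.
Qed.

Lemma linear_morphisms :
  one_to_one
    [set p : (U -> W) * (ext1 U -> W) |
      [/\ difference_factorizer p.1 p.2,
          factorizer_additive p.2 & factorizer_homogeneous p.2]]
    [set F : lin_dmap U [set: W] |
      is_dmor (lin_dcat U) (lin_dcat [set: W]) F /\ trivial_on_K F]
    (fun p F => given_by p.1 p.2 F).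
Proof.
split.
  move=> [f f1] /= [h1 h2 h3]; exists (factorizer_dmap f f1); split.
    split; last exact: factorizer_dmap_given.
    by split; [exact: factorizer_dmap_mor|exists (Defs.to_setT f)].
  by move=> F [_ hF]; apply: given_by_uniq hF; exact: factorizer_dmap_given.
move=> F [hF tF]; have [f [f1 [h1 h2 h3 h4]]] := morphism_factorizer hF tF.
exists (f, f1); split=> //= -[g g1] [_ /= h5].
case: h4 => [[_ a] b _]; case: h5 => [[_ a'] b' _].
congr pair; apply/funext => x.
  by have := congr1 (fun p => \val p.1) (a (x, 0)); rewrite a' /= => ->.
by have := congr1 (fun p => p.1.2) (b x); rewrite b' /= => ->.
Qed.

End LinearMorphisms.

Section ZeroModule.
Variables (K : pzRingType) (Z : lmodType K^c).
Hypothesis Z0 : forall z : Z, z = 0.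

Lemma zero_eq (x y : Z) : x = y. Proof. by rewrite (Z0 x) (Z0 y). Qed.

Lemma zero_set_eq (x y : [set: Z]) : x = y.
Proof. by apply: val_sub_inj; exact: zero_eq. Qed.

(** Constant zero maps are the only candidates for a map and its factorizer, so the correspondence
    with factorizers yields existence and uniqueness at once. *)
Lemma morphism_to_zero (V : lmodType K^c) (U : set V) :
  exists! F : lin_dmap U [set: Z],
    is_dmor (lin_dcat U) (lin_dcat [set: Z]) F /\ trivial_on_K F.
Proof.
exists (factorizer_dmap (fun _ => 0) (fun _ => 0)); split.
  split; last by exists (Defs.to_setT (fun _ => 0)).
  apply: factorizer_dmap_mor.
  - by move=> a; exact: zero_eq.
  - by move=> *; exact: zero_eq.
  - by move=> *; exact: zero_eq.
move=> F [hF tF]; have [f [f1 [_ _ _ h]]] := morphism_factorizer hF tF.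
apply: given_by_uniq h; have -> : f = (fun _ => 0) by apply/funext => x; exact: Z0.
have -> : f1 = (fun _ => 0) by apply/funext => x; exact: Z0.
exact: factorizer_dmap_given.
Qed.

Lemma zero_bul1_iso : is_cat_iso (lin_bul1 [set: Z]) (left_action_cat K)
  (fun a => (\val a).2) (fun a => (\val a).2).
Proof.
have F := lin_bul1_action [set: Z]; split=> //.
pose G1 (p : K * K) : ext11 [set: Z] :=
  to_sub (conj I I : ext11 [set: Z] ((0, 0), p)).
pose G0 (t : K) : ext1 [set: Z] :=
  to_sub (conj I I : ext1 [set: Z] ((0, 0), t)).
have c1 : cancel (fun a : ext11 [set: Z] => (\val a).2) G1.
  by move=> a; apply: ext11_eq => //=; exact: zero_eq.
have c2 : cancel (fun a : ext1 [set: Z] => (\val a).2) G0.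
  by move=> a; apply: ext1_eq => //=; exact: zero_eq.
exists G1, G0; split=> //.
apply: (functor_inv _ _ F) => //; first exact: lin_bul1_cat.
exact: left_action_cat_cat.
Qed.

Lemma zero_bul0_iso :
  is_cat_iso (lin_bul0 [set: Z]) (left_action_cat K) snd snd.
Proof.
have F := lin_bul0_action [set: Z]; split=> //.
pose z : [set: Z] := to_sub (I : [set: Z] 0).
have c1 : cancel (snd : [set: Z] * (K * K) -> K * K) (pair z).
  by move=> [a p]; congr pair; exact: zero_set_eq.
have c2 : cancel (snd : [set: Z] * K -> K) (pair z).
  by move=> [a p]; congr pair; exact: zero_set_eq.
exists (pair z), (pair z); split=> //.
Qed.

End ZeroModule.

(** * Unit parts and pair groupoids *)

Lemma bij_inv (A B : Type) (f : A -> B) :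
  injective f -> (forall y, exists x, f x = y) ->
  exists g, cancel f g /\ cancel g f.
Proof.
move=> fI /choiceP [g gP]; exists g; split=> // x.
by apply: fI; rewrite gP.
Qed.

Section Restriction.
Variables (C1 C0 D1 D0 : Type) (C : catData C1 C0) (D : catData D1 D0).
Variables (P1 : set C1) (P0 : set C0) (Q1 : set D1) (Q0 : set D0).
Variables (C' : catData P1 P0) (D' : catData Q1 Q0).

Lemma restriction_cat : is_cat C -> is_restriction C C' ->
  (forall g f h, P1 g -> P1 f -> comp C g f h -> P1 h) -> is_cat C'.
Proof.
move=> hC [a b c d] cl.
apply: (functor_inj_cat (D := C) (F1 := \val) (F0 := \val)) => //.
move=> g f h H; have Ph : P1 h by apply: cl H; exact: set_valP.
by exists (to_sub Ph).
Qed.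

Lemma functor_restrict (F1 : C1 -> D1) (F0 : C0 -> D0) (G1 : P1 -> Q1)
    (G0 : P0 -> Q0) :
  is_functor C D F1 F0 -> is_restriction C C' -> is_restriction D D' ->
  (forall x, \val (G1 x) = F1 (\val x)) ->
  (forall x, \val (G0 x) = F0 (\val x)) -> is_functor C' D' G1 G0.
Proof.
move=> [s t i c] [s1 t1 i1 c1] [s2 t2 i2 c2] e1 e0; split.
- by move=> f; apply: val_sub_inj; rewrite s2 e1 s e0 s1.
- by move=> f; apply: val_sub_inj; rewrite t2 e1 t e0 t1.
- by move=> x; apply: val_sub_inj; rewrite e1 i1 i i2 e0.
- by move=> g f h /c1 /c; rewrite -!e1 => /c2.
Qed.

End Restriction.

(** * The unit part of an abstract double category over scalars *)

Section UnitPart.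
Variables (K : pzRingType) (X C11 C10 : Type).
Variable D : dcatData C11 C10 (X * (K * K)) (X * K).
Hypothesis hD : is_dcat D.
Hypothesis bul0E : bul0 D = cat_prodl X (left_action_cat K).
Hypothesis par1 : forall a, (tgt (star1 D) a).2 = (src (star1 D) a).2.
Hypothesis par0 : forall a, (tgt (star0 D) a).2 = (src (star0 D) a).2.
Hypothesis arrow1 : forall x y p, units K p.1 -> units K p.2 ->
  exists! a, src (star1 D) a = (x, p) /\ tgt (star1 D) a = (y, p).
Hypothesis arrow0 : forall x y t, units K t ->
  exists! a, src (star0 D) a = (x, t) /\ tgt (star0 D) a = (y, t).

Local Notation P11 := (@unit_part11 K X C11 C10 D).
Local Notation P10 := (@unit_part10 K X C11 C10 D).
Local Notation P01 := (unit_part01 K X).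
Local Notation P00 := (unit_part00 K X).

Let star1s (a : P11) : P01 (src (star1 D) (\val a)).
Proof. exact: (set_valP a). Qed.

Let star1t (a : P11) : P01 (tgt (star1 D) (\val a)).
Proof. rewrite /unit_part01 /= par1; exact: (set_valP a). Qed.

Let star1i (x : P01) : P11 (idt (star1 D) (\val x)).
Proof.
rewrite /unit_part11 /= (idt_src (star1_cat hD)); exact: (set_valP x).
Qed.

Let star0s (a : P10) : P00 (src (star0 D) (\val a)).
Proof. exact: (set_valP a). Qed.

Let star0t (a : P10) : P00 (tgt (star0 D) (\val a)).
Proof. rewrite /unit_part00 /= par0; exact: (set_valP a). Qed.

Let star0i (x : P00) : P10 (idt (star0 D) (\val x)).
Proof.
rewrite /unit_part10 /= (idt_src (star0_cat hD)); exact: (set_valP x).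
Qed.

Let bul0s (x : P01) : P00 (src (bul0 D) (\val x)).
Proof. by rewrite bul0E; case: (set_valP x) => *; exact: unitsM. Qed.

Let bul0t (x : P01) : P00 (tgt (bul0 D) (\val x)).
Proof. by rewrite bul0E; case: (set_valP x). Qed.

Let bul0i (x : P00) : P01 (idt (bul0 D) (\val x)).
Proof. by rewrite bul0E; split; [exact: units1|exact: (set_valP x)]. Qed.

(** The scalars of an arrow are those of its star source, and bullet projections commute with star
    sources, so the claim reduces to the same one for [bul0]. *)
Let bul1s (a : P11) : P10 (src (bul1 D) (\val a)).
Proof.
case: (src_bul_functor hD) => e _ _ _; rewrite /unit_part10 /= e.
exact: (bul0s (to_sub (star1s a))).
Qed.

Let bul1t (a : P11) : P10 (tgt (bul1 D) (\val a)).
Proof.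
case: (tgt_bul_functor hD) => e _ _ _; rewrite /unit_part10 /= e.
exact: (bul0t (to_sub (star1s a))).
Qed.

Let bul1i (x : P10) : P11 (idt (bul1 D) (\val x)).
Proof.
case: (idt_bul_functor hD) => e _ _ _; rewrite /unit_part11 /= e.
exact: (bul0i (to_sub (star0s x))).
Qed.

Definition unit_part : dcatData P11 P10 P01 P00 :=
  DcatData
    (CatData (fun a => to_sub (star1s a)) (fun a => to_sub (star1t a))
      (fun x => to_sub (star1i x))
      (fun g f h => comp (star1 D) (\val g) (\val f) (\val h)))
    (CatData (fun a => to_sub (star0s a)) (fun a => to_sub (star0t a))
      (fun x => to_sub (star0i x))
      (fun g f h => comp (star0 D) (\val g) (\val f) (\val h)))
    (CatData (fun a => to_sub (bul1s a)) (fun a => to_sub (bul1t a))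
      (fun x => to_sub (bul1i x))
      (fun g f h => comp (bul1 D) (\val g) (\val f) (\val h)))
    (CatData (fun a => to_sub (bul0s a)) (fun a => to_sub (bul0t a))
      (fun x => to_sub (bul0i x))
      (fun g f h => comp (bul0 D) (\val g) (\val f) (\val h))).

Lemma unit_part_restriction : is_unit_part D unit_part.
Proof. by split; split. Qed.

Let bul0_closed g f h : P01 g -> P01 f -> comp (bul0 D) g f h -> P01 h.
Proof.
rewrite bul0E => -[a b] [c d] [e1 e2 [e3 e4]].
by split; rewrite e4 //=; exact: unitsM.
Qed.

Lemma unit_part_dcat : is_dcat unit_part.
Proof.
have [r1 r2 r3 r4] := unit_part_restriction.
case: (hD) => h1 h2 h3 h4 h5 h6 h7 h8 h9 h10 h11; split.
- apply: (restriction_cat h1) => // g f h Pg Pf /(comp_src h1).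
  by rewrite /unit_part11 /= => ->.
- apply: (restriction_cat h2) => // g f h Pg Pf /(comp_src h2).
  by rewrite /unit_part10 /= => ->.
- apply: (restriction_cat h3) => // g f h Pg Pf.
  case: (h8) => _ _ _ k /k; exact: bul0_closed.
- exact: (restriction_cat h4).
- exact: (functor_restrict h5).
- exact: (functor_restrict h6).
- exact: (functor_restrict h7).
- exact: (functor_restrict h8).
- exact: (functor_restrict h9).
- exact: (functor_restrict h10).
- move=> a b c d ab cd ac bd x y H1 H2 H3 H4 H5 H6; apply: val_sub_inj.
  exact: (h11 _ _ _ _ _ _ _ _ _ _ H1 H2 H3 H4 H5 H6).
Qed.

(** The scalars [(s,t)] are recorded as the target [t] and the source [st] of the corresponding
    arrow of the left action category. For units nothing is lost, since [s] is [(st) t^-1]. *)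
Definition anchor : dmap_to_pairs D :=
  Dmap
    (fun a : P11 => (((tgt (star1 D) (\val a)).1, (src (star1 D) (\val a)).1),
      (to_sub (star1s a).2, to_sub (unitsM (star1s a).1 (star1s a).2))))
    (fun a : P10 => (((tgt (star0 D) (\val a)).1, (src (star0 D) (\val a)).1),
      to_sub (star0s a : units K _)))
    (fun x : P01 => ((\val x).1, (to_sub (set_valP x).2,
       to_sub (unitsM (set_valP x).1 (set_valP x).2))))
    (fun x : P00 => ((\val x).1, to_sub (set_valP x : units K (\val x).2))).

Lemma anchorP : is_anchor D anchor. Proof. by split. Qed.

Let bij00 : exists g, cancel (m00 anchor) g /\ cancel g (m00 anchor).
Proof.
apply: bij_inv.
  move=> x y e; apply: val_sub_inj; apply: prod_eq.
    exact: (congr1 (fun p => p.1) e).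
  exact: (congr1 (fun p => \val p.2) e).
move=> [x t].
exists (to_sub (set_valP t : P00 (x, \val t))).
by apply: prod_eq => //; exact: val_sub_inj.
Qed.

Let bij01 : exists g, cancel (m01 anchor) g /\ cancel g (m01 anchor).
Proof.
apply: bij_inv.
  move=> x y e; apply: val_sub_inj; apply: prod_eq.
    exact: (congr1 (fun p => p.1) e).
  have e1 := congr1 (fun p => \val p.2.1) e.
  have e2 := congr1 (fun p => \val p.2.2) e.
  rewrite /= in e1 e2; apply: prod_eq => //.
  by rewrite e1 in e2; apply: units_mulI e2; case: (set_valP y).
move=> [x [t r]]; have ht := set_valP t.
(* The arrow from [r] to [t] in the action of the units is [s = r t^-1]. *)
have [s st] := units_solve (\val r) ht.
have hs : units K s by apply: (units_divr ht); rewrite st; exact: set_valP.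
exists (to_sub (conj hs ht : P01 (x, (s, \val t)))).
by apply: prod_eq => //; apply: prod_eq; exact: val_sub_inj.
Qed.

Let bij10 : exists g, cancel (m10 anchor) g /\ cancel g (m10 anchor).
Proof.
apply: bij_inv.
  move=> a b e; apply: val_sub_inj.
  have e1 := congr1 (fun p => p.1.1) e.
  have e2 := congr1 (fun p => p.1.2) e.
  have e3 := congr1 (fun p => \val p.2) e.
  rewrite /= in e1 e2 e3.
  (* Both [a] and [b] are compared with the unique arrow that has the given endpoints and
     parameter. *)
  have [c [_ cu]] := arrow0 (src (star0 D) (\val a)).1
    (tgt (star0 D) (\val a)).1 (set_valP a).
  rewrite -(cu (\val a)); last first.
    by split; apply: prod_eq => //=; rewrite par0.
  by apply: cu; split; apply: prod_eq => //=; rewrite ?par0.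
move=> [[y x] t]; have ht := set_valP t.
have [a [[a1 a2] _]] := arrow0 x y ht.
have Pa : P10 a by rewrite /unit_part10 /= a1.
exists (to_sub Pa); apply: prod_eq => /=; first by rewrite a1 a2.
by apply: val_sub_inj; rewrite /= a1.
Qed.

Let bij11 : exists g, cancel (m11 anchor) g /\ cancel g (m11 anchor).
Proof.
apply: bij_inv.
  move=> a b e; apply: val_sub_inj.
  have e1 := congr1 (fun p => p.1.1) e.
  have e2 := congr1 (fun p => p.1.2) e.
  have e3 := congr1 (fun p => \val p.2.1) e.
  have e4 := congr1 (fun p => \val p.2.2) e.
  rewrite /= in e1 e2 e3 e4.
  have [ua1 ua2] := set_valP a; have [ub1 ub2] := set_valP b.
  have e5 : (src (star1 D) (\val a)).2 = (src (star1 D) (\val b)).2.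
    by apply: prod_eq => //; rewrite e3 in e4; apply: units_mulI e4.
  have [c [_ cu]] := arrow1 (src (star1 D) (\val a)).1
    (tgt (star1 D) (\val a)).1 ua1 ua2.
  rewrite -(cu (\val a)); last first.
    by split; apply: prod_eq => //=; rewrite par1.
  by apply: cu; split; apply: prod_eq => //=; rewrite ?par1.
move=> [[y x] [t r]]; have ht := set_valP t.
have [s st] := units_solve (\val r) ht.
have hs : units K s by apply: (units_divr ht); rewrite st; exact: set_valP.
have [a [[a1 a2] _]] := arrow1 (p := (s, \val t)) x y hs ht.
have Pa : P11 a by rewrite /unit_part11 /= a1.
exists (to_sub Pa); apply: prod_eq => /=; first by rewrite a1 a2.
by apply: prod_eq; apply: val_sub_inj; rewrite /= a1.
Qed.

Lemma anchor_mor : is_dmor unit_part (pairs_dcat K X) anchor.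
Proof.
case: (hD) => h1 h2 h3 h4 h5 h6 h7 h8 h9 h10 _; split; split.
- by move=> a; apply: prod_eq => //=; apply: prod_eq; exact: val_sub_inj.
- move=> a; apply: prod_eq => //=.
  by apply: prod_eq; apply: val_sub_inj; rewrite /= par1.
- move=> x; apply: prod_eq => /=; first by rewrite (idt_src h1) (idt_tgt h1).
  by apply: prod_eq; apply: val_sub_inj; rewrite /= (idt_src h1).
- move=> g f h H; have e1 := comp_src h1 H; have e2 := comp_tgt h1 H.
  have e3 : tgt (star1 D) (\val f) = src (star1 D) (\val g).
    by apply/(comp_def h1); exists (\val h).
  have e4 : (src (star1 D) (\val f)).2 = (src (star1 D) (\val g)).2.
    by rewrite -par1 e3.
  split.
  + by apply: prod_eq; apply: val_sub_inj; rewrite /= e4.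
  + by apply: prod_eq; apply: val_sub_inj; rewrite /= e1 e4.
  + by split=> /=; rewrite ?e3 // e1 e2.
- by move=> a; apply: prod_eq => //=; exact: val_sub_inj.
- by move=> a; apply: prod_eq => //=; apply: val_sub_inj; rewrite /= par0.
- move=> x; apply: prod_eq => /=; first by rewrite (idt_src h2) (idt_tgt h2).
  by apply: val_sub_inj; rewrite /= (idt_src h2).
- move=> g f h H; have e1 := comp_src h2 H; have e2 := comp_tgt h2 H.
  have e3 : tgt (star0 D) (\val f) = src (star0 D) (\val g).
    by apply/(comp_def h2); exists (\val h).
  have e4 : (src (star0 D) (\val f)).2 = (src (star0 D) (\val g)).2.
    by rewrite -par0 e3.
  split.
  + by apply: val_sub_inj; rewrite /= e4.
  + by apply: val_sub_inj; rewrite /= e1 e4.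
  + by split=> /=; rewrite ?e3 // e1 e2.
- case: h5 => s t _ _; rewrite bul0E in s t; move=> a.
  by apply: prod_eq => /=; [|apply: val_sub_inj]; rewrite /= ?s ?t.
- case: h6 => s t _ _; rewrite bul0E in s t; move=> a.
  by apply: prod_eq => /=; [|apply: val_sub_inj]; rewrite /= ?s ?t.
- case: h7 => s t _ _; rewrite bul0E in s t; move=> a.
  apply: prod_eq => /=; rewrite ?s ?t //=.
  by apply: prod_eq; apply: val_sub_inj; rewrite /= s //= mul1r.
- case: h8 => _ _ _ s; case: h9 => _ _ _ t; rewrite bul0E in s t.
  move=> g f h H; have [e1 e2 [e3 e4]] := s _ _ _ H.
  have [e5 e6 _] := t _ _ _ H.
  split=> /=; first by rewrite e1 e5.
    by rewrite e2 e6.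
  split; first by apply: val_sub_inj.
  by apply: prod_eq; apply: val_sub_inj; rewrite /= e4 //= e3 mulrA.
- by move=> x; apply: prod_eq => /=; [|apply: val_sub_inj]; rewrite /= bul0E.
- by move=> x; apply: prod_eq => /=; [|apply: val_sub_inj]; rewrite /= bul0E.
- move=> x; apply: prod_eq => /=; rewrite ?bul0E //=.
  by apply: prod_eq; apply: val_sub_inj; rewrite /= bul0E //= mul1r.
- move=> g f h; rewrite /= bul0E => -[e1 e2 [e3 e4]].
  split=> //=; split; first exact: val_sub_inj.
  by apply: prod_eq; apply: val_sub_inj; rewrite /= e4 //= e3 mulrA.
Qed.

Lemma pairs_dcat_is_dcat : is_dcat (pairs_dcat K X).
Proof.
have pg := fun A => (pair_groupoid_groupoid A).1.
split.
- exact: cat_prodr_cat.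
- exact: cat_prodr_cat.
- exact: cat_prodl_cat.
- exact: cat_prodl_cat.
- by split=> //= g f h [-> -> [-> ->]].
- by split=> //= g f h [-> -> [-> ->]].
- by split=> //= g f h [-> -> [-> ->]].
- by split=> //= g f h [-> -> [-> ->]].
- by split=> //= g f h [-> -> [-> ->]].
- by split=> //= g f h [-> -> [-> ->]].
- move=> a b c d ab cd ac bd x y [a1 a2 [a3 a4]] [b1 b2 [b3 b4]].
  move=> [c1 c2 [c3 c4]] [d1 d2 [d3 d4]] [e1 e2 [e3 e4]] [f1 f2 [f3 f4]].
  apply: prod_eq.
    by rewrite c2 a4 f4 d2 e2.
  by rewrite c4 f2 d4 a2 b2.
Qed.

(** Unique existence of arrows with unit parameters, assumed as [arrow1] and [arrow0], makes the
    anchor bijective on all four sets, and inverses are transported back from the pair groupoids.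
    The abstract setting serves linear sets and manifolds alike. *)
Lemma unit_part_pairs : exists E, [/\ is_unit_part D E, is_dgroupoid E &
  exists Phi, is_diso E (pairs_dcat K X) Phi /\ is_anchor D Phi].
Proof.
have hP := pairs_dcat_is_dcat; have hE := unit_part_dcat.
have pg := pair_groupoid_groupoid.
have [k1 k2 k3 k4] := anchor_mor.
have [f1 [a1 b1]] := bij11; have [f2 [a2 b2]] := bij10.
have [f3 [a3 b3]] := bij01; have [f4 [a4 b4]] := bij00.
exists unit_part; split; first exact: unit_part_restriction.
  split=> //; split.
  - apply: (groupoid_transport (star1_cat hE) _ k1 a1 b1 a3 b3).
    exact: cat_prodr_groupoid.
  - apply: (groupoid_transport (star0_cat hE) _ k2 a2 b2 a4 b4).
    exact: cat_prodr_groupoid.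
  - apply: (groupoid_transport (bul1_cat hE) _ k3 a1 b1 a2 b2).
    exact: cat_prodl_groupoid.
  - apply: (groupoid_transport (bul0_cat hE) _ k4 a3 b3 a4 b4).
    exact: cat_prodl_groupoid.
exists anchor; split; last exact: anchorP.
exact: (diso_of_bij (G := Dmap f1 f2 f3 f4)).
Qed.

End UnitPart.

Section LinearUnitPart.
Variables (K : pzRingType) (V : lmodType K^c) (U : set V).

Lemma ext1_arrow (x y : U) (t : K) : units K t ->
  exists! a : ext1 U, start1 a = x /\ end1 a = y /\ (\val a).2 = t.
Proof.
move=> ut; have [v vt] := rscale_solve (\val y - \val x) ut.
have H : ext1 U ((\val x, v), t).
  split=> /=; first exact: (set_valP x).
  by rewrite vt addrC subrK; exact: (set_valP y).
exists (to_sub H); split.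
  split; first exact: val_sub_inj.
  by split=> //; apply: val_sub_inj; rewrite /= vt addrC subrK.
move=> a [a1 [a2 a3]]; have e1 := congr1 \val a1; have e2 := congr1 \val a2.
rewrite /= in e1 e2 vt; apply: ext1_eq => //=.
by apply: (rscaleI ut); rewrite vt -a3 -e1 -e2 addrC addKr.
Qed.

Lemma ext11_arrow (x y : U) (p : K * K) : units K (p.1 * p.2) ->
  exists! a : ext11 U, start11 a = x /\ end11 a = y /\ (\val a).2 = p.
Proof.
move=> ut; have [v vt] := rscale_solve (\val y - \val x) ut.
rewrite -rscaleA in vt.
have H : ext11 U ((\val x, v), p).
  split=> /=; first exact: (set_valP x).
  by rewrite vt addrC subrK; exact: (set_valP y).
exists (to_sub H); split.
  split; first exact: val_sub_inj.
  by split=> //; apply: val_sub_inj; rewrite /= vt addrC subrK.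
move=> a [a1 [a2 a3]]; have e1 := congr1 \val a1; have e2 := congr1 \val a2.
rewrite /= in e1 e2 vt; apply: ext11_eq => //=.
by apply: (rscaleI ut); rewrite -!rscaleA vt -a3 -e1 -e2 addrC addKr.
Qed.

Lemma lin_unit_part : exists E, [/\ is_unit_part (lin_dcat U) E,
  is_dgroupoid E & exists Phi, is_diso E (pairs_dcat K U) Phi].
Proof.
have [||||||E [h1 h2 [Phi [h3 _]]]] := @unit_part_pairs _ _ _ _ (lin_dcat U).
- exact: lin_dcat_is_dcat.
- by [].
- by [].
- by [].
- move=> x y p u1 u2; have [a [[a1 [a2 a3]] a4]] := ext11_arrow x y (unitsM u1 u2).
  exists a; split; first by rewrite /= a1 a2 a3.
  by move=> b [[b1 b2] [b3 b4]]; apply: a4; split=> //; exact: val_sub_inj.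
- move=> x y p u1; have [a [[a1 [a2 a3]] a4]] := ext1_arrow x y u1.
  exists a; split; first by rewrite /= a1 a2 a3.
  by move=> b [[b1 b2] [b3 b4]]; apply: a4; split=> //; exact: val_sub_inj.
by exists E; split=> //; exists Phi.
Qed.

End LinearUnitPart.

(** * Pointwise continuity *)

Section PointwiseContinuity.
Implicit Types X Y Z : topologicalType.

Lemma cts_id X (x : X) : {for x, continuous (fun y : X => y)}.
Proof. exact: cvg_id. Qed.

Lemma cts_cst X Y (x : X) (c : Y) : {for x, continuous (fun _ : X => c)}.
Proof. exact: cvg_cst. Qed.

Lemma cts_comp X Y Z (f : X -> Y) (g : Y -> Z) (x : X) :
  {for x, continuous f} -> {for f x, continuous g} ->
  {for x, continuous (fun y => g (f y))}.
Proof. by move=> cf cg; exact: continuous_comp. Qed.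

Lemma cts_pair X Y Z (f : X -> Y) (g : X -> Z) (x : X) :
  {for x, continuous f} -> {for x, continuous g} ->
  {for x, continuous (fun y => (f y, g y))}.
Proof. by move=> cf cg; apply: cvg_pair. Qed.

Lemma cts_fst X Y Z (f : X -> Y * Z) (x : X) :
  {for x, continuous f} -> {for x, continuous (fun y => (f y).1)}.
Proof. by move=> cf; apply: (cts_comp cf (g := fst)); exact: cvg_fst. Qed.

Lemma cts_snd X Y Z (f : X -> Y * Z) (x : X) :
  {for x, continuous f} -> {for x, continuous (fun y => (f y).2)}.
Proof. by move=> cf; apply: (cts_comp cf (g := snd)); exact: cvg_snd. Qed.

Lemma cts_near X Y (f g : X -> Y) (x : X) :
  {for x, continuous f} -> (\forall y \near x, f y = g y) ->
  {for x, continuous g}.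
Proof.
move=> cf fg; have e := nbhs_singleton fg.
rewrite /prop_for /continuous_at -e => P /cf fP; rewrite /= in fP *.
by apply: filterS2 fg fP => y /= ->.
Qed.

Lemma cts_nbhs X Y (f : X -> Y) (x : X) (P : set Y) :
  {for x, continuous f} -> nbhs (f x) P -> \forall y \near x, P (f y).
Proof. by move=> cf; exact: cf. Qed.

Lemma cts_open X Y (f : X -> Y) (x : X) (P : set Y) :
  {for x, continuous f} -> open P -> P (f x) -> \forall y \near x, P (f y).
Proof. by move=> cf oP Pf; apply: (cts_nbhs cf); exact: open_nbhs_nbhs. Qed.

Lemma cts_val X (A : set X) (x : A) : {for x, continuous (\val : A -> X)}.
Proof. exact: initial_continuous. Qed.

Lemma cts_sub X Y (A : set X) (f : Y -> A) (y : Y) :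
  {for y, continuous (fun z => \val (f z))} -> {for y, continuous f}.
Proof.
move=> cf P /= [_ [[Q oQ <-] Qf] /filterS]; apply.
exact: cts_open cf oQ Qf.
Qed.

Lemma near_sub X (A : set X) (x : A) (P : set X) : open A ->
  (\forall y \near x, P (\val (y : A))) -> nbhs (\val x) P.
Proof.
move=> oA [_ [[Q oQ <-] Qx] QP].
apply: (filterS (P := A `&` Q)).
  by move=> y [Ay Qy]; exact: (QP (to_sub Ay)).
apply: filterI; apply: open_nbhs_nbhs; split=> //.
exact: set_valP.
Qed.

Lemma cts_restrict X Y (A : set X) (f : X -> Y) (x : A) :
  {for \val x, continuous f} -> {for x, continuous (fun y : A => f (\val y))}.
Proof. by move=> cf; apply: cts_comp cf; exact: cts_val. Qed.

Lemma cts_unrestrict X Y (A : set X) (f : X -> Y) (x : A) : open A ->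
  {for x, continuous (fun y : A => f (\val y))} -> {for \val x, continuous f}.
Proof.
by move=> oA cf P /cf /= fP; exact: (near_sub oA fP).
Qed.

Lemma near_open X (A : set X) (x : X) : open A -> A x -> \forall y \near x, A y.
Proof. by move=> oA Ax; exact: open_nbhs_nbhs. Qed.

End PointwiseContinuity.

Section ModuleContinuity.
Variables (K : topologicalRingType) (V : topologicalRmodType K).
Variable X : topologicalType.

Lemma cts_subr (f g : X -> V) (x : X) :
  {for x, continuous f} -> {for x, continuous g} ->
  {for x, continuous (fun y => f y - g y)}.
Proof.
move=> cf cg; apply: (cts_comp (cts_pair cf cg) (g := fun p => p.1 - p.2)).
exact: modB_continuous.
Qed.

Lemma cts_oppr (f : X -> V) (x : X) :
  {for x, continuous f} -> {for x, continuous (fun y => - f y)}.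
Proof.
move=> cf; have := cts_subr (@cts_cst X V x 0) cf.
by rewrite (_ : (fun y => 0 - f y) = (fun y => - f y)) //;
  apply/funext => y; rewrite sub0r.
Qed.

Lemma cts_addr (f g : X -> V) (x : X) :
  {for x, continuous f} -> {for x, continuous g} ->
  {for x, continuous (fun y => f y + g y)}.
Proof.
move=> cf /cts_oppr cg; have := cts_subr cf cg.
rewrite (_ : (fun y => f y - - g y) = (fun y => f y + g y)) //.
by apply/funext => y; rewrite opprK.
Qed.

Lemma cts_scale (f : X -> V) (g : X -> K) (x : X) :
  {for x, continuous f} -> {for x, continuous g} ->
  {for x, continuous (fun y => f y ⋅ g y)}.
Proof.
move=> cf cg.
apply: (cts_comp (cts_pair cf cg) (g := fun p : V * K => (p.2 : K^c) *: p.1)).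
exact: modZ_continuous.
Qed.

Lemma cts_mulr (f g : X -> K) (x : X) :
  {for x, continuous f} -> {for x, continuous g} ->
  {for x, continuous (fun y => f y * g y)}.
Proof.
move=> cf cg; apply: (cts_comp (cts_pair cf cg) (g := fun p : K * K => p.1 * p.2)).
exact: ringM_continuous.
Qed.

End ModuleContinuity.

(** Decomposes a function into pairs, projections and ring or module operations. Any other
    ingredient must be present as a continuity hypothesis, which the first case picks up. *)
Ltac cts := repeat (lazymatch goal with
  | H : {for ?x, continuous ?f} |- {for ?x, continuous ?f} => exact: H
  | |- {for _, continuous (fun y => y)} => exact: cts_id
  | |- {for _, continuous (fun _ => ?c)} => exact: cts_cst
  | |- {for _, continuous (fun y => (@?f y, @?g y))} =>
      apply: (cts_pair (f := f) (g := g))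
  | |- {for _, continuous (pair ?p)} =>
      apply: (cts_pair (f := fun _ => p) (g := fun y => y))
  | |- {for _, continuous fst} => exact: cvg_fst
  | |- {for _, continuous snd} => exact: cvg_snd
  | |- {for _, continuous (fun y => fst (@?f y))} => apply: (cts_fst (f := f))
  | |- {for _, continuous (fun y => snd (@?f y))} => apply: (cts_snd (f := f))
  | |- {for _, continuous (fun y => rscale (@?f y) (@?g y))} =>
      apply: (cts_scale (f := f) (g := g))
  | |- {for _, continuous (fun y => GRing.mul (@?f y) (@?g y))} =>
      apply: (cts_mulr (f := f) (g := g))
  | |- {for _, continuous (fun y => (@?f y) - (@?g y))} =>
      apply: (cts_subr (f := f) (g := g))
  | |- {for _, continuous (fun y => (@?f y) + (@?g y))} =>
      apply: (cts_addr (f := f) (g := g))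
  | |- {for _, continuous (fun y => - (@?f y))} => apply: (cts_oppr (f := f))
  end).

(** * Calculus of continuous difference factorizers *)

Section Factorizers.
Variables (K : topologicalRingType).
Hypothesis dK : dense (units K).

(** Any two neighbourhoods of the two values contain a common point, namely the common value at a
    unit close to [t0]; in a Hausdorff space this forces equality. *)
Lemma units_dense_eq (W : topologicalType) (g1 g2 : K -> W) (t0 : K) :
  hausdorff_space W -> {for t0, continuous g1} -> {for t0, continuous g2} ->
  (\forall t \near t0, units K t -> g1 t = g2 t) -> g1 t0 = g2 t0.
Proof.
move=> hW c1 c2 E; apply: hW => A B nA nB.
have : nbhs t0 ((fun t => units K t -> g1 t = g2 t) `&`
    ((g1 @^-1` A) `&` (g2 @^-1` B))).
  by apply: filterI => //; apply: filterI; [exact: c1|exact: c2].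
rewrite nbhsE /= => -[O [oO Ot] OP].
have [t [Ot' ut]] := dK (ex_intro _ t0 Ot) oO.
have [e [At Bt]] := OP _ Ot'.
by exists (g1 t); split=> //; rewrite e.
Qed.

Section OneFactorizer.
Variables (V W : topologicalRmodType K).

(* [f] and [g] are total functions with irrelevant values outside of [U] and
   [ext1 U]; continuity is pointwise, as [U] is going to be open. *)
Definition is_fact (U : set V) (f : V -> W) (g : V * V * K -> W) : Prop :=
  (forall a, ext1 U a -> f (a.1.1 + a.1.2 ⋅ a.2) - f a.1.1 = g a ⋅ a.2) /\
  (forall a, ext1 U a -> {for a, continuous g}).

Lemma ext1_open (U : set V) : open U -> open (ext1 U).
Proof.
move=> oU; rewrite openE => a [h1 h2]; rewrite /interior.
apply: filterI.
  by apply: (cts_open (f := fun a : V * V * K => a.1.1) (P := U)) => //; cts.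
apply: (cts_open (f := fun a : V * V * K => a.1.1 + a.1.2 ⋅ a.2) (P := U)) => //.
by cts.
Qed.

Lemma fact_restrict (U U' : set V) f g : U' `<=` U ->
  is_fact U f g -> is_fact U' f g.
Proof.
by move=> s [h1 h2]; split=> a [a1 a2]; [apply: h1|apply: h2]; split; exact: s.
Qed.

Lemma fact_eq (U : set V) f f' g : (forall x, U x -> f x = f' x) ->
  is_fact U f g -> is_fact U f' g.
Proof.
by move=> e [h1 h2]; split=> // a [a1 a2]; rewrite -!e //; exact: h1.
Qed.

Hypothesis hW : hausdorff_space W.

(** Only the scalar varies: [x] and [v] are fixed, and openness keeps [x + v ⋅ t] in both domains
    for [t] near [t0]. The domains may differ, so that factorizers found on different open sets can
    be compared at a common triple. *)
Lemma fact_uniq (U U' : set V) f f' g g' a :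
  open U -> open U' -> is_fact U f g -> is_fact U' f' g' ->
  ext1 U a -> ext1 U' a -> (forall x, U x -> U' x -> f x = f' x) ->
  g a = g' a.
Proof.
move=> oU oU' [g1 g2] [h1 h2] Ua Ua' E; case: a Ua Ua' => -[x v] t0 Ua Ua'.
apply: (@units_dense_eq _ (fun t => g ((x, v), t)) (fun t => g' ((x, v), t)))
  => //.
- by apply: (cts_comp (g := g)); [cts|exact: g2].
- by apply: (cts_comp (g := g')); [cts|exact: h2].
have c : {for t0, continuous (fun t => x + v ⋅ t)} by cts.
have [a1 a2] := Ua; have [b1 b2] := Ua'; rewrite /= in a1 a2 b1 b2.
near=> t => ut; apply: (rscaleI ut).
have A : U (x + v ⋅ t) by near: t; exact: cts_open c oU a2.
have B : U' (x + v ⋅ t) by near: t; exact: cts_open c oU' b2.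
by rewrite -(g1 ((x, v), t)) // -(h1 ((x, v), t)) //= !E.
Unshelve. all: by end_near. Qed.

(** After multiplication by a unit [r] both sides telescope to [f (x + v ⋅ r + v' ⋅ r) - f x];
    cancelling [r] and letting it approach [t] gives the identity. *)
Lemma fact_add (U : set V) f g x v v' t : open U -> is_fact U f g ->
  U x -> U (x + v ⋅ t) -> U (x + v ⋅ t + v' ⋅ t) ->
  g ((x, v + v'), t) = g ((x + v ⋅ t, v'), t) + g ((x, v), t).
Proof.
move=> oU [g1 g2] Ux U1 U2.
apply: (@units_dense_eq _ (fun t => g ((x, v + v'), t))
  (fun t => g ((x + v ⋅ t, v'), t) + g ((x, v), t))) => //.
- apply: (cts_comp (g := g)); first by cts.
  by apply: g2; split=> //=; rewrite rscaleDl addrA.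
- apply: cts_addr.
    by apply: (cts_comp (g := g)); [cts|exact: g2].
  by apply: (cts_comp (g := g)); [cts|exact: g2].
have c1 : {for t, continuous (fun t => x + v ⋅ t)} by cts.
have c2 : {for t, continuous (fun t => x + v ⋅ t + v' ⋅ t)} by cts.
near=> r => ur; apply: (rscaleI ur); rewrite rscaleDl.
have A : U (x + v ⋅ r) by near: r; exact: cts_open c1 oU U1.
have B : U (x + v ⋅ r + v' ⋅ r) by near: r; exact: cts_open c2 oU U2.
rewrite -(g1 ((x, v), r)) // -(g1 ((x + v ⋅ r, v'), r)) //.
rewrite -(g1 ((x, v + v'), r)) //=; last by split=> //=; rewrite rscaleDl addrA.
by rewrite rscaleDl addrA addrA subrK.
Unshelve. all: by end_near. Qed.

(** After multiplication by a unit [r] both sides become [f (x + v ⋅ s ⋅ r) - f x]. Only [r] is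
    inverted; [s] is arbitrary. *)
Lemma fact_hom (U : set V) f g x v s t : open U -> is_fact U f g ->
  U x -> U (x + v ⋅ s ⋅ t) ->
  g ((x, v ⋅ s), t) = g ((x, v), s * t) ⋅ s.
Proof.
move=> oU [g1 g2] Ux U1.
have U1' r : U (x + v ⋅ s ⋅ r) -> ext1 U ((x, v), s * r).
  by move=> h; split=> //=; rewrite -rscaleA.
apply: (@units_dense_eq _ (fun t => g ((x, v ⋅ s), t))
  (fun t => g ((x, v), s * t) ⋅ s)) => //.
- by apply: (cts_comp (g := g)); [cts|exact: g2].
- apply: cts_scale; last by cts.
  by apply: (cts_comp (g := g)); [cts|apply: g2; exact: U1'].
have c1 : {for t, continuous (fun t => x + v ⋅ s ⋅ t)} by cts.
near=> r => ur; apply: (rscaleI ur).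
have A : U (x + v ⋅ s ⋅ r) by near: r; exact: cts_open c1 oU U1.
rewrite -(g1 ((x, v ⋅ s), r)) // rscaleA -(g1 ((x, v), s * r)) //=.
  by rewrite rscaleA.
exact: U1'.
Unshelve. all: by end_near. Qed.

(** With scalar [1] the factorizer identity reads [f y = f x + g (x, y - x, 1)] for [y] near [x],
    and the right-hand side is continuous at [x]. *)
Lemma fact_cts (U : set V) f g x : open U -> is_fact U f g -> U x ->
  {for x, continuous f}.
Proof.
move=> oU [g1 g2] Ux.
apply: (@cts_near _ _ (fun y => f x + g ((x, y - x), 1)) f).
  apply: cts_addr; first by cts.
  apply: (cts_comp (g := g)); first by cts.
  by apply: g2; split; rewrite //= subrr rscale0l addr0.
near=> y; have Uy : U y by near: y; exact: near_open.
rewrite -[X in _ + X](rscale1 (V := W)) -(g1 ((x, y - x), 1)) /=.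
  by rewrite rscale1 addrC subrK addrC subrK.
by split; rewrite //= rscale1 addrC subrK.
Unshelve. all: by end_near. Qed.

(* C^1 is a property of pairs of points rather than of points. *)
Lemma fact_two_local (U : set V) f : open U ->
  (forall x y, U x -> U y -> exists (U' : set V) g,
    [/\ open U', U' x, U' y & is_fact (U `&` U') f g]) ->
  exists g, is_fact U f g.
Proof.
move=> oU H.
have H' (a : V * V * K) : exists Ug : set V * (V * V * K -> W), ext1 U a ->
    [/\ open Ug.1, Ug.1 `<=` U, ext1 Ug.1 a & is_fact Ug.1 f Ug.2].
  have [[h1 h2]|n] := pselect (ext1 U a).
    have [U' [g [k1 k2 k3 k4]]] := H _ _ h1 h2.
    exists (U `&` U', g) => _; split=> //; first exact: openI.
    by move=> ? [].
  by exists (set0, fun _ => 0).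
(* The value at [a] is taken from the factorizer chosen for [a] itself. By uniqueness it agrees near
   [a] with that one fixed factorizer, whence continuity. *)
have [Ug UgP] := choiceP H'; exists (fun a => (Ug a).2 a); split.
  by move=> a /[dup] Ua /UgP [h1 h2 h3 [h4 h5]]; exact: h4.
move=> a /[dup] Ua /UgP [h1 h2 h3 h4].
apply: (@cts_near _ _ (Ug a).2); first by case: h4 => _; exact.
near=> b; have Eb : ext1 (Ug a).1 b.
  by near: b; exact: (near_open (ext1_open h1) h3).
have Ub : ext1 U b by case: Eb => *; split; exact: h2.
have [k1 k2 k3 k4] := UgP _ Ub.
by apply: (fact_uniq h1 k1 h4 k4).
Unshelve. all: by end_near. Qed.

End OneFactorizer.

(** Chain rule: [((f x, g (x, v, t)), t)] is an admissible triple for [U'] because its endpoint is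
    [f (x + v ⋅ t)], so the factorizer of the composite is read off there. *)
Lemma fact_comp (V W Z : topologicalRmodType K) (U : set V) (U' : set W)
    f f' g g' : open U -> (forall x, U x -> U' (f x)) ->
  is_fact U f g -> is_fact U' f' g' ->
  is_fact U (fun x => f' (f x)) (fun a : V * V * K => g' ((f a.1.1, g a), a.2) : Z).
Proof.
move=> oU s F F'; have [g1 g2] := F; have [h1 h2] := F'.
have E a : ext1 U a -> f a.1.1 + g a ⋅ a.2 = f (a.1.1 + a.1.2 ⋅ a.2).
  by move=> Ua; rewrite -g1 // addrC subrK.
have S a : ext1 U a -> ext1 U' ((f a.1.1, g a), a.2).
  by move=> Ua; split; rewrite /= ?E //; apply: s; case: Ua.
split.
  by move=> a Ua; rewrite -h1; [rewrite /= E|exact: S].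
move=> a Ua; apply: (cts_comp (g := g')); last by apply: h2; exact: S.
have cf : {for a, continuous (fun a : V * V * K => f a.1.1)}.
  apply: (cts_comp (f := fun a : V * V * K => a.1.1)); first by cts.
  by apply: (fact_cts oU F); case: Ua.
have cg := g2 _ Ua; cts.
Qed.

Section Total.
Variables (V W : topologicalRmodType K) (U : set V).

Definition total_ext (T : Type) (A : set T) (g : A -> W) (a : T) : W :=
  if pselect (A a) is left h then g (to_sub h) else 0.

Lemma total_extE (T : Type) (A : set T) (g : A -> W) (a : A) :
  total_ext g (\val a) = g a.
Proof.
rewrite /total_ext; case: pselect => [h|n].
  by congr g; exact: val_sub_inj.
by have := set_valP a.
Qed.

Lemma fact_total (f : U -> W) (F : V -> W) (g : ext1 U -> W) : open U ->
  (forall x, F (\val x) = f x) ->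
  difference_factorizer f g -> continuous g -> is_fact U F (total_ext g).
Proof.
move=> oU EF dg cg.
have E a (h : ext1 U a) : total_ext g a = g (to_sub h).
  by rewrite -[in LHS](_ : \val (to_sub h) = a) // total_extE.
split=> a h.
  by rewrite E -dg -!EF.
rewrite -[a]/(\val (to_sub h)).
apply: cts_unrestrict; first exact: ext1_open.
rewrite (_ : (fun y => _) = g); first exact: cg.
by apply/funext => b; rewrite total_extE.
Qed.

Lemma total_fact (f : U -> W) (F : V -> W) (g : V * V * K -> W) :
  (forall x, F (\val x) = f x) -> is_fact U F g ->
  difference_factorizer f (fun a : ext1 U => g (\val a)) /\
  continuous (fun a : ext1 U => g (\val a)).
Proof.
move=> EF [g1 g2]; split.
  by move=> a; rewrite -!EF /= g1 //; exact: (set_valP a).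
move=> a; apply: cts_restrict; apply: g2; exact: set_valP.
Qed.

(** The bridge from maps on subtypes to total functions; [F] may be any function that restricts to
    [f]. *)
Lemma C1_fact (f : U -> W) (F : V -> W) : open U ->
  (forall x, F (\val x) = f x) -> C1 f <-> exists g, is_fact U F g.
Proof.
move=> oU EF; split=> [[g [dg cg]]|[g Fg]].
  by exists (total_ext g); exact: fact_total.
by exists (fun a => g (\val a)); exact: total_fact.
Qed.

End Total.

Section C1Morphism.
Variables (V W : topologicalRmodType K) (U : set V) (f : U -> W).
Hypotheses (hW : hausdorff_space W) (oU : open U).

Lemma C1_morphism : C1 f -> exists f1 : ext1 U -> W,
  [/\ difference_factorizer f f1, continuous f1,
    forall g, difference_factorizer f g -> continuous g -> g = f1 &
    exists F : lin_dmap U [set: W],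
      [/\ is_dmor (lin_dcat U) (lin_dcat [set: W]) F,
          continuous_dmap F & given_by f f1 F]].
Proof.
move=> [f1 [d1 c1]]; have EF := total_extE f.
have F1 := fact_total oU EF d1 c1.
have cf (x : U) : {for x, continuous f}.
  rewrite (_ : f = fun x => total_ext f (\val x)); last first.
    by apply/funext => y; rewrite EF.
  by apply: cts_restrict; apply: (fact_cts oU F1); exact: set_valP.
exists f1; split=> //.
  move=> g dg cg; apply/funext => a.
  rewrite -[LHS]total_extE -[RHS]total_extE.
  apply: (fact_uniq hW oU oU (fact_total oU EF dg cg) F1) => //;
  exact: set_valP.
exists (factorizer_dmap f f1); split; last exact: factorizer_dmap_given.
  apply: factorizer_dmap_mor => //.
    move=> x v v' t a b c Ea Eb Ec.
    rewrite -[f1 a]total_extE -[f1 b]total_extE -[f1 c]total_extE Ea Eb Ec.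
    have [a1 a2] := set_valP a; have [b1 b2] := set_valP b.
    rewrite Ea Eb /= in a1 a2 b1 b2.
    exact: (fact_add hW oU F1).
  move=> x v s t a b Ea Eb.
  rewrite -[f1 a]total_extE -[f1 b]total_extE Ea Eb.
  have [a1 a2] := set_valP a; rewrite Ea /= -rscaleA in a1 a2.
  exact: (fact_hom hW oU F1).
have cs1 (a : ext1 U) : {for a, continuous (@start1 _ _ U)}.
  by apply: cts_sub; apply: (cts_restrict (f := fun a => a.1.1)); cts.
have cs11 (a : ext11 U) : {for a, continuous (@start11 _ _ U)}.
  by apply: cts_sub; apply: (cts_restrict (f := fun a => a.1.1)); cts.
have cp (a : ext11 U) : {for a, continuous (@partial0 _ _ U)}.
  apply: cts_sub; apply: (cts_restrict (f := fun a => (a.1, a.2.1 * a.2.2))).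
  by cts.
have cT (T : topologicalType) (x : U * T) :
    {for x, continuous (fun x : U * T => (Defs.to_setT f x.1, x.2))}.
  apply: cts_pair; last by cts.
  apply: cts_sub; apply: (cts_comp (f := fst) (g := f)); last exact: cf.
  exact: cvg_fst.
split=> a.
- apply: cts_sub; apply: (cts_pair
      (f := fun a : ext11 U => (f (start11 a), f1 (partial0 a)))
      (g := fun a : ext11 U => (\val a).2)).
    apply: cts_pair; last first.
      by apply: (cts_comp (g := f1)); [exact: cp|exact: c1].
    by apply: (cts_comp (g := f)); [exact: cs11|exact: cf].
  by apply: (cts_restrict (f := snd)); exact: cvg_snd.
- apply: cts_sub; apply: (cts_pair (f := fun a : ext1 U => (f (start1 a), f1 a))
    (g := fun a : ext1 U => (\val a).2)).
    apply: cts_pair; last exact: c1.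
    by apply: (cts_comp (g := f)); [exact: cs1|exact: cf].
  by apply: (cts_restrict (f := snd)); exact: cvg_snd.
- exact: cT.
- exact: cT.
Qed.

End C1Morphism.

End Factorizers.

(** * Gluing *)

Section Glue.
Variables (I : Type) (T : topologicalType) (X : I -> set T).
Variable R : I -> I -> T -> T -> Prop.

Local Notation gl a := (@Defs.glue I T X R _ a).

(* Coordinates in the piece [i], as a relation with values in [T] rather than in
   the subtype [X i]. *)
Definition gat (i : I) (a : T) (z : glued X R) : Prop :=
  exists2 a' : X i, \val a' = a & gl a' = z.

Lemma gat_ex (z : glued X R) : exists i a, gat i a z.
Proof.
case: z => C [i [a e]]; exists i, (\val a), a => //.
by apply: eq_exist; rewrite e.
Qed.

Lemma gat_dom i a z : gat i a z -> X i a.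
Proof. by move=> [a' <- _]; exact: set_valP. Qed.

Lemma gat_glue i (a : X i) : gat i (\val a) (gl a).
Proof. by exists a. Qed.

Lemma gat_mk i a : X i a -> exists z, gat i a z.
Proof. by move=> Xa; exists (gl (to_sub Xa)), (to_sub Xa). Qed.

Lemma gat_fun i a z z' : gat i a z -> gat i a z' -> z = z'.
Proof.
move=> [b eb <-] [c ec <-]; congr Defs.glue.
by apply: val_sub_inj; rewrite eb.
Qed.

(** The relations are graphs of maps [t i j] on [D i j], with irrelevant values elsewhere. The first
    five fields make them coherent identifications of points; the last three make coordinates
    continuous for the generated topology. *)
Record good_gluing (D : I -> I -> set T) (t : I -> I -> T -> T) : Prop :=
    GoodGluing {
  gluing_rel : forall i j a b, R i j a b <-> D i j a /\ b = t i j a ;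
  gluing_cod : forall i j a, D i j a -> X j (t i j a) ;
  gluing_id : forall i a, X i a -> D i i a /\ t i i a = a ;
  gluing_sym : forall i j a, D i j a -> D j i (t i j a) /\ t j i (t i j a) = a ;
  gluing_trans : forall i j k a, D i j a -> D j k (t i j a) ->
    D i k a /\ t i k a = t j k (t i j a) ;
  gluing_piece_open : forall i, open (X i) ;
  gluing_dom_open : forall i j, open (D i j) ;
  gluing_cts : forall i j a, D i j a -> {for a, continuous (t i j)} }.

Variables (D : I -> I -> set T) (t : I -> I -> T -> T).
Hypothesis HG : good_gluing D t.
Let RE := gluing_rel HG.
Let tX := gluing_cod HG.
Let t_id := gluing_id HG.
Let t_sym := gluing_sym HG.
Let t_trans := gluing_trans HG.
Let XO := gluing_piece_open HG.
Let DO := gluing_dom_open HG.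
Let t_cts := gluing_cts HG.

(** A point of the glued space is the set of its own coordinates, so equality can be tested by
    membership of [(j, b)] in the class of [a]; conversely, symmetry and the cocycle law move every
    further coordinate from one class to the other. *)
Lemma glue_eq i j (a : X i) (b : X j) :
  gl a = gl b <-> D i j (\val a) /\ \val b = t i j (\val a).
Proof.
split.
  move=> /(congr1 (@proj1_sig _ _)) /= e.
  have : glue_class X R j (\val b) (j, \val b).
    by split=> /=; [exact: set_valP|apply/RE; have [? ->] := t_id (set_valP b)].
  by rewrite -e => -[/= _ /RE].
move=> [Dab eb]; apply: eq_exist; apply/predeqP => -[k c] /=; split.
  move=> [Xc /RE [/= Dac ec]]; split=> //=; apply/RE.
  have [Dba ea] := t_sym Dab; rewrite -eb in Dba ea.
  have := @t_trans j i k (\val b); rewrite ea => /(_ Dba Dac) [? ->].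
  by split.
move=> [Xc /RE [/= Dbc ec]]; split=> //=; apply/RE.
rewrite eb in Dbc ec; have [Dac e] := t_trans Dab Dbc.
by rewrite e; split.
Qed.

Lemma gat_eq i j a b z : gat i a z -> gat j b z -> D i j a /\ b = t i j a.
Proof. by move=> [a' <- <-] [b' <- /esym/glue_eq]. Qed.

Lemma gat_inj i a b z : gat i a z -> gat i b z -> a = b.
Proof.
move=> ha hb; have [_ ->] := gat_eq ha hb.
by have [_ ->] := t_id (gat_dom ha).
Qed.

Lemma gat_trans i j a z : gat i a z -> D i j a -> gat j (t i j a) z.
Proof.
move=> [a' <- <-] Da; exists (to_sub (tX Da)) => //.
by apply/esym/glue_eq.
Qed.

Let subbase := [set O : set (glued X R) |
  exists (i : I) (P : set (X i)), open P /\ O = @Defs.glue I T X R i @` P].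

Let subbase_open O : subbase O -> open O.
Proof.
move=> sO; exists [set O]; last by rewrite bigcup_set1.
by move=> _ ->; exact: (finI_from1 id).
Qed.

Lemma gat_image_open i (P : set T) : open P ->
  open [set z | exists2 a, P a & gat i a z].
Proof.
move=> oP; apply: subbase_open; exists i, (\val @^-1` P); split.
  by apply: open_comp => // a _; exact: cts_val.
apply/predeqP => z; split=> [[a Pa [a' ea e]]|[a Pa <-]].
  by exists a' => //=; rewrite ea.
by exists (\val a) => //; exact: gat_glue.
Qed.

(** A single coordinate sees the whole neighbourhood filter. Pieces have open images, which settles
    one direction; the other reduces to subbasic open sets. *)
Lemma gat_nbhs i a z (N : set (glued X R)) : gat i a z ->
  nbhs z N <-> \forall b \near a, forall w, gat i b w -> N w.
Proof.
move=> az; split; last first.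
  move=> H; have : nbhs a [set b | forall w, gat i b w -> N w] := H.
  rewrite (@nbhsE T) => -[O [oO Oa] ON].
  apply: (filterS (P := [set w | exists2 b, (O `&` X i) b & gat i b w])).
    by move=> w [b [Ob _] bw]; exact: ON bw.
  apply: open_nbhs_nbhs; split; last first.
    by exists a => //; split=> //; exact: gat_dom az.
  by apply: gat_image_open; exact: openI.
rewrite (@nbhsE (glued X R)) => -[O [oO Oz] ON].
have [B sB eB] : exists2 B, B `<=` finI_from subbase id &
    \bigcup_(S in B) S = O by exact: oO.
move: Oz; rewrite -eB => -[Q BQ Qz].
suff : \forall b \near a, forall w, gat i b w -> Q w.
  apply: filterS => b H w /H Qw; apply: ON; rewrite -eB; by exists Q.
have [E sE eQ] := sB _ BQ; rewrite -eQ.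
apply: filterS (@filter_bigI T _ E
    (fun S => [set b | forall w, gat i b w -> S w]) (nbhs a) _ _).
  by move=> b H w bw S ES; exact: H.
move=> S SE; have /set_mem [j [P [oP eS]]] := sE _ SE.
have : S z by rewrite -eQ in Qz; exact: Qz.
rewrite eS => -[c Pc cz].
have cz' : gat j (\val c) z by exists c.
have [Da ec] := gat_eq az cz'.
(* A subbasic set is the image of an open part of another piece [j]; continuity of [t i j] pulls it
   back to the coordinate in [i]. *)
have nP : nbhs (t i j a) [set b | forall h : X j b, P (to_sub h)].
  rewrite -ec; apply: near_sub => //.
  have /near_open /(_ Pc) := oP; apply: filterS => y Py h.
  by rewrite (_ : to_sub h = y) //; exact: val_sub_inj.
near=> b => /= w bw.
have Db : D i j b by near: b; exact: near_open.
exists (to_sub (tX Db)).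
  have : forall h : X j (t i j b), P (to_sub h).
    by near: b; exact: (cts_nbhs (t_cts Da) nP).
  exact.
apply: (gat_fun (i := j) (a := t i j b)); last exact: gat_trans bw Db.
exact: (gat_glue (to_sub (tX Db))).
Unshelve. all: by end_near. Qed.

Lemma glued_cts_from (Y : topologicalType) (f : glued X R -> Y) i a z
    (h : T -> Y) : gat i a z -> {for a, continuous h} ->
  (\forall b \near a, forall w, gat i b w -> f w = h b) ->
  {for z, continuous f}.
Proof.
move=> az ch E N; have := nbhs_singleton E _ az => ->.
move=> /(cts_nbhs ch) /= nN; apply/(gat_nbhs _ az).
near=> b => w bw /=; have -> : f w = h b by move: w bw; near: b.
by near: b.
Unshelve. all: by end_near. Qed.

Lemma glued_cts_to (Y : topologicalType) (f : Y -> glued X R) i y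
    (h : Y -> T) : {for y, continuous h} ->
  (\forall x \near y, gat i (h x) (f x)) ->
  {for y, continuous f}.
Proof.
move=> ch E N; have yz := nbhs_singleton E.
move=> /(gat_nbhs _ yz) nN.
suff : \forall x \near y, N (f x) by [].
near=> x.
have : forall w, gat i (h x) w -> N w by near: x; exact: (cts_nbhs ch nN).
by apply; near: x.
Unshelve. all: by end_near. Qed.

Section Coordinate.
Variable a0 : T.

(* The coordinate in the piece [i], with the junk value [a0] elsewhere. *)
Definition gco (i : I) (z : glued X R) : T :=
  if pselect (exists a, gat i a z) is left h then projT1 (cid h) else a0.

Lemma gcoE i a z : gat i a z -> gco i z = a.
Proof.
move=> az; rewrite /gco; case: pselect => [h|n]; last by case: n; exists a.
by case: cid => b /= bz; apply: gat_inj bz az.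
Qed.

Lemma gco_at i a z : gat i a z -> gat i (gco i z) z.
Proof. by move=> az; rewrite (gcoE az). Qed.

Lemma gco_near i a z : gat i a z -> \forall w \near z, gat i (gco i w) w.
Proof.
move=> az; apply/(gat_nbhs _ az); near=> b => w; exact: gco_at.
Unshelve. all: by end_near. Qed.

Lemma gco_cts i a z : gat i a z -> {for z, continuous (gco i)}.
Proof.
move=> az; apply: (glued_cts_from az (h := fun b => b)); first exact: cts_id.
by near=> b => w; exact: gcoE.
Unshelve. all: by end_near. Qed.

End Coordinate.

End Glue.

(** * Transition maps *)

Lemma within_cts (X Y : topologicalType) (A : set X) (f : X -> Y) (x : X) :
  open A -> {within A, continuous f} -> A x -> {for x, continuous f}.
Proof.
move=> oA cf Ax; rewrite continuous_open_subspace // in cf.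
by apply: cf; exact: mem_set.
Qed.

Section ChartCalculus.
Variables (K : topologicalRingType) (V : topologicalRmodType K).
Variable M : topologicalType.
Implicit Types c d : chart M V.

(* [trans] as a total function. *)
Definition tau c d (x : V) : V := cfun d (cinv c x).

Lemma cinv_cts c x : is_chart c -> ccod c x -> {for x, continuous (cinv c)}.
Proof. by case=> *; apply: (within_cts (A := ccod c)). Qed.

Lemma cfun_cts c p : is_chart c -> cdom c p -> {for p, continuous (cfun c)}.
Proof. by case=> *; apply: (within_cts (A := cdom c)). Qed.

Lemma preim_chart_open c (O : set M) : is_chart c -> open O ->
  open [set x | ccod c x /\ O (cinv c x)].
Proof.
move=> hc oO; rewrite openE => x [cx dx]; apply: filterI.
  by apply: near_open => //; exact: ccod_open hc.
by apply: (cts_open (f := cinv c)) => //; exact: cinv_cts.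
Qed.

Lemma trans_dom_open c d : is_chart c -> is_chart d -> open (trans_dom c d).
Proof. by move=> hc /cdom_open; exact: preim_chart_open. Qed.

Lemma compatible_fact c d : is_chart c -> is_chart d -> compatible c d <->
  (exists g, is_fact (trans_dom c d) (tau c d) g) /\
  (exists g, is_fact (trans_dom d c) (tau d c) g).
Proof.
move=> hc hd; rewrite /compatible.
by rewrite (C1_fact (trans_dom_open hc hd) (F := tau c d)) //
  (C1_fact (trans_dom_open hd hc) (F := tau d c)).
Qed.

End ChartCalculus.

Record good_atlas (K : topologicalRingType) (V : topologicalRmodType K)
    (M : topologicalType) (A : set (chart M V)) : Prop := GoodAtlas {
  good_dense : dense (units K) ;
  good_hausdorff : hausdorff_space V ;
  good_manifold : is_manifold A ;
  good_charted : finitely_charted A }.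

Section Manifold.
Variables (K : topologicalRingType).
Variables (V : topologicalRmodType K) (M : topologicalType).
Variable A : set (chart M V).
Hypothesis HA : good_atlas A.
Let dK := good_dense HA.
Let hV := good_hausdorff HA.
Let hA := good_manifold HA.
Let fA := good_charted HA.

Local Notation dom c := (cdom (\val c)).
Local Notation cod c := (ccod (\val c)).
Local Notation phi c := (cfun (\val c)).
Local Notation psi c := (cinv (\val c)).
Local Notation ov c d := (trans_dom (\val c) (\val d)).
Local Notation tr c d := (tau (\val c) (\val d)).

Lemma chartP (c : A) : is_chart (\val c).
Proof. by apply: (atlas_chart hA); exact: set_valP. Qed.

Lemma ov_open (c d : A) : open (ov c d).
Proof. by apply: trans_dom_open; exact: chartP. Qed.

(** Four points are what associativity asks for: three composable arrows involve four objects.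
    Smaller numbers are obtained by repetition. *)
Lemma charted4 (p q r s : M) :
  exists c : A, [/\ dom c p, dom c q, dom c r & dom c s].
Proof.
have [||c Ac H] := fA (S := [set p] `|` [set q] `|` [set r] `|` [set s]).
- by rewrite !finite_setU; do !split; exact: finite_set1.
- by exists p; left; left; left.
exists (to_sub Ac); split; apply: H.
- by left; left; left.
- by left; left; right.
- by left; right.
- by right.
Qed.

Lemma factor_ex : exists G : A -> A -> V * V * K -> V,
  forall c d, is_fact (ov c d) (tr c d) (G c d).
Proof.
have H (cd : A * A) : exists g, is_fact (ov cd.1 cd.2) (tr cd.1 cd.2) g.
  have /compatible_fact [||] := atlas_compatible hA (set_valP cd.1) (set_valP cd.2);
    by [exact: chartP|exact: chartP|].
by have [G GP] := choiceP H; exists (fun c d => G (c, d)) => c d; exact: (GP (c, d)).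
Qed.

(** Chosen once and for all; on [dom1 c d] its values do not depend on the choice. *)
Definition factor : A -> A -> V * V * K -> V := projT1 (cid factor_ex).

Lemma factorP c d : is_fact (ov c d) (tr c d) (factor c d).
Proof. by rewrite /factor; case: cid. Qed.

Definition tr1 (c d : A) (a : V * V * K) : V * V * K :=
  ((tr c d a.1.1, factor c d a), a.2).

Definition dom1 (c d : A) : set (V * V * K) := ext1 (ov c d).

Lemma dom1_open c d : open (dom1 c d).
Proof. by apply: ext1_open; exact: ov_open. Qed.

Lemma tr_cts (c d : A) x : ov c d x -> {for x, continuous (tr c d)}.
Proof. exact: (fact_cts (ov_open c d) (factorP c d)). Qed.

Lemma tr1_cts c d a : dom1 c d a -> {for a, continuous (tr1 c d)}.
Proof.
move=> Da; have c1 : {for a, continuous (factor c d)}.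
  by case: (factorP c d) => _; exact.
have c2 : {for a, continuous (fun a : V * V * K => tr c d a.1.1)}.
  apply: (cts_comp (f := fun a : V * V * K => a.1.1)); first by cts.
  by apply: tr_cts; case: Da.
by rewrite /tr1; cts.
Qed.

Lemma trE (c d : A) x : psi c x \in dom d -> psi d (tr c d x) = psi c x.
Proof. by move=> /set_mem; exact: (cfunK (chartP d)). Qed.

Lemma tr_inv (c d : A) x : ov c d x ->
  ov d c (tr c d x) /\ psi d (tr c d x) = psi c x.
Proof.
move=> [cx dx]; have e := trE (mem_set dx); split=> //; split.
  exact: (cfun_cod (chartP d)).
by rewrite e; exact: (cinv_dom (chartP c)).
Qed.

Lemma tr1_end (c d : A) a : dom1 c d a ->
  (tr1 c d a).1.1 + (tr1 c d a).1.2 ⋅ (tr1 c d a).2 =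
    tr c d (a.1.1 + a.1.2 ⋅ a.2).
Proof. by move=> Da; rewrite /= -(factorP c d).1 // addrC subrK. Qed.

Lemma tr1_inv c d a : dom1 c d a -> dom1 d c (tr1 c d a).
Proof.
move=> Da; have [/tr_inv [h1 _] /tr_inv [h2 _]] := Da.
by split; rewrite ?tr1_end.
Qed.

Lemma ov_cod (c d : A) x : ov c d x -> cod c x. Proof. by case. Qed.

Lemma dom1_cod c d a : dom1 c d a -> ext1 (cod c) a.
Proof. by case=> /ov_cod ? /ov_cod ?. Qed.

Lemma tr1_cod c d a : dom1 c d a -> ext1 (cod d) (tr1 c d a).
Proof. by move=> /tr1_inv; exact: dom1_cod. Qed.

Lemma cod_ov (c : A) x : cod c x -> ov c c x.
Proof. by move=> cx; split=> //; exact: (cinv_dom (chartP c)). Qed.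

Lemma tr1_id c a : ext1 (cod c) a -> dom1 c c a /\ tr1 c c a = a.
Proof.
move=> [h1 h2]; have Da : dom1 c c a by split; exact: cod_ov.
split=> //; rewrite /tr1 /tau (cinvK (chartP c)) //.
(* The identity map has the factorizer [(x, v, t) |-> v]. *)
rewrite (fact_uniq (f' := id) (g' := fun a => a.1.2) dK hV
  (ov_open c c) (ov_open c c) (factorP c c) _ Da Da).
- by case: (a) => [[]].
- by split=> [b _ /=|b _]; [rewrite addrC addKr|cts].
- by move=> x [cx _] _; rewrite /tau (cinvK (chartP c)).
Qed.

(** Cocycle law for the extended transition maps: on the triple overlap the chain rule yields a
    second factorizer of the transition from [c] to [e], and uniqueness identifies it with the
    chosen one. *)
Lemma tr1_trans c d e a : dom1 c d a -> dom1 d e (tr1 c d a) ->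
  dom1 c e a /\ tr1 c e a = tr1 d e (tr1 c d a).
Proof.
move=> Da De; have h x : ov c d x -> ov d e (tr c d x) ->
    ov c e x /\ tr d e (tr c d x) = tr c e x.
  move=> cx [_]; have [_ e1] := tr_inv cx; rewrite /(tau _ _ (tau _ _ _)) e1.
  by case: cx.
have [a1 a2] := Da; have [b1 b2] := De; rewrite tr1_end // in b2.
have [c1 e1] := h _ a1 b1; have [c2 e2] := h _ a2 b2.
split=> //; rewrite /tr1 /= -e1; congr (_, _, _).
pose U := [set x | cod c x /\ (dom d `&` dom e) (psi c x)].
have oU : open U.
  apply: preim_chart_open; first exact: chartP.
  by apply: openI; exact: cdom_open (chartP _).
have Ud : U `<=` ov c d by move=> x [cx [dx _]].
have Ue x : U x -> ov d e (tr c d x).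
  move=> Ux; have [_ ee] := tr_inv (Ud _ Ux).
  case: Ux => cx [dx ex]; split; last by rewrite ee.
  exact: (cfun_cod (chartP d)).
have Ua : ext1 U a.
  case: (c1) (c2) => k1 k2 [k3 k4]; case: a1 a2 => k5 k6 [k7 k8].
  by split.
apply: (fact_uniq dK hV (ov_open c e) oU (factorP c e)
  (fact_comp oU Ue (fact_restrict Ud (factorP c d)) (factorP d e))) => // x k Ux.
by have [_ ->] := h _ (Ud _ Ux) (Ue _ Ux).
Qed.

Lemma tr1_sym c d a : dom1 c d a ->
  dom1 d c (tr1 c d a) /\ tr1 d c (tr1 c d a) = a.
Proof.
move=> Da; have Db := tr1_inv Da; split=> //.
have [_ <-] := tr1_trans Da Db.
by have [] := tr1_id (dom1_cod Da).
Qed.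

Lemma factor_uniq (c d : A) (g : ext1 (ov c d) -> V) (a : ext1 (ov c d)) :
  difference_factorizer (@trans _ _ _ (\val c) (\val d)) g -> continuous g ->
  g a = factor c d (\val a).
Proof.
move=> dg cg; rewrite -[LHS]total_extE; have oU := ov_open c d.
apply: (fact_uniq dK hV oU oU (fact_total (F := tr c d) oU _ dg cg)
  (factorP c d)) => //; exact: (set_valP a).
Qed.

Lemma factor_dif (c d : A) :
  difference_factorizer (@trans _ _ _ (\val c) (\val d))
    (fun a : ext1 (ov c d) => factor c d (\val a)) /\
  continuous (fun a : ext1 (ov c d) => factor c d (\val a)).
Proof. exact: (total_fact (F := tr c d) _ (factorP c d)). Qed.

(** Uniqueness replaces the existentially quantified factorizer by the chosen one, which turns the
    gluing relation into the graph of [tr1]. *)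
Lemma trans1P (c d : A) a b :
  trans1 (\val c) (\val d) a b <-> dom1 c d a /\ b = tr1 c d a.
Proof.
split=> [[g [dg cg [a' <- ->]]]|[Da ->]].
  split; first exact: (set_valP a').
  by rewrite /ext1_fun (factor_uniq _ dg cg).
have [dg cg] := factor_dif c d.
exists (fun a : ext1 (ov c d) => factor c d (\val a)); split=> //.
by exists (to_sub Da).
Qed.

(* M11 and TM are the pullbacks of M1 along the parameter maps
   (s,t) |-> st and 0 : {0} -> K. *)
Definition p11 (a : V * V * (K * K)) : V * V * K := (a.1, a.2.1 * a.2.2).

Lemma ext11_ext1 (U : set V) a : ext11 U a <-> ext1 U (p11 a).
Proof. by rewrite /ext11 /ext1 /= rscaleA. Qed.

Lemma trans11P (c d : A) a b : trans11 (\val c) (\val d) a b <->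
  dom1 c d (p11 a) /\ b = ((tr1 c d (p11 a)).1, a.2).
Proof.
split=> [[g [dg cg [a' <- ->]]]|[Da ->]].
  split; first by apply/ext11_ext1; exact: (set_valP a').
  by rewrite /ext11_fun (factor_uniq _ dg cg).
have [dg cg] := factor_dif c d.
exists (fun a : ext1 (ov c d) => factor c d (\val a)); split=> //.
by move/ext11_ext1: Da => Da; exists (to_sub Da).
Qed.

Definition pT (a : V * V) : V * V * K := (a, 0).

Lemma tangent_ext1 (U : set V) a : tangent_piece U a <-> ext1 U (pT a).
Proof.
rewrite /tangent_piece /ext1 /= rscale0r addr0; split=> [|[]] //.
Qed.

Lemma transTP (c d : A) a b : transT (\val c) (\val d) a b <->
  dom1 c d (pT a) /\ b = (tr1 c d (pT a)).1.
Proof.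
split=> [[g [dg cg [a' ea ->]]]|[Da ->]].
  rewrite -[pT a]ea; split; first exact: (set_valP a').
  by rewrite (factor_uniq _ dg cg).
have [dg cg] := factor_dif c d.
exists (fun a : ext1 (ov c d) => factor c d (\val a)); split=> //.
by exists (to_sub Da).
Qed.

Lemma tr1_add (c d : A) x v v' t : dom1 c d ((x, v), t) ->
  dom1 c d ((x + v ⋅ t, v'), t) ->
  tr1 c d ((x, v + v'), t) =
    ((tr c d x, factor c d ((x, v), t) + factor c d ((x + v ⋅ t, v'), t)), t).
Proof.
move=> [/= h1 h2] [/= _ h3]; rewrite /tr1 /=.
by rewrite (fact_add dK hV (ov_open c d) (factorP c d)) // addrC.
Qed.

Lemma tr1_scale (c d : A) x v s t : dom1 c d ((x, v), s * t) ->
  tr1 c d ((x, v ⋅ s), t) = ((tr c d x, factor c d ((x, v), s * t) ⋅ s), t).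
Proof.
move=> [/= h1 h2]; rewrite -rscaleA in h2; rewrite /tr1 /=.
by rewrite (fact_hom dK hV (ov_open c d) (factorP c d)).
Qed.

(** Additivity applied to two zero vectors; units of star therefore look the same in every chart. *)
Lemma factor0 (c d : A) x t : ov c d x -> factor c d ((x, 0), t) = 0.
Proof.
move=> ox; have D : dom1 c d ((x, 0), t) by split; rewrite //= rscale0l addr0.
have := tr1_add (v' := 0) D; rewrite rscale0l !addr0 => /(_ D).
rewrite /tr1 /= => -[] /eqP.
by rewrite -[X in X == _]addr0 (inj_eq (addrI _)) eq_sym => /eqP.
Qed.

End Manifold.

(** * The category M1 *)

Section Arrows.
Variables (K : topologicalRingType).
Variables (V : topologicalRmodType K) (M : topologicalType).
Variable A : set (chart M V).
Hypothesis HA : good_atlas A.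
Local Notation dom c := (cdom (\val c)).
Local Notation cod c := (ccod (\val c)).
Local Notation phi c := (cfun (\val c)).
Local Notation psi c := (cinv (\val c)).
Local Notation ov c d := (trans_dom (\val c) (\val d)).
Local Notation tr c d := (tau (\val c) (\val d)).
Local Notation tr1 := (tr1 HA).
Local Notation factor := (factor HA).

Definition at1 (c : A) (a : V * V * K) (z : M1 A) : Prop := gat c a z.

Lemma cod_open (c : A) : open (cod c).
Proof. exact: ccod_open (chartP HA c). Qed.

Lemma gluing1 : good_gluing (@piece1 K V M A)
  (fun c d : A => trans1 (\val c) (\val d)) (@dom1 K V M A) tr1.
Proof.
split.
- exact: trans1P.
- exact: tr1_cod.
- exact: tr1_id.
- exact: tr1_sym.
- exact: tr1_trans.
- by move=> c; exact: ext1_open (cod_open c).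
- exact: dom1_open.
- exact: tr1_cts.
Qed.

Lemma at1_ex z : exists c a, at1 c a z. Proof. exact: gat_ex. Qed.

Lemma at1_cod c a z : at1 c a z -> ext1 (cod c) a. Proof. exact: gat_dom. Qed.

Lemma at1_mk c a : ext1 (cod c) a -> exists z, at1 c a z.
Proof. exact: (@gat_mk A _ (@piece1 K V M A)). Qed.

Lemma at1_fun c a z z' : at1 c a z -> at1 c a z' -> z = z'.
Proof. exact: gat_fun. Qed.

Lemma at1_chart1 (c : A) (a : ext1 (cod c)) : at1 c (\val a) (chart1 a).
Proof. exact: gat_glue. Qed.

Lemma at1_eq c d a b z : at1 c a z -> at1 d b z ->
  dom1 c d a /\ b = tr1 c d a.
Proof. exact: (gat_eq gluing1). Qed.

Lemma at1_inj c a b z : at1 c a z -> at1 c b z -> a = b.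
Proof. exact: (gat_inj gluing1). Qed.

Lemma at1_trans c d a z : at1 c a z -> dom1 c d a -> at1 d (tr1 c d a) z.
Proof. exact: (gat_trans gluing1). Qed.

Lemma at1_cts_to (Y : topologicalType) (f : Y -> M1 A) c y (h : Y -> V * V * K) :
  {for y, continuous h} -> (\forall x \near y, at1 c (h x) (f x)) ->
  {for y, continuous f}.
Proof. exact: (glued_cts_to gluing1). Qed.

(* The coordinate in the chart [c] (0 outside of the chart). *)
Definition co1 (c : A) (z : M1 A) : V * V * K :=
  @gco A _ (@piece1 K V M A) _ 0 c z.

Lemma co1E c a z : at1 c a z -> co1 c z = a.
Proof. exact: (gcoE gluing1). Qed.

Lemma co1_near c a z : at1 c a z -> \forall w \near z, at1 c (co1 c w) w.
Proof. exact: (gco_near gluing1). Qed.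

Lemma co1_cts c a z : at1 c a z -> {for z, continuous (co1 c)}.
Proof. exact: (gco_cts gluing1). Qed.

(** The value is taken in one chart and shown to be right in every other chart; choice then gives a
    function with a formula valid in all charts. The same pattern produces targets, parameters,
    units, inverses and the projections below. *)
Lemma msrc_ex : exists f : M1 A -> M, forall z c a, at1 c a z ->
  f z = psi c a.1.1.
Proof.
have H (z : M1 A) : exists p : M, forall c a, at1 c a z -> p = psi c a.1.1.
  have [d [b bz]] := at1_ex z; exists (psi d b.1.1) => c a az.
  have [[h _] ->] := at1_eq bz az.
  by have [_ ->] := tr_inv HA h.
by have [f fP] := choiceP H; exists f => z c a; exact: fP.
Qed.

Lemma mtgt_ex : exists f : M1 A -> M, forall z c a, at1 c a z ->
  f z = psi c (a.1.1 + a.1.2 ⋅ a.2).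
Proof.
have H (z : M1 A) : exists p : M, forall c a, at1 c a z ->
    p = psi c (a.1.1 + a.1.2 ⋅ a.2).
  have [d [b bz]] := at1_ex z; exists (psi d (b.1.1 + b.1.2 ⋅ b.2)) => c a az.
  have [D ->] := at1_eq bz az; rewrite tr1_end //.
  by case: D => _ h; have [_ ->] := tr_inv HA h.
by have [f fP] := choiceP H; exists f => z c a; exact: fP.
Qed.

Lemma mkap_ex : exists f : M1 A -> K, forall z c a, at1 c a z -> f z = a.2.
Proof.
have H (z : M1 A) : exists p : K, forall c a, at1 c a z -> p = a.2.
  have [d [b bz]] := at1_ex z; exists b.2 => c a az.
  by have [D ->] := at1_eq bz az.
by have [f fP] := choiceP H; exists f => z c a; exact: fP.
Qed.

Definition msrc := projT1 (cid msrc_ex).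
Definition mtgt := projT1 (cid mtgt_ex).
Definition mkap := projT1 (cid mkap_ex).

Lemma msrcE c a z : at1 c a z -> msrc z = psi c a.1.1.
Proof. by rewrite /msrc; case: cid => f /= fP /fP. Qed.

Lemma mtgtE c a z : at1 c a z -> mtgt z = psi c (a.1.1 + a.1.2 ⋅ a.2).
Proof. by rewrite /mtgt; case: cid => f /= fP /fP. Qed.

Lemma mkapE c a z : at1 c a z -> mkap z = a.2.
Proof. by rewrite /mkap; case: cid => f /= fP /fP. Qed.

Lemma at1_src c a z : at1 c a z -> dom c (msrc z) /\ phi c (msrc z) = a.1.1.
Proof.
move=> az; rewrite (msrcE az); have [h _] := at1_cod az.
by rewrite (cinvK (chartP HA c)) //; split=> //; exact: (cinv_dom (chartP HA c)).
Qed.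

Lemma at1_tgt c a z : at1 c a z ->
  dom c (mtgt z) /\ phi c (mtgt z) = a.1.1 + a.1.2 ⋅ a.2.
Proof.
move=> az; rewrite (mtgtE az); have [_ h] := at1_cod az.
by rewrite (cinvK (chartP HA c)) //; split=> //; exact: (cinv_dom (chartP HA c)).
Qed.

(** An arrow is admissible for a chart as soon as its two endpoints are in the domain, whatever lies
    between them. This is why charts through finitely many prescribed points suffice. *)
Lemma at1_charted c z : dom c (msrc z) -> dom c (mtgt z) -> exists a, at1 c a z.
Proof.
have [d [b bz]] := at1_ex z; rewrite (msrcE bz) (mtgtE bz) => h1 h2.
exists (tr1 d c b); apply: at1_trans => //; have [k1 k2] := at1_cod bz.
by split.
Qed.

Lemma phi_psi (c : A) x : cod c x -> phi c (psi c x) = x.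
Proof. exact: (cinvK (chartP HA c)). Qed.

Lemma psi_phi (c : A) p : dom c p -> psi c (phi c p) = p.
Proof. exact: (cfunK (chartP HA c)). Qed.

Lemma phi_cod (c : A) p : dom c p -> cod c (phi c p).
Proof. exact: (cfun_cod (chartP HA c)). Qed.

Lemma dom_open (c : A) : open (dom c).
Proof. exact: (cdom_open (chartP HA c)). Qed.

Lemma charted2 (p q : M) : exists c : A, dom c p /\ dom c q.
Proof. by have [c [h1 h2 _ _]] := charted4 HA p q p q; exists c. Qed.

Definition mcomp (g f h : M1 A) : Prop := exists c a b,
  [/\ at1 c a f, at1 c b g, b.1.1 = a.1.1 + a.1.2 ⋅ a.2, b.2 = a.2 &
      at1 c ((a.1.1, a.1.2 + b.1.2), a.2) h].

(** Composition may be computed in any chart that sees both factors, not only in the one provided by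
    [mcomp]: extended transition maps are additive, and the end of the composite is the end of [g],
    so the composite is visible there too. *)
Lemma mcompE g f h c a b : mcomp g f h -> at1 c a f -> at1 c b g ->
  [/\ b.1.1 = a.1.1 + a.1.2 ⋅ a.2, b.2 = a.2 &
      at1 c ((a.1.1, a.1.2 + b.1.2), a.2) h].
Proof.
move=> [d [a' [b' [af bg e1 e2 h']]]] /(at1_eq af) [Da ->] /(at1_eq bg) [Db ->].
rewrite tr1_end // /= e1 e2; split=> //.
have Ea : a' = ((a'.1.1, a'.1.2), a'.2) by case: (a') => [[]].
have Eb : b' = ((a'.1.1 + a'.1.2 ⋅ a'.2, b'.1.2), a'.2).
  by rewrite -e1 -e2; case: (b') => [[]].
have D : dom1 d c (a'.1.1, a'.1.2 + b'.1.2, a'.2).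
  case: Da => h1 _; case: Db => _ h2; split=> //=.
  by rewrite rscaleDl addrA -e1 -[X in _ ⋅ X]e2.
have := at1_trans h' D; rewrite tr1_add -?Ea -?Eb //.
Qed.

Lemma mcomp_src g f h : mcomp g f h -> msrc h = msrc f.
Proof. by move=> [c [a [b [af bg e1 e2 ch]]]]; rewrite (msrcE ch) (msrcE af). Qed.

Lemma mcomp_tgt g f h : mcomp g f h -> mtgt h = mtgt g.
Proof.
move=> [c [a [b [af bg e1 e2 ch]]]]; rewrite (mtgtE ch) (mtgtE bg) /=.
by rewrite rscaleDl addrA e1 e2.
Qed.

Lemma mcomp_mid g f h : mcomp g f h -> mtgt f = msrc g.
Proof.
by move=> [c [a [b [af bg e1 e2 ch]]]]; rewrite (mtgtE af) (msrcE bg) e1.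
Qed.

Lemma mcomp_kap g f h : mcomp g f h -> mkap g = mkap f /\ mkap h = mkap f.
Proof.
by move=> [c [a [b [af bg e1 e2 ch]]]]; rewrite !(mkapE af, mkapE bg, mkapE ch).
Qed.

(** The composite is formed in a chart that contains all three objects. *)
Lemma mcomp_ex g f : mtgt f = msrc g -> mkap f = mkap g -> exists h, mcomp g f h.
Proof.
move=> e1 e2; have [c [h1 h2 h3 _]] := charted4 HA (msrc f) (mtgt f) (mtgt g) (msrc f).
have [a af] := at1_charted h1 h2.
have [b bg] : exists b, at1 c b g by apply: at1_charted; rewrite -?e1.
have E1 : b.1.1 = a.1.1 + a.1.2 ⋅ a.2.
  by have [_ <-] := at1_src bg; have [_ <-] := at1_tgt af; rewrite e1.
have E2 : b.2 = a.2 by rewrite -(mkapE af) -(mkapE bg).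
have [z zP] : exists z, at1 c (a.1.1, a.1.2 + b.1.2, a.2) z.
  apply: at1_mk; have [k1 k2] := at1_cod af; have [k3 k4] := at1_cod bg.
  by split=> //=; rewrite rscaleDl addrA -E1 -[X in _ + _ ⋅ X]E2.
by exists z, c, a, b.
Qed.

Lemma mcomp_uniq g f h h' : mcomp g f h -> mcomp g f h' -> h = h'.
Proof.
move=> H; have [c [a [b [af bg e1 e2 ch]]]] := H; move=> H'.
by have [_ _] := mcompE H' af bg; exact: at1_fun.
Qed.

Lemma mcomp_assoc h g f hg gf k l : mcomp h g hg -> mcomp g f gf ->
  mcomp h gf k -> mcomp hg f l -> k = l.
Proof.
move=> H1 H2 H3 H4.
have [c [h1 h2 h3 h4]] := charted4 HA (msrc f) (mtgt f) (mtgt g) (mtgt h).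
have [a af] := at1_charted h1 h2.
have [b bg] : exists b, at1 c b g.
  by apply: at1_charted; rewrite -?(mcomp_mid H2).
have [d dh] : exists b, at1 c b h.
  by apply: at1_charted; rewrite -?(mcomp_mid H1).
have [_ E1 k1] := mcompE H1 bg dh; have [_ E2 k2] := mcompE H2 af bg.
have [_ _ /= k3] := mcompE H3 k2 dh; have [_ _ /= k4] := mcompE H4 af k1.
by rewrite addrA in k4; apply: at1_fun k3 k4.
Qed.

Lemma midt_ex : exists f : M * K -> M1 A, forall p (c : A), dom c p.1 ->
  at1 c ((phi c p.1, 0), p.2) (f p).
Proof.
suff H (p : M * K) : exists z, forall c : A, dom c p.1 ->
    at1 c ((phi c p.1, 0), p.2) z by exact: (choiceP H).
case: p => p t /=; have [c [cp _]] := charted2 p p.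
have [z zP] : exists z, at1 c ((phi c p, 0), t) z.
  by apply: at1_mk; split; rewrite /= ?rscale0l ?addr0; exact: phi_cod.
exists z => d dp; have op : ov c d (phi c p).
  by split; [exact: phi_cod|rewrite psi_phi].
have D : dom1 c d (phi c p, 0, t) by split; rewrite /= ?rscale0l ?addr0.
by have := at1_trans zP D; rewrite /(tr1 _ _ _) /= factor0 // /tau psi_phi.
Qed.

Definition midt := projT1 (cid midt_ex).

Lemma midtE p (c : A) : dom c p.1 -> at1 c ((phi c p.1, 0), p.2) (midt p).
Proof. by rewrite /midt; case: cid => f /= fP; exact: fP. Qed.

Lemma midt_at (c : A) x t : cod c x -> at1 c ((x, 0), t) (midt (psi c x, t)).
Proof.
move=> cx; have := @midtE (psi c x, t) c; rewrite /= phi_psi //; apply.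
exact: (cinv_dom (chartP HA c)).
Qed.

Lemma midt_src p : msrc (midt p) = p.1.
Proof.
have [c [cp _]] := charted2 p.1 p.1.
by rewrite (msrcE (midtE cp)) psi_phi.
Qed.

Lemma midt_tgt p : mtgt (midt p) = p.1.
Proof.
have [c [cp _]] := charted2 p.1 p.1.
by rewrite (mtgtE (midtE cp)) rscale0l addr0 psi_phi.
Qed.

Lemma midt_kap p : mkap (midt p) = p.2.
Proof. by have [c [cp _]] := charted2 p.1 p.1; rewrite (mkapE (midtE cp)). Qed.

Lemma mcomp_idr f : mcomp f (midt (msrc f, mkap f)) f.
Proof.
have [c [a az]] := at1_ex f; have [h1 h2] := at1_src az.
have h3 := mkapE az.
exists c, ((phi c (msrc f), 0), mkap f), a; split=> //=.
- exact: (@midtE (_, _)).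
- by rewrite rscale0l addr0.
- by rewrite add0r h2 h3; case: (a) az => [[]].
Qed.

Lemma mcomp_idl f : mcomp (midt (mtgt f, mkap f)) f f.
Proof.
have [c [a az]] := at1_ex f; have [h1 h2] := at1_tgt az.
have h3 := mkapE az.
exists c, a, ((phi c (mtgt f), 0), mkap f); split=> //=.
- exact: (@midtE (_, _)).
- by rewrite addr0; case: (a) az => [[]].
Qed.

Definition mstar0 : catData (M1 A) (M * K) :=
  CatData (fun z => (msrc z, mkap z)) (fun z => (mtgt z, mkap z)) midt mcomp.

Lemma mstar0_cat : is_cat mstar0.
Proof.
split.
- move=> g f; split=> [[h H]|[e1 e2]] /=; last exact: mcomp_ex.
  by rewrite (mcomp_mid H); have [-> _] := mcomp_kap H.
- by move=> g f h h'; exact: mcomp_uniq.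
- by move=> g f h H /=; rewrite (mcomp_src H); have [_ ->] := mcomp_kap H.
- by move=> g f h H /=; rewrite (mcomp_tgt H); have [-> ->] := mcomp_kap H.
- by move=> [x t] /=; rewrite midt_src midt_kap.
- by move=> [x t] /=; rewrite midt_tgt midt_kap.
- exact: mcomp_idr.
- exact: mcomp_idl.
- by move=> h g f hg gf k l; exact: mcomp_assoc.
Qed.

Lemma minv_ex : exists i : M1 A -> M1 A, forall z c a, at1 c a z ->
  at1 c ((a.1.1 + a.1.2 ⋅ a.2, - a.1.2), a.2) (i z).
Proof.
suff H (z : M1 A) : exists w, forall c a, at1 c a z ->
    at1 c ((a.1.1 + a.1.2 ⋅ a.2, - a.1.2), a.2) w by exact: (choiceP H).
have [c [a az]] := at1_ex z.
have inv_cod (d : A) b : ext1 (cod d) b ->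
    ext1 (cod d) ((b.1.1 + b.1.2 ⋅ b.2, - b.1.2), b.2).
  by move=> [h1 h2]; split=> //=; rewrite rscaleNl addrK.
have [w ww] := at1_mk (inv_cod _ _ (at1_cod az)).
exists w => d b bz; have [D ->] := at1_eq az bz.
have D' : dom1 c d (a.1.1 + a.1.2 ⋅ a.2, - a.1.2, a.2).
  by case: D => h1 h2; split=> //=; rewrite rscaleNl addrK.
have := at1_trans ww D'; rewrite tr1_end //= /(tr1 _ _ (_, _)) /=.
(* The vector of the reversed arrow is minus that of the arrow in the chart [d] as well: by
   additivity the two add up to the factorizer at the zero vector, which vanishes. *)
congr at1; congr (_, _, _); apply/eqP; rewrite -addr_eq0; apply/eqP.
have D2 : dom1 c d (a.1.1, a.1.2, a.2) by case: (a) D => [[]].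
have ea : (a.1.1, a.1.2, a.2) = a by case: (a) => [[]].
have := tr1_add HA D2 D'; rewrite subrr [in RHS]addrC ea.
move=> /(congr1 (fun x => x.1.2)) /= <-.
by rewrite factor0 //; case: D.
Qed.

Definition minv := projT1 (cid minv_ex).

Lemma minvE z c a : at1 c a z ->
  at1 c ((a.1.1 + a.1.2 ⋅ a.2, - a.1.2), a.2) (minv z).
Proof. by rewrite /minv; case: cid => f /= fP; exact: fP. Qed.

Lemma minvP f : is_inverse mstar0 f (minv f).
Proof.
have [c [a az]] := at1_ex f; have i := minvE az; split=> /=.
  have [h1 h2] := at1_src az; exists c, a, ((a.1.1 + a.1.2 ⋅ a.2, - a.1.2), a.2).
  split=> //=; rewrite subrr -h2 -(mkapE az); exact: (@midtE (_, _)).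
have [h1 h2] := at1_tgt az; exists c, ((a.1.1 + a.1.2 ⋅ a.2, - a.1.2), a.2), a.
split=> //=; first by rewrite rscaleNl addrK.
by rewrite addNr -h2 -(mkapE az); exact: (@midtE (_, _)).
Qed.

Lemma psi_cts (c : A) x : cod c x -> {for x, continuous (psi c)}.
Proof. exact: cinv_cts (chartP HA c). Qed.

Lemma phi_cts (c : A) p : dom c p -> {for p, continuous (phi c)}.
Proof. exact: cfun_cts (chartP HA c). Qed.

Lemma msrc_cts z : {for z, continuous msrc}.
Proof.
have [c [a az]] := at1_ex z.
apply: (cts_near (f := fun w => psi c (co1 c w).1.1)).
  apply: (cts_comp (f := fun w => (co1 c w).1.1)).
    by have h := co1_cts az; cts.
  by rewrite (co1E az); apply: psi_cts; case: (at1_cod az).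
near=> w; apply/esym/msrcE; near: w; exact: co1_near az.
Unshelve. all: by end_near. Qed.

Lemma mtgt_cts z : {for z, continuous mtgt}.
Proof.
have [c [a az]] := at1_ex z.
apply: (cts_near (f := fun w => psi c ((co1 c w).1.1 + (co1 c w).1.2 ⋅ (co1 c w).2))).
  apply: (cts_comp (f := fun w => (co1 c w).1.1 + (co1 c w).1.2 ⋅ (co1 c w).2)).
    by have h := co1_cts az; cts.
  by rewrite (co1E az); apply: psi_cts; case: (at1_cod az).
near=> w; apply/esym/mtgtE; near: w; exact: co1_near az.
Unshelve. all: by end_near. Qed.

Lemma mkap_cts z : {for z, continuous mkap}.
Proof.
have [c [a az]] := at1_ex z.
apply: (cts_near (f := fun w => (co1 c w).2)); first by have h := co1_cts az; cts.
near=> w; apply/esym/mkapE; near: w; exact: co1_near az.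
Unshelve. all: by end_near. Qed.

Lemma midt_cts p : {for p, continuous midt}.
Proof.
have [c [cp _]] := charted2 p.1 p.1.
apply: (at1_cts_to (c := c) (h := fun p => ((phi c p.1, 0), p.2))).
  have h : {for p, continuous (fun p : M * K => phi c p.1)}.
    by apply: (cts_comp (f := fst)); [cts|exact: phi_cts].
  by cts.
near=> q; apply: midtE; near: q.
by apply: (cts_open (f := fst)) => //; [cts|exact: dom_open].
Unshelve. all: by end_near. Qed.

Lemma minv_cts z : {for z, continuous minv}.
Proof.
have [c [a az]] := at1_ex z; have h := co1_cts az.
apply: (at1_cts_to (c := c) (h := fun w => (((co1 c w).1.1 +
  (co1 c w).1.2 ⋅ (co1 c w).2, - (co1 c w).1.2), (co1 c w).2))); first by cts.
near=> w; apply: minvE; near: w; exact: co1_near az.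
Unshelve. all: by end_near. Qed.

(** Stated for families over an arbitrary space, so that it applies to every category whose arrows
    are mapped to [M1]: [M11], the tangent bundle and the fibers. *)
Lemma mcomp_cts (Y : topologicalType) (f g h : Y -> M1 A) y :
  {for y, continuous f} -> {for y, continuous g} ->
  (forall x, mcomp (g x) (f x) (h x)) -> {for y, continuous h}.
Proof.
move=> cf cg H.
have [c [a [b [af bg _ _ _]]]] := H y.
have kf : {for y, continuous (fun x => co1 c (f x))}.
  by apply: (cts_comp cf); exact: co1_cts af.
have kg : {for y, continuous (fun x => co1 c (g x))}.
  by apply: (cts_comp cg); exact: co1_cts bg.
apply: (at1_cts_to (c := c) (h := fun x => (((co1 c (f x)).1.1,
   (co1 c (f x)).1.2 + (co1 c (g x)).1.2), (co1 c (f x)).2))); first by cts.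
near=> x.
have Af : at1 c (co1 c (f x)) (f x).
  by near: x; exact: (cts_nbhs cf (co1_near af)).
have Ag : at1 c (co1 c (g x)) (g x).
  by near: x; exact: (cts_nbhs cg (co1_near bg)).
by have [_ _] := mcompE (H x) Af Ag.
Unshelve. all: by end_near. Qed.

End Arrows.

(** * M11 and TM as pullbacks of M1 *)

Section Pullback.
Variables (K : topologicalRingType).
Variables (V : topologicalRmodType K) (M : topologicalType).
Variable A : set (chart M V).
Hypothesis HA : good_atlas A.
Local Notation cod c := (ccod (\val c)).
Local Notation tr1 := (tr1 HA).

Variables (T P : topologicalType) (k : P -> K) (q : T -> V * V * K).
Variables (par : T -> P) (mk : V * V * P -> T).
Variables (X : A -> set T) (R : A -> A -> T -> T -> Prop).

(* A point of [T] is a pair of a vector pair and a parameter in [P], on which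
   the scalar [k] depends; so the gluing of the [X c] is M1 x_K P. *)
Record is_pullback : Prop := IsPullback {
  pullback_k : forall a, (q a).2 = k (par a) ;
  pullback_mkK : forall a, mk ((q a).1, par a) = a ;
  pullback_q : forall x, q (mk x) = (x.1, k x.2) ;
  pullback_par : forall x, par (mk x) = x.2 ;
  pullback_qc : forall a, {for a, continuous q} ;
  pullback_parc : forall a, {for a, continuous par} ;
  pullback_mkc : forall a, {for a, continuous mk} ;
  pullback_X : forall c a, X c a <-> ext1 (cod c) (q a) ;
  pullback_R : forall c d a b, R c d a b <->
    dom1 c d (q a) /\ b = mk ((tr1 c d (q a)).1, par a) }.

Hypothesis HP : is_pullback.

Let t (c d : A) (a : T) : T := mk ((tr1 c d (q a)).1, par a).

Let q_t c d a : q (t c d a) = tr1 c d (q a).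
Proof. by rewrite (pullback_q HP) -(pullback_k HP). Qed.

(** The map [q] intertwines [t] with [tr1] while the parameter stays fixed, so each law reduces to
    the corresponding one for [M1]. *)
Lemma pullback_gluing : good_gluing X R (fun c d => q @^-1` dom1 c d) t.
Proof.
split.
- exact: (pullback_R HP).
- by move=> c d a /(tr1_cod HA) h; apply/(pullback_X HP); rewrite q_t.
- move=> c a /(pullback_X HP) /(tr1_id HA) [h1 h2]; split=> //.
  by rewrite /t h2 (pullback_mkK HP).
- move=> c d a /(tr1_sym HA) [h1 h2]; split; first by rewrite /= q_t.
  by rewrite {1}/t q_t h2 (pullback_par HP) (pullback_mkK HP).
- move=> c d e a /= h1; rewrite q_t => h2.
  have [h3 h4] := tr1_trans h1 h2; split=> //.
  by rewrite /t h4 q_t (pullback_par HP).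
- move=> c; rewrite (_ : X c = q @^-1` ext1 (cod c)).
    apply: open_comp; last exact: ext1_open (cod_open HA c).
    by move=> a _; exact: (pullback_qc HP).
  by apply/predeqP => a; exact: (pullback_X HP).
- move=> c d; apply: open_comp; last exact: dom1_open HA c d.
  by move=> a _; exact: (pullback_qc HP).
- move=> c d a Da; apply: (cts_comp (g := mk)); last exact: (pullback_mkc HP).
  have h := pullback_parc HP (a := a).
  apply: cts_pair => //; apply: cts_fst; apply: cts_comp; last exact: tr1_cts.
  exact: (pullback_qc HP).
Qed.

Local Notation G := pullback_gluing.
Local Notation at_ := (@gat A T X R).

Lemma pull_ex : exists f : glued X R -> M1 A * P, forall w c a, at_ c a w ->
  at1 c (q a) (f w).1 /\ (f w).2 = par a.
Proof.
suff H (w : glued X R) : exists z : M1 A * P, forall c a, at_ c a w ->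
  at1 c (q a) z.1 /\ z.2 = par a by exact: (choiceP H).
have [d [b bw]] := gat_ex w.
have [z bz] : exists z, at1 d (q b) z.
  by apply: at1_mk; apply/(pullback_X HP); exact: gat_dom bw.
exists (z, par b) => c a aw /=.
have [D ->] := gat_eq G bw aw; split; last by rewrite (pullback_par HP).
by rewrite q_t; exact: at1_trans.
Qed.

Definition pull (w : glued X R) : M1 A := (projT1 (cid pull_ex) w).1.
Definition pullpar (w : glued X R) : P := (projT1 (cid pull_ex) w).2.

Lemma pullE c a w : at_ c a w -> at1 c (q a) (pull w).
Proof. by rewrite /pull; case: cid => f /= fP /fP []. Qed.

Lemma pullparE c a w : at_ c a w -> pullpar w = par a.
Proof. by rewrite /pullpar; case: cid => f /= fP /fP []. Qed.

Lemma pull_atP c a w : at_ c a w <-> at1 c (q a) (pull w) /\ pullpar w = par a.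
Proof.
split=> [h|[h1 h2]]; first by split; [exact: pullE|exact: (pullparE h)].
have [d [b bw]] := gat_ex w.
have [D e] := at1_eq HA (pullE bw) h1.
have := gat_trans G bw D; congr gat.
by rewrite /t -e -(pullparE bw) h2 (pullback_mkK HP).
Qed.

Lemma pull_kap w : mkap HA (pull w) = k (pullpar w).
Proof.
have [d [b bw]] := gat_ex w.
by rewrite (mkapE HA (pullE bw)) (pullparE bw) (pullback_k HP).
Qed.

Lemma pull_inj w w' : pull w = pull w' -> pullpar w = pullpar w' -> w = w'.
Proof.
move=> e1 e2; have [d [b bw]] := gat_ex w.
by apply: (gat_fun bw); apply/pull_atP; rewrite -e1 -e2; apply/pull_atP.
Qed.

Lemma pull_at c v p w : at1 c v (pull w) -> pullpar w = p -> at_ c (mk (v.1, p)) w.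
Proof.
move=> vw e; apply/pull_atP; rewrite (pullback_q HP) (pullback_par HP) /=.
split=> //; rewrite -e -pull_kap (mkapE HA vw); by case: (v) vw.
Qed.

(** Surjectivity onto the fibred product of [M1] and [P] over [K]. With [pull_inj] and
    [pull_cts_lift], the glued space has the points and the topology of that product, so that maps
    into it can be defined and tested by components. *)
Lemma pull_lift z p : mkap HA z = k p -> exists w, pull w = z /\ pullpar w = p.
Proof.
move=> e; have [c [v vz]] := at1_ex z.
have qv : q (mk (v.1, p)) = v.
  by rewrite (pullback_q HP) /= -e (mkapE HA vz); case: (v).
have [w ww] : exists w, at_ c (mk (v.1, p)) w.
  by apply: gat_mk; apply/(pullback_X HP); rewrite qv; exact: at1_cod vz.
exists w; split; last by rewrite (pullparE ww) (pullback_par HP).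
by apply: at1_fun vz; rewrite -qv; exact: pullE.
Qed.

Lemma pull_cts w : {for w, continuous pull}.
Proof.
have [c [a aw]] := gat_ex w; have h := gco_cts (a0 := a) G aw.
apply: (at1_cts_to HA (c := c) (h := fun w => q (gco a c w))).
  by apply: cts_comp h _; exact: (pullback_qc HP).
near=> u; apply: pullE; near: u; exact: (gco_near G a aw).
Unshelve. all: by end_near. Qed.

Lemma pullpar_cts w : {for w, continuous pullpar}.
Proof.
have [c [a aw]] := gat_ex w; have h := gco_cts (a0 := a) G aw.
apply: (cts_near (f := fun w => par (gco a c w))).
  by apply: cts_comp h _; exact: (pullback_parc HP).
near=> u; apply/esym/pullparE; near: u; exact: (gco_near G a aw).
Unshelve. all: by end_near. Qed.

Lemma pull_cts_lift (Y : topologicalType) (f : Y -> glued X R) y :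
  {for y, continuous (fun x => pull (f x))} ->
  {for y, continuous (fun x => pullpar (f x))} -> {for y, continuous f}.
Proof.
move=> c1 c2; have [c [v vz]] := at1_ex (pull (f y)).
apply: (glued_cts_to G (i := c)
  (h := fun x => mk ((co1 c (pull (f x))).1, pullpar (f x)))).
  apply: (cts_comp (g := mk)); last exact: (pullback_mkc HP).
  have h : {for y, continuous (fun x => co1 c (pull (f x)))}.
    by apply: (cts_comp c1); exact: co1_cts vz.
  by cts.
near=> x; apply: pull_at => //; near: x.
exact: (cts_nbhs c1 (co1_near HA vz)).
Unshelve. all: by end_near. Qed.

End Pullback.

Section PullbackInstances.
Variables (K : topologicalRingType).
Variables (V : topologicalRmodType K) (M : topologicalType).
Variable A : set (chart M V).
Hypothesis HA : good_atlas A.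

Lemma pullback11 : is_pullback HA (fun p : K * K => p.1 * p.2) (@p11 K V)
  snd (fun x => (x.1, x.2)) (@piece11 K V M A)
  (fun c d : A => trans11 (\val c) (\val d)).
Proof.
split=> //; try by move=> a; case: a.
- by move=> a; rewrite /p11; cts.
- by move=> a; cts.
- by move=> a; cts.
- by move=> c a; exact: ext11_ext1.
- exact: trans11P.
Qed.

Lemma pullbackT : is_pullback HA (fun p : [set (0 : K)] => \val p) (@pT K V)
  (fun _ => to_sub (erefl : [set (0 : K)] 0)) fst (@pieceT K V M A)
  (fun c d : A => transT (\val c) (\val d)).
Proof.
have E (p : [set (0 : K)]) : \val p = 0 by exact: (set_valP p).
split=> //.
- by move=> [v p] /=; rewrite E.
- by move=> x; apply: val_sub_inj; rewrite E.
- by move=> a; rewrite /pT; cts.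
- by move=> a; exact: cts_cst.
- by move=> a; cts.
- by move=> c a; exact: tangent_ext1.
- exact: transTP.
Qed.

Definition mp0 : M11 A -> M1 A := pull pullback11.
Definition mpar : M11 A -> K * K := pullpar pullback11.
Definition mpT : TM A -> M1 A := pull pullbackT.

Definition at11 (c : A) (a : V * V * (K * K)) (w : M11 A) : Prop := gat c a w.
Definition atT (c : A) (a : V * V) (w : TM A) : Prop := gat c a w.

Lemma at11P c a w : at11 c a w <-> at1 c (p11 a) (mp0 w) /\ mpar w = a.2.
Proof. exact: pull_atP. Qed.

Lemma atTP c a w : atT c a w <-> at1 c (pT a) (mpT w).
Proof.
split; first by move/(pull_atP pullbackT) => [].
move=> h; apply/(pull_atP pullbackT); split=> //; apply: val_sub_inj.
by rewrite /= [LHS](set_valP (pullpar pullbackT w)).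
Qed.

Lemma at11_ex w : exists c a, at11 c a w. Proof. exact: gat_ex. Qed.

Lemma at11_chart11 (c : A) (a : ext11 (ccod (\val c))) :
  at11 c (\val a) (chart11 a).
Proof. exact: gat_glue. Qed.

Lemma atT_chartT (c : A) (a : tangent_piece (ccod (\val c))) :
  atT c (\val a) (chartT a).
Proof. exact: gat_glue. Qed.

Lemma at11_fun c a w w' : at11 c a w -> at11 c a w' -> w = w'.
Proof. exact: gat_fun. Qed.

Lemma mp0_kap w : mkap HA (mp0 w) = (mpar w).1 * (mpar w).2.
Proof. exact: pull_kap. Qed.

Lemma mpT_kap w : mkap HA (mpT w) = 0.
Proof.
by rewrite [LHS](pull_kap pullbackT); exact: (set_valP (pullpar pullbackT w)).
Qed.

Lemma mp0_inj w w' : mp0 w = mp0 w' -> mpar w = mpar w' -> w = w'.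
Proof. exact: pull_inj. Qed.

Lemma mpT_inj w w' : mpT w = mpT w' -> w = w'.
Proof.
move=> e; apply: (pull_inj (HP := pullbackT) e); apply: val_sub_inj.
by rewrite [LHS](set_valP (pullpar pullbackT w))
  [RHS](set_valP (pullpar pullbackT w')).
Qed.

Lemma mp0_lift z p : mkap HA z = p.1 * p.2 -> exists w, mp0 w = z /\ mpar w = p.
Proof. by move=> e; apply: (pull_lift pullback11). Qed.

Lemma mpT_lift z : mkap HA z = 0 -> exists w, mpT w = z.
Proof.
move=> e.
by have [|w [ww _]] := pull_lift pullbackT (p := to_sub (erefl : [set (0 : K)] 0))
  (z := z) _; [|exists w].
Qed.

Lemma mp0_cts w : {for w, continuous mp0}. Proof. exact: pull_cts. Qed.
Lemma mpT_cts w : {for w, continuous mpT}. Proof. exact: pull_cts. Qed.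
Lemma mpar_cts w : {for w, continuous mpar}. Proof. exact: pullpar_cts. Qed.

Lemma mp0_cts_lift (Y : topologicalType) (f : Y -> M11 A) y :
  {for y, continuous (fun x => mp0 (f x))} ->
  {for y, continuous (fun x => mpar (f x))} -> {for y, continuous f}.
Proof. exact: (pull_cts_lift (HP := pullback11)). Qed.

Lemma mpT_cts_lift (Y : topologicalType) (f : Y -> TM A) y :
  {for y, continuous (fun x => mpT (f x))} -> {for y, continuous f}.
Proof.
move=> h; apply: (pull_cts_lift (HP := pullbackT)) => //.
apply: cts_sub; apply: (cts_near (f := fun _ => 0)); first exact: cts_cst.
near=> x; apply/esym; exact: (set_valP (pullpar pullbackT (f x))).
Unshelve. all: by end_near. Qed.

End PullbackInstances.

(** * The glued double category *)

Section GluedDoubleCategory.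
Variables (K : topologicalRingType).
Variables (V : topologicalRmodType K) (M : topologicalType).
Variable A : set (chart M V).
Hypothesis HA : good_atlas A.
Local Notation dom c := (cdom (\val c)).
Local Notation cod c := (ccod (\val c)).
Local Notation phi c := (cfun (\val c)).
Local Notation psi c := (cinv (\val c)).
Local Notation tr1 := (tr1 HA).
Local Notation factor := (factor HA).
Local Notation msrc := (msrc HA).
Local Notation mtgt := (mtgt HA).
Local Notation mkap := (mkap HA).
Local Notation mp0 := (mp0 HA).
Local Notation mpar := (mpar HA).
Local Notation midt := (midt HA).

Lemma at11_at1 c a w : at11 c a w -> at1 c (p11 a) (mp0 w).
Proof. by move=> /(at11P HA) []. Qed.

Lemma at11_par c a w : at11 c a w -> mpar w = a.2.
Proof. by move=> /(at11P HA) []. Qed.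

(** Unlike the source projection [mp0], the bullet target is not given by the pullback description.
    Its independence of the chart is the homogeneity of the factorizers. *)
Lemma mp1_ex : exists f : M11 A -> M1 A, forall w c a, at11 c a w ->
  at1 c ((a.1.1, a.1.2 ⋅ a.2.1), a.2.2) (f w).
Proof.
suff H (w : M11 A) : exists z, forall c a, at11 c a w ->
  at1 c ((a.1.1, a.1.2 ⋅ a.2.1), a.2.2) z by exact: (choiceP H).
have [d [b bw]] := at11_ex w.
have sc (c : A) a : ext1 (cod c) (p11 a) ->
    ext1 (cod c) ((a.1.1, a.1.2 ⋅ a.2.1), a.2.2).
  by move=> [h1 h2]; split=> //=; rewrite rscaleA.
have [z bz] := at1_mk (sc _ _ (at1_cod (at11_at1 bw))).
exists z => c a aw; have [D] := at1_eq HA (at11_at1 bw) (at11_at1 aw).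
have := at11_par aw; rewrite (at11_par bw) => <- ep.
have D' : dom1 d c (b.1.1, b.1.2 ⋅ b.2.1, b.2.2).
  by case: D => h1 h2; split=> //=; rewrite rscaleA.
have := at1_trans HA bz D'; rewrite tr1_scale; last by case: (b) D => [[? ?] [? ?]].
congr at1; rewrite -[a.1.1]/((p11 a).1.1) -[a.1.2]/((p11 a).1.2) ep /=.
by rewrite /p11; case: (b) => [[? ?] [? ?]].
Qed.

Definition mp1 := projT1 (cid mp1_ex).

Lemma at11_mp1 w c a : at11 c a w ->
  at1 c ((a.1.1, a.1.2 ⋅ a.2.1), a.2.2) (mp1 w).
Proof. by rewrite /mp1; case: cid => f /= fP /fP. Qed.

Lemma mp1_src w : msrc (mp1 w) = msrc (mp0 w).
Proof.
have [c [a aw]] := at11_ex w.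
by rewrite (msrcE HA (at11_mp1 aw)) (msrcE HA (at11_at1 aw)).
Qed.

Lemma mp1_tgt w : mtgt (mp1 w) = mtgt (mp0 w).
Proof.
have [c [a aw]] := at11_ex w.
by rewrite (mtgtE HA (at11_mp1 aw)) (mtgtE HA (at11_at1 aw)) /= rscaleA.
Qed.

Lemma mp1_kap w : mkap (mp1 w) = (mpar w).2.
Proof.
have [c [a aw]] := at11_ex w.
by rewrite (mkapE HA (at11_mp1 aw)) (at11_par aw).
Qed.

Lemma mz_ex : exists f : M1 A -> M11 A, forall z,
  mp0 (f z) = z /\ mpar (f z) = (1, mkap z).
Proof.
suff H (z : M1 A) : exists w, mp0 w = z /\ mpar w = (1, mkap z)
  by exact: (choiceP H).
by apply: mp0_lift; rewrite mul1r.
Qed.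

Definition mz := projT1 (cid mz_ex).
Lemma mz_mp0 z : mp0 (mz z) = z.
Proof. by rewrite /mz; case: cid => f /= fP; case: (fP z). Qed.
Lemma mz_par z : mpar (mz z) = (1, mkap z).
Proof. by rewrite /mz; case: cid => f /= fP; case: (fP z). Qed.

Lemma midt11_ex : exists f : M * (K * K) -> M11 A, forall x,
  mp0 (f x) = midt (x.1, x.2.1 * x.2.2) /\ mpar (f x) = x.2.
Proof.
suff H (x : M * (K * K)) : exists w, mp0 w = midt (x.1, x.2.1 * x.2.2) /\
  mpar w = x.2 by exact: (choiceP H).
by apply: mp0_lift; rewrite midt_kap.
Qed.

Definition midt11 := projT1 (cid midt11_ex).
Lemma midt11_mp0 x : mp0 (midt11 x) = midt (x.1, x.2.1 * x.2.2).
Proof. by rewrite /midt11; case: cid => f /= fP; case: (fP x). Qed.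
Lemma midt11_par x : mpar (midt11 x) = x.2.
Proof. by rewrite /midt11; case: cid => f /= fP; case: (fP x). Qed.

Lemma at11_lift c a w z :
  at1 c (p11 a) z -> mp0 w = z -> mpar w = a.2 -> at11 c a w.
Proof. by move=> az e1 e2; apply/(at11P HA); rewrite e1. Qed.

Lemma mz_at c a z : at1 c a z -> at11 c (a.1, (1, a.2)) (mz z).
Proof.
move=> az; apply: (at11_lift (z := z)); rewrite ?mz_mp0 ?mz_par //.
  by rewrite /p11 /= mul1r; case: (a) az.
by rewrite (mkapE HA az).
Qed.

Lemma mz_mp1 z : mp1 (mz z) = z.
Proof.
have [c [a az]] := at1_ex z; apply: (at1_fun (c := c) (a := a)) => //.
have := at11_mp1 (mz_at az); rewrite /= rscale1.
by case: (a) => [[? ?] ?].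
Qed.

Definition mstar1 : catData (M11 A) (M * (K * K)) :=
  CatData (fun w => (msrc (mp0 w), mpar w)) (fun w => (mtgt (mp0 w), mpar w))
    midt11 (fun g f h => [/\ mpar g = mpar f, mpar h = mpar f &
                             mcomp (mp0 g) (mp0 f) (mp0 h)]).

(** The composite has the same arrow of [M1] as [f], because its parameter [(s s') t'] equals [s t]
    when [t = s' t']. *)
Definition mbul1 : catData (M11 A) (M1 A) :=
  CatData mp0 mp1 mz (fun g f h => [/\ mp1 f = mp0 g, mp0 h = mp0 f &
    mpar h = ((mpar f).1 * (mpar g).1, (mpar g).2)]).

Definition gdcat : mdcatData A :=
  DcatData mstar1 (mstar0 HA) mbul1 (cat_prodl M (left_action_cat K)).

Lemma mstar1_cat : is_cat mstar1.
Proof.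
have S0 := mstar0_cat HA.
split.
- move=> g f; split=> [[h [e1 e2 H]]|[e1 e2]] /=.
    by rewrite (mcomp_mid HA H) e1.
  have [h H] := mcomp_ex e1 (etrans (etrans (mp0_kap HA f)
    (congr1 (fun p => p.1 * p.2) e2)) (esym (mp0_kap HA g))).
  have [w [w1 w2]] : exists w, mp0 w = h /\ mpar w = mpar f.
    by apply: mp0_lift; have [_ ->] := mcomp_kap HA H; exact: mp0_kap.
  by exists w; split=> //; rewrite w1.
- move=> g f h h' [_ e H] [_ e' H']; apply: (mp0_inj (HA := HA)).
    exact: mcomp_uniq H H'.
  by rewrite e e'.
- by move=> g f h [e1 e2 H] /=; rewrite (mcomp_src HA H) e2.
- by move=> g f h [e1 e2 H] /=; rewrite (mcomp_tgt HA H) e2 e1.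
- by move=> [x p] /=; rewrite midt11_mp0 midt11_par midt_src.
- by move=> [x p] /=; rewrite midt11_mp0 midt11_par midt_tgt.
- move=> f; split=> /=; rewrite ?midt11_par //= midt11_mp0 /= -mp0_kap.
  exact: mcomp_idr.
- move=> f; split=> /=; rewrite ?midt11_par //= midt11_mp0 /= -mp0_kap.
  exact: mcomp_idl.
- move=> h g f hg gf k l [a1 a2 a3] [b1 b2 b3] [c1 c2 c3] [d1 d2 d3].
  apply: (mp0_inj (HA := HA)); first exact: (mcomp_assoc HA a3 b3 c3 d3).
  by rewrite c2 d2 b2.
Qed.

Lemma mbul1_cat : is_cat mbul1.
Proof.
split.
- move=> g f; split=> [[h []]//|/= e].
  have [w [w1 w2]] : exists w, mp0 w = mp0 f /\
      mpar w = ((mpar f).1 * (mpar g).1, (mpar g).2).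
    apply: mp0_lift; rewrite /= -mulrA -mp0_kap -e mp1_kap.
    exact: mp0_kap.
  by exists w.
- move=> g f h h' [_ e1 e2] [_ e3 e4].
  by apply: (mp0_inj (HA := HA)); rewrite ?e1 ?e3 // e2 e4.
- by move=> g f h [].
(* The target of a composite is the one axiom that needs coordinates: from [v] one reaches
   [(v s) s'] through [g], and [v (s s')] directly. *)
- move=> g f h [/= e1 e2 e3].
  have [c [a af]] := at11_ex f; have ah := at11_at1 af.
  have mf := at11_mp1 af; have := mf; rewrite e1 => mg.
  have ag : at11 c ((a.1.1, a.1.2 ⋅ a.2.1), mpar g) g.
    apply: (at11_lift (z := mp0 g)) => //=.
    by rewrite /p11 /= -mp0_kap (mkapE HA mg).
  have ch : at11 c (a.1, (a.2.1 * (mpar g).1, (mpar g).2)) h.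
    apply: (at11_lift (z := mp0 f)); rewrite ?e2 //= ?e3 ?(at11_par af) //.
    rewrite /p11 /= -mulrA -mp0_kap -e1 mp1_kap (at11_par af).
    exact: ah.
  apply: (at1_fun (at11_mp1 ch)).
  by have := at11_mp1 ag; rewrite /= rscaleA.
- exact: mz_mp0.
- exact: mz_mp1.
- move=> f; split=> /=; first by rewrite mz_mp1.
    by rewrite mz_mp0.
  by rewrite mz_par /= mul1r; case: (mpar f).
- move=> f; split=> //=; first by rewrite mz_mp0.
  by rewrite mz_par /= mulr1 mp1_kap; case: (mpar f).
- move=> h g f hg gf k l [a1 a2 a3] [b1 b2 b3] [c1 c2 c3] [d1 d2 d3].
  apply: (mp0_inj (HA := HA)); rewrite ?c2 ?c3 ?d2 ?d3 //.
  by rewrite b3 a3 /= mulrA.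
Qed.

Lemma mp1_functor : is_functor mstar1 (mstar0 HA) mp1
  (tgt (cat_prodl M (left_action_cat K))).
Proof.
split.
- by move=> f /=; rewrite mp1_src mp1_kap.
- by move=> f /=; rewrite mp1_tgt mp1_kap.
- move=> [x p] /=; have [c [cx _]] := charted2 HA x x.
  have H : at11 c ((phi c x, 0), p) (midt11 (x, p)).
    apply: (at11_lift (z := midt (x, p.1 * p.2))); rewrite ?midt11_mp0 ?midt11_par //.
    by apply: (@midtE _ _ _ _ HA (_, _)).
  have := at11_mp1 H; rewrite /= rscale0l => H1; apply: (at1_fun H1).
  by apply: (@midtE _ _ _ _ HA (_, _)).
- move=> g f h [e1 e2 H].
  (* In a chart through the three objects, star adds vectors and the bullet target multiplies them
     by the common scalar [s], which distributes over sums. *)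
  have [c [h1 h2 h3 _]] := charted4 HA (msrc (mp0 f)) (mtgt (mp0 f))
    (mtgt (mp0 g)) (msrc (mp0 f)).
  have [a af] := at1_charted h1 h2.
  have [b bg] : exists b, at1 c b (mp0 g).
    by apply: at1_charted; rewrite -?(mcomp_mid HA H).
  have [E1 E2 E3] := mcompE HA H af bg.
  have lift v w : at1 c v (mp0 w) -> at11 c (v.1, mpar w) w.
    move=> vw; apply: (at11_lift (z := mp0 w)) => //.
    by rewrite /p11 -mp0_kap (mkapE HA vw); case: (v) vw.
  have /lift/at11_mp1 /= af' := af; have /lift/at11_mp1 /= bg' := bg.
  have /lift/at11_mp1 /= ch' := E3.
  exists c; do 2!eexists; split; [exact: af'|exact: bg'| | |] => /=.
  + by rewrite E1 rscaleA -mp0_kap (mkapE HA af).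
  + by rewrite e1.
  + by rewrite e1 -rscaleDl; move: ch'; rewrite e2.
Qed.

Lemma gdcat_dcat : is_dcat gdcat.
Proof.
split.
- exact: mstar1_cat.
- exact: mstar0_cat.
- exact: mbul1_cat.
- exact: cat_prodl_cat (left_action_cat_cat K).
- split=> /=.
  + by move=> f; rewrite mp0_kap.
  + by move=> f; rewrite mp0_kap.
  + by move=> x; rewrite midt11_mp0.
  + by move=> g f h [].
- exact: mp1_functor.
- split=> /=.
  + by move=> f; rewrite mz_mp0 mz_par.
  + by move=> f; rewrite mz_mp0 mz_par.
  + move=> [x t]; apply: (mp0_inj (HA := HA)).
      by rewrite mz_mp0 midt11_mp0 /= mul1r.
    by rewrite mz_par midt11_par midt_kap.
  + move=> g f h H; rewrite !mz_par !mz_mp0.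
    by have [-> ->] := mcomp_kap HA H.
- split=> /=.
  + by move=> f; rewrite mp0_kap.
  + by move=> f; rewrite mp1_src mp1_kap.
  + by move=> f; rewrite mz_mp0 mz_par.
  + move=> g f h [e1 e2 e3]; split=> //=; rewrite -?e1 ?e2 ?mp1_src //.
    by rewrite -mp0_kap -e1 mp1_kap e3.
- split=> /=.
  + by move=> f; rewrite mp0_kap.
  + by move=> f; rewrite mp1_tgt mp1_kap.
  + by move=> f; rewrite mz_mp0 mz_par.
  + move=> g f h [e1 e2 e3]; split=> //=; rewrite -?e1 ?e2 ?mp1_tgt //.
    by rewrite -mp0_kap -e1 mp1_kap e3.
- split=> /=.
  + by move=> [x p]; rewrite midt11_mp0.
  + by move=> [x p]; case: mp1_functor => _ _ ->.
  + move=> [x t]; apply: (mp0_inj (HA := HA)).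
      by rewrite mz_mp0 midt11_mp0 /= mul1r.
    by rewrite mz_par midt11_par midt_kap.
  + move=> [x p] [y r] [z u] [/= -> -> [e1 ->]].
    case: mp1_functor => _ _ -> _ /=.
    rewrite !midt11_mp0 !midt11_par /= e1; split=> //.
    by rewrite mulrA.
(* Bullet keeps the arrow of [M1] of the factor applied first, so both sides lie over the star
   composite of [c] and [d]; the scalars agree by computation. *)
- move=> a b c d ab cd ac bd x y [a1 a2 a3] [b1 b2 b3] [c1 c2 c3].
  move=> [d1 d2 d3] [e1 e2 e3] [f1 f2 f3].
  apply: (mp0_inj (HA := HA)).
    by rewrite d2 e2 in f3; rewrite c2; exact: mcomp_uniq b3 f3.
  by rewrite c3 f2 e3 b2 a2.
Qed.

End GluedDoubleCategory.

(** Once arrows, objects and composable pairs all come from charts, the chart functors determine the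
    whole structure. Covering arrows alone would leave composites across different charts
    undetermined. *)
Lemma covered_cat_eq (I : Type) (C1 C0 : I -> Type)
    (C : forall i, catData (C1 i) (C0 i)) (E1 E0 : Type) (D D' : catData E1 E0)
    (F1 : forall i, C1 i -> E1) (F0 : forall i, C0 i -> E0) :
  is_cat D -> is_cat D' ->
  (forall i, is_functor (C i) D (F1 i) (F0 i)) ->
  (forall i, is_functor (C i) D' (F1 i) (F0 i)) ->
  (forall f, exists i a, f = F1 i a) -> (forall x, exists i a, x = F0 i a) ->
  (forall g f h, comp D g f h -> exists i b a k,
    [/\ g = F1 i b, f = F1 i a, h = F1 i k & comp (C i) b a k]) ->
  D = D'.
Proof.
move=> hD hD' H H' s1 s0 sc; apply: catData_eq => //.
- move=> f; have [i [a ->]] := s1 f.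
  by case: (H i) (H' i) => + _ _ _ [+ _ _ _] => -> ->.
- move=> f; have [i [a ->]] := s1 f.
  by case: (H i) (H' i) => _ + _ _ [_ + _ _] => -> ->.
- move=> f; have [i [a ->]] := s0 f.
  by case: (H i) (H' i) => _ _ + _ [_ _ + _] => <- <-.
- move=> g f h /sc [i [b [a [k [-> -> -> Ck]]]]].
  by case: (H' i) => _ _ _; exact.
Qed.

(** * Uniqueness of the glued double category *)

Section GluedUniqueness.
Variables (K : topologicalRingType).
Variables (V : topologicalRmodType K) (M : topologicalType).
Variable A : set (chart M V).
Hypothesis HA : good_atlas A.
Local Notation dom c := (cdom (\val c)).
Local Notation cod c := (ccod (\val c)).
Local Notation phi c := (cfun (\val c)).
Local Notation psi c := (cinv (\val c)).
Local Notation msrc := (msrc HA).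
Local Notation mtgt := (mtgt HA).
Local Notation mkap := (mkap HA).
Local Notation mp0 := (mp0 HA).
Local Notation mp1 := (mp1 HA).
Local Notation mpar := (mpar HA).
Local Notation midt := (midt HA).

Lemma at1_chart (c : A) a (z : M1 A) : at1 c a z ->
  exists a' : ext1 (cod c), \val a' = a /\ z = chart1 a'.
Proof. by move=> [a' ea ez]; exists a'. Qed.

Lemma at11_chart (c : A) a (z : M11 A) : at11 c a z ->
  exists a' : ext11 (cod c), \val a' = a /\ z = chart11 a'.
Proof. by move=> [a' ea ez]; exists a'. Qed.

Lemma chart1_eq (c : A) (a : ext1 (cod c)) (z : M1 A) :
  at1 c (\val a) z -> chart1 a = z.
Proof. by move=> h; apply: at1_fun h; exact: at1_chart1. Qed.

Lemma chart11_eq (c : A) (a : ext11 (cod c)) (z : M11 A) :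
  at11 c (\val a) z -> chart11 a = z.
Proof. by move=> h; apply: at11_fun h; exact: at11_chart11. Qed.

Lemma at11_src c a w : at11 c a w -> msrc (mp0 w) = psi c a.1.1.
Proof. by move=> aw; rewrite (msrcE HA (at11_at1 HA aw)). Qed.

Lemma at11_tgt c a w : at11 c a w ->
  mtgt (mp0 w) = psi c (a.1.1 + a.1.2 ⋅ a.2.1 ⋅ a.2.2).
Proof. by move=> aw; rewrite (mtgtE HA (at11_at1 HA aw)) /= rscaleA. Qed.

Lemma midt11_at (c : A) x p : cod c x ->
  at11 c ((x, 0), p) (midt11 HA (psi c x, p)).
Proof.
move=> cx; apply: (at11_lift (HA := HA) (z := midt (psi c x, p.1 * p.2))).
- exact: midt_at.
- by rewrite midt11_mp0.
- by rewrite midt11_par.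
Qed.

Lemma gdcat_charts (c : A) : is_dmor (lin_dcat (cod c)) (gdcat HA) (chart_dmap c).
Proof.
have A11 (a : ext11 (cod c)) := at11_chart11 a.
have A1 (a : ext1 (cod c)) := at1_chart1 a.
split; split=> /=.
- by move=> f; rewrite (at11_src (A11 f)) (at11_par HA (A11 f)).
- by move=> f; rewrite (at11_tgt (A11 f)) (at11_par HA (A11 f)).
- by move=> [x p]; apply: chart11_eq; apply: midt11_at; exact: (set_valP x).
- move=> g f h [e1 e2 e3]; rewrite !(at11_par HA (A11 _)) /= e3; split=> //.
  exists c, (p11 (\val f)), (p11 (\val g)); split=> /=.
  + exact: (at11_at1 HA (A11 f)).
  + exact: (at11_at1 HA (A11 g)).
  + by rewrite -rscaleA.
  + by rewrite e2.
  + by have := at11_at1 HA (A11 h); rewrite /= e3.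
- by move=> f; rewrite (msrcE HA (A1 f)) (mkapE HA (A1 f)).
- by move=> f; rewrite (mtgtE HA (A1 f)) (mkapE HA (A1 f)).
- by move=> [x p]; apply: chart1_eq; apply: midt_at; exact: (set_valP x).
- move=> g f h [e1 e2 e3]; exists c, (\val f), (\val g); split=> //.
  by have := A1 h; rewrite /= e3.
- move=> f; apply/esym; apply: chart1_eq; exact: (at11_at1 HA (A11 f)).
- move=> f; apply/esym; apply: chart1_eq; exact: (at11_mp1 HA (A11 f)).
- move=> a; apply: chart11_eq; exact: (mz_at HA (A1 a)).
- move=> g f h /lin_bul1E [e1 e2 e3 e4]; split.
  + apply: (at1_fun (at11_mp1 HA (A11 f))).
    have := at11_at1 HA (A11 g); rewrite /p11 -e3 -e2 -e1.
    by case: (\val g) => [[]].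
  + apply: (at1_fun (at11_at1 HA (A11 h))).
    have := at11_at1 HA (A11 f); rewrite e4 /p11 /=.
    by rewrite e3 mulrA.
  + by rewrite !(at11_par HA (A11 _)) e4.
- by [].
- by [].
- by [].
- by move=> g f h [-> -> [-> ->]].
Qed.

Lemma gdcat_glued : is_glued_dcat (gdcat HA).
Proof. by split; [exact: gdcat_dcat|exact: gdcat_charts]. Qed.

Lemma chart_pt (T : Type) (x : M * T) : exists (c : A) (y : cod c * T),
  x = (psi c (\val y.1), y.2).
Proof.
case: x => p t; have [c [cp _]] := charted2 HA p p.
have Cp : cod c (phi c p) by exact: phi_cod.
by exists c, (to_sub Cp, t); rewrite /= psi_phi.
Qed.

(** Each of the four categories is covered by charts together with its composable pairs. Statements
    about an arbitrary glued structure are thereby reduced to the model [gdcat]. *)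
Lemma glued_uniq (D : mdcatData A) : is_glued_dcat D -> D = gdcat HA.
Proof.
move=> [[h1 h2 h3 h4 _ _ _ _ _ _ _] hc].
have [[g1 g2 g3 g4 _ _ _ _ _ _ _] gc] := gdcat_glued.
have S11 w : exists (c : A) (a : ext11 (cod c)), w = chart11 a.
  have [c [a aw]] := at11_ex w; exists c.
  by have [a' [_ e]] := at11_chart aw; exists a'.
have S1 w : exists (c : A) (a : ext1 (cod c)), w = chart1 a.
  have [c [a aw]] := at1_ex w; exists c.
  by have [a' [_ e]] := at1_chart aw; exists a'.
case: D h1 h2 h3 h4 hc => s1 s0 b1 b0 /= h1 h2 h3 h4 hc.
apply/esym; rewrite /gdcat; congr DcatData.
- apply: (@covered_cat_eq A _ _ (fun c => lin_star1 (cod c)) _ _ _ _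
    (fun c => m11 (chart_dmap c)) (fun c => m01 (chart_dmap c))) => //.
  + by move=> c; case: (gc c).
  + by move=> c; case: (hc c).
  + exact: chart_pt.
  move=> g f h [e1 e2 H].
  have [c [k1 k2 k3 _]] := charted4 HA (msrc (mp0 f)) (mtgt (mp0 f))
    (mtgt (mp0 g)) (msrc (mp0 f)).
  have [a af] := at1_charted k1 k2.
  have [b bg] : exists b, at1 c b (mp0 g).
    by apply: at1_charted; rewrite -?(mcomp_mid HA H).
  have [E1 E2 E3] := mcompE HA H af bg.
  have lift v w : at1 c v (mp0 w) -> exists a' : ext11 (cod c),
      \val a' = (v.1, mpar w) /\ w = chart11 a'.
    move=> vw; apply: at11_chart; apply: (at11_lift (HA := HA) (z := mp0 w)) => //.
    by rewrite /p11 -mp0_kap (mkapE HA vw); case: (v) vw.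
  have [a' [ea' ->]] := lift _ _ af; have [b' [eb' ->]] := lift _ _ bg.
  have [k' [ek' ->]] := lift _ _ E3.
  exists c, b', a', k'; split=> //=; rewrite ?ek' ?ea' ?eb' /= ?e1 ?e2 //.
  by rewrite E1 rscaleA -mp0_kap (mkapE HA af).
- apply: (@covered_cat_eq A _ _ (fun c => lin_star0 (cod c)) _ _ _ _
    (fun c => m10 (chart_dmap c)) (fun c => m00 (chart_dmap c))) => //.
  + by move=> c; case: (gc c).
  + by move=> c; case: (hc c).
  + exact: chart_pt.
  move=> g f h [c [a [b [/at1_chart [a' [ea ->]] /at1_chart [b' [eb ->]] E1 E2]]]].
  move=> /at1_chart [k' [ek ->]].
  by exists c, b', a', k'; split=> //=; split; rewrite /= ?ek ?ea ?eb.
- apply: (@covered_cat_eq A _ _ (fun c => lin_bul1 (cod c)) _ _ _ _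
    (fun c => m11 (chart_dmap c)) (fun c => m10 (chart_dmap c))) => //.
  + by move=> c; case: (gc c).
  + by move=> c; case: (hc c).
  move=> g f h [e1 e2 e3].
  (* Arrows composable by bullet have the same endpoints in [M], so any chart of [f] also sees [g]
     and the composite. *)
  have [c [a af]] := at11_ex f; have mf := at11_mp1 HA af.
  have mg := mf; rewrite e1 in mg.
  have ag : at11 c ((a.1.1, a.1.2 ⋅ a.2.1), mpar g) g.
    apply: (at11_lift (HA := HA) (z := mp0 g)) => //=.
    by rewrite /p11 /= -mp0_kap (mkapE HA mg).
  have E : a.2.2 = (mpar g).1 * (mpar g).2.
    by rewrite -mp0_kap -e1 mp1_kap (at11_par HA af).
  have ch : at11 c (a.1, (a.2.1 * (mpar g).1, (mpar g).2)) h.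
    apply: (at11_lift (HA := HA) (z := mp0 f)); rewrite ?e2 //= ?e3 ?(at11_par HA af) //.
    by rewrite /p11 /= -mulrA -E; exact: (at11_at1 HA af).
  have [a' [ea ->]] := at11_chart af; have [b' [eb ->]] := at11_chart ag.
  have [k' [ek ->]] := at11_chart ch.
  exists c, b', a', k'; split=> //; apply/lin_bul1E.
  by rewrite ea eb ek; split.
- apply: (@covered_cat_eq A _ _ (fun c => lin_bul0 (cod c)) _ _ _ _
    (fun c => m01 (chart_dmap c)) (fun c => m00 (chart_dmap c))) => //.
  + by move=> c; case: (gc c).
  + by move=> c; case: (hc c).
  + exact: chart_pt.
  + exact: chart_pt.
  move=> [x p] [y r] [z u] /= [-> -> [e1 ->]].
  have [c [cx _]] := charted2 HA x x; have Cx := phi_cod HA cx.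
  exists c, (to_sub Cx, p), (to_sub Cx, r), (to_sub Cx, (r.1 * p.1, p.2)).
  by rewrite /= psi_phi.
Qed.

End GluedUniqueness.

(** * Continuity, inverses and unit part of the glued double category *)

Section GluedProperties.
Variables (K : topologicalRingType).
Variables (V : topologicalRmodType K) (M : topologicalType).
Variable A : set (chart M V).
Hypothesis HA : good_atlas A.
Local Notation dom c := (cdom (\val c)).
Local Notation cod c := (ccod (\val c)).
Local Notation phi c := (cfun (\val c)).
Local Notation psi c := (cinv (\val c)).
Local Notation msrc := (msrc HA).
Local Notation mtgt := (mtgt HA).
Local Notation mkap := (mkap HA).
Local Notation mp0 := (mp0 HA).
Local Notation mp1 := (mp1 HA).
Local Notation mpT := (mpT HA).
Local Notation mpar := (mpar HA).
Local Notation midt := (midt HA).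
Local Notation minv := (minv HA).

(** Common criterion for [M1], [M11], the tangent bundle and the fibers: continuity into [C1] is
    detected by the arrow [e] in [M1] and a parameter [r], so composition and inversion inherit
    continuity from [M1]. *)
Lemma continuous_groupoid_of (C1 C0 R : topologicalType) (C : catData C1 C0)
    (e : C1 -> M1 A) (r : C1 -> R) :
  is_cat C -> continuous (src C) -> continuous (tgt C) -> continuous (idt C) ->
  (forall x, {for x, continuous e}) -> (forall x, {for x, continuous r}) ->
  (forall (Y : topologicalType) (f : Y -> C1) y,
    {for y, continuous (fun x => e (f x))} ->
    {for y, continuous (fun x => r (f x))} -> {for y, continuous f}) ->
  (forall g f h, comp C g f h -> mcomp (e g) (e f) (e h) /\ r h = r f) ->
  (forall f, exists g, [/\ is_inverse C f g, e g = minv (e f) & r g = r f]) ->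
  continuous_groupoid C.
Proof.
move=> hC cs ct ci ce cr lift Cm inv.
have [i iP] := choiceP inv.
split.
- by split=> // f; exists (i f); case: (iP f).
- split=> //; set S := [set gf : _ | _].
  have H (gf : S) : exists h, comp C (\val gf).1 (\val gf).2 h.
    by apply/(comp_def hC); exact: (set_valP gf).
  have [m mP] := choiceP H; exists m; split=> // gf.
  have c2 : {for gf, continuous (fun x : S => (\val x).2)}.
    by apply: cts_snd; exact: cts_val.
  have c1 : {for gf, continuous (fun x : S => (\val x).1)}.
    by apply: cts_fst; exact: cts_val.
  have Cm' (x : S) := Cm _ _ _ (mP x).
  apply: lift.
    apply: (@mcomp_cts _ _ _ _ HA _ (fun x : S => e (\val x).2)
      (fun x : S => e (\val x).1)).
    + exact: (cts_comp c2 (ce _)).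
    + exact: (cts_comp c1 (ce _)).
    + by move=> x; case: (Cm' x).
  rewrite (_ : (fun x => r (m x)) = (fun x : S => r (\val x).2)).
    exact: (cts_comp c2 (cr _)).
  by apply/funext => x; case: (Cm' x).
- exists i; split; last by move=> f; case: (iP f).
  move=> f; apply: lift.
    rewrite (_ : (fun x => e (i x)) = (fun x => minv (e x))).
      exact: (cts_comp (ce _) (@minv_cts _ _ _ _ HA _)).
    by apply/funext => x; case: (iP x).
  rewrite (_ : (fun x => r (i x)) = r); first exact: cr.
  by apply/funext => x; case: (iP x).
Qed.

Lemma minv_src z : msrc (minv z) = mtgt z.
Proof.
have [_ H] := minvP HA z; have := mcomp_mid HA H.
by have := mcomp_src HA H; rewrite midt_src.
Qed.

Lemma minv_kap z : mkap (minv z) = mkap z.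
Proof. by have [_ H] := minvP HA z; have [] := mcomp_kap HA H. Qed.

Lemma mstar0_groupoid : continuous_groupoid (mstar0 HA).
Proof.
have cs (z : M1 A) : {for z, continuous (fun z => (msrc z, mkap z))}.
  by apply: cts_pair; [exact: msrc_cts|exact: mkap_cts].
have ct (z : M1 A) : {for z, continuous (fun z => (mtgt z, mkap z))}.
  by apply: cts_pair; [exact: mtgt_cts|exact: mkap_cts].
apply: (@continuous_groupoid_of _ _ K (mstar0 HA) id mkap).
- exact: mstar0_cat.
- by move=> z; exact: cs.
- by move=> z; exact: ct.
- by move=> z; exact: midt_cts.
- by move=> z; exact: cts_id.
- by move=> z; exact: mkap_cts.
- by [].
- by move=> g f h H; split=> //; case: (mcomp_kap HA H).
- move=> f; exists (minv f); split=> //; last exact: minv_kap.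
  exact: minvP.
Qed.

Lemma mp0_comp_cts (Y : topologicalType) (f : Y -> M11 A) y :
  {for y, continuous f} -> {for y, continuous (fun x => mp0 (f x))}.
Proof. by move=> cf; apply: (cts_comp cf); exact: mp0_cts. Qed.

Lemma mpar_comp_cts (Y : topologicalType) (f : Y -> M11 A) y :
  {for y, continuous f} -> {for y, continuous (fun x => mpar (f x))}.
Proof. by move=> cf; apply: (cts_comp cf); exact: mpar_cts. Qed.

Lemma minv11_ex w : exists w', mp0 w' = minv (mp0 w) /\ mpar w' = mpar w.
Proof. by apply: mp0_lift; rewrite minv_kap mp0_kap. Qed.

Lemma midt11_cts x : {for x, continuous (midt11 HA)}.
Proof.
apply: mp0_cts_lift.
  rewrite (_ : (fun x => _) = (fun x => midt (x.1, x.2.1 * x.2.2))).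
    apply: (cts_comp (f := fun x : M * (K * K) => (x.1, x.2.1 * x.2.2))).
      by cts.
    exact: midt_cts.
  by apply/funext => y; rewrite midt11_mp0.
rewrite (_ : (fun x => _) = snd); first by cts.
by apply/funext => y; rewrite midt11_par.
Qed.

Lemma mstar1_groupoid : continuous_groupoid (mstar1 HA).
Proof.
have k0 := mp0_cts (HA := HA); have k1 := mpar_cts (HA := HA).
apply: (@continuous_groupoid_of _ _ (K * K)%type (mstar1 HA) mp0 mpar) => //.
- exact: mstar1_cat.
- move=> z; apply: (cts_pair (f := fun z => msrc (mp0 z))); last exact: k1.
  by apply: (cts_comp (k0 z)); exact: msrc_cts.
- move=> z; apply: (cts_pair (f := fun z => mtgt (mp0 z))); last exact: k1.
  by apply: (cts_comp (k0 z)); exact: mtgt_cts.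
- by move=> x; exact: midt11_cts.
- by move=> Y f y; exact: mp0_cts_lift.
- by move=> g f h [_ -> H].
- move=> f; have [w [w1 w2]] := minv11_ex f; exists w; split=> //.
  have [i1 i2] := minvP HA (mp0 f); split; split=> /=; rewrite ?midt11_par //.
    by rewrite midt11_mp0 w1 /= -mp0_kap.
  by rewrite midt11_mp0 w1 /= -mp0_kap.
Qed.

Lemma mp1_at c v w : at1 c v (mp0 w) ->
  at1 c ((v.1.1, v.1.2 ⋅ (mpar w).1), (mpar w).2) (mp1 w).
Proof.
move=> vw; apply: (@at11_mp1 _ _ _ _ HA _ _ (v.1, mpar w)).
apply: (at11_lift (HA := HA) (z := mp0 w)) => //.
by rewrite /p11 -mp0_kap (mkapE HA vw); case: (v) vw.
Qed.

Lemma mp1_cts w : {for w, continuous mp1}.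
Proof.
have [c [v vw]] := at1_ex (mp0 w).
have c0 := mp0_cts (HA := HA) (w := w); have c1 := mpar_cts (HA := HA) (w := w).
apply: (at1_cts_to HA (c := c) (h := fun w => (((co1 c (mp0 w)).1.1,
  (co1 c (mp0 w)).1.2 ⋅ (mpar w).1), (mpar w).2))).
  have h : {for w, continuous (fun w => co1 c (mp0 w))}.
    by apply: (cts_comp c0); exact: (co1_cts HA vw).
  by cts.
near=> u; apply: mp1_at; near: u; exact: (cts_nbhs c0 (co1_near HA vw)).
Unshelve. all: by end_near. Qed.

Lemma mz_cts z : {for z, continuous (mz HA)}.
Proof.
apply: mp0_cts_lift.
  rewrite (_ : (fun x => _) = id); first exact: cts_id.
  by apply/funext => y; rewrite mz_mp0.
rewrite (_ : (fun x => _) = (fun z => (1, mkap z))).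
  have h := mkap_cts (HA := HA) (z := z); by cts.
by apply/funext => y; rewrite mz_par.
Qed.

Lemma gdcat_continuous : continuous_dcat (gdcat HA).
Proof.
split.
- by case: mstar1_groupoid.
- by case: mstar0_groupoid.
- split=> [x|x|x|].
  + exact: mp0_cts.
  + exact: mp1_cts.
  + exact: mz_cts.
  set S := [set gf : _ | _].
  have H (gf : S) : exists h, comp (mbul1 HA) (\val gf).1 (\val gf).2 h.
    by apply/(comp_def (mbul1_cat HA)); exact: (set_valP gf).
  have [m mP] := choiceP H; exists m; split=> // gf.
  have c2 : {for gf, continuous (fun x : S => (\val x).2)}.
    by apply: cts_snd; exact: cts_val.
  have c1 : {for gf, continuous (fun x : S => (\val x).1)}.
    by apply: cts_fst; exact: cts_val.
  apply: mp0_cts_lift.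
    rewrite (_ : (fun x => _) = (fun x : S => mp0 (\val x).2)).
      exact: mp0_comp_cts.
    by apply/funext => x; case: (mP x).
  rewrite (_ : (fun x => _) = (fun x : S =>
    ((mpar (\val x).2).1 * (mpar (\val x).1).1, (mpar (\val x).1).2))).
    have h2 := mpar_comp_cts c2; have h1 := mpar_comp_cts c1; by cts.
  by apply/funext => x; case: (mP x).
- split=> [x|x|x|].
  + by apply: (cts_pair (f := fst) (g := fun x : M * (K * K) => x.2.1 * x.2.2)); cts.
  + by apply: (cts_pair (f := fst) (g := fun x : M * (K * K) => x.2.2)); cts.
  + by apply: (cts_pair (f := fst) (g := fun x : M * K => (1, x.2))); cts.
  exists (fun gf => ((\val gf).1.1, ((\val gf).2.2.1 * (\val gf).1.2.1, (\val gf).1.2.2))).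
  split.
    move=> gf; apply: (cts_restrict (f := fun gf : (M * (K * K)) * (M * (K * K)) =>
      (gf.1.1, (gf.2.2.1 * gf.1.2.1, gf.1.2.2)))).
    by cts.
  move=> gf; have /= e := set_valP gf; split=> //=.
    exact: (congr1 fst e).
  split=> //; exact: (congr1 snd e).
Qed.

Lemma marrow x y u : units K u ->
  exists! z, [/\ msrc z = x, mtgt z = y & mkap z = u].
Proof.
move=> uu; have [c [cx cy]] := charted2 HA x y.
have Cx := phi_cod HA cx; have Cy := phi_cod HA cy.
have [a [[a1 [a2 a3]] au]] := ext1_arrow (to_sub Cx) (to_sub Cy) uu.
have A1 := at1_chart1 a.
have e1 : (\val a).1.1 = phi c x := congr1 \val a1.
have e2 : (\val a).1.1 + (\val a).1.2 ⋅ (\val a).2 = phi c y := congr1 \val a2.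
exists (chart1 a); split.
  by rewrite (msrcE HA A1) (mtgtE HA A1) (mkapE HA A1) e2 e1 a3 !psi_phi.
move=> z [z1 z2 z3]; have [b bz] : exists b, at1 c b z.
  by apply: at1_charted; rewrite ?z1 ?z2.
have [b' [eb ->]] := at1_chart bz; congr chart1; apply: au; split.
  by apply: val_sub_inj; rewrite /= -[sval b']/(\val b') eb;
    have [_ <-] := at1_src HA bz; rewrite z1.
split; last by rewrite eb -(mkapE HA bz).
by apply: val_sub_inj; rewrite /= -[sval b']/(\val b') eb;
    have [_ <-] := at1_tgt HA bz; rewrite z2.
Qed.

(** In a chart the arrow from [p] to [q] has vector [(phi q - phi p) ⋅ b] with [b] the inverse of
    [u]. The parameter is the same throughout the family, so [b] is a constant and only the
    endpoints vary. *)
Lemma marrow_cts (Y : topologicalType) (f : Y -> M1 A) y u : units K u ->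
  (forall x, mkap (f x) = u) ->
  {for y, continuous (fun x => msrc (f x))} ->
  {for y, continuous (fun x => mtgt (f x))} -> {for y, continuous f}.
Proof.
move=> [b [ub bu]] fu cs ct.
have [c [c1 c2]] := charted2 HA (msrc (f y)) (mtgt (f y)).
have cs' : {for y, continuous (fun x => phi c (msrc (f x)))}.
  by apply: (cts_comp cs); exact: (phi_cts HA).
have ct' : {for y, continuous (fun x => phi c (mtgt (f x)))}.
  by apply: (cts_comp ct); exact: (phi_cts HA).
apply: (at1_cts_to HA (c := c) (h := fun x => ((phi c (msrc (f x)),
   (phi c (mtgt (f x)) - phi c (msrc (f x))) ⋅ b), u))); first by cts.
near=> x.
have d1 : dom c (msrc (f x)).
  by near: x; exact: (cts_open cs (dom_open HA c) c1).
have d2 : dom c (mtgt (f x)).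
  by near: x; exact: (cts_open ct (dom_open HA c) c2).
have [a az] := at1_charted d1 d2.
have [_ ->] := at1_src HA az; have [_ ->] := at1_tgt HA az.
have := mkapE HA az; rewrite fu => <-.
rewrite addrC addKr rscaleA ub rscale1.
by have := mkapE HA az; rewrite fu => ->; case: (a) az => [[]].
Unshelve. all: by end_near. Qed.

Lemma gdcat_unit_part : exists E, [/\ is_unit_part (gdcat HA) E, is_dgroupoid E &
  exists Phi, is_diso E (pairs_dcat K M) Phi /\ is_anchor (gdcat HA) Phi].
Proof.
apply: unit_part_pairs => //.
- exact: gdcat_dcat.
- move=> x y p u1 u2; have [z [[z1 z2 z3] zu]] := marrow x y (unitsM u1 u2).
  have [w [w1 w2]] := mp0_lift z3.
  exists w; split; first by rewrite /= w1 w2 z1 z2.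
  move=> w' [[e1 e2] [e3 e4]]; apply: (mp0_inj (HA := HA)); last by rewrite w2 e2.
  by rewrite w1; apply: zu; split=> //; rewrite mp0_kap e2.
- move=> x y t ut; have [z [[z1 z2 z3] zu]] := marrow x y ut.
  exists z; split; first by rewrite /= z1 z2 z3.
  by move=> w [[e1 e2] [e3 e4]]; apply: zu.
Qed.

Lemma gdcat_field : is_field K ->
  let D := gdcat HA in
  let Z := [set x : M * (K * K) | x.2.1 * x.2.2 = 0] in
  let G := unit_part01 K M in
  [/\ Z `|` G = setT, Z `&` G = set0,
      src (star1 D) @^-1` Z = tgt (star1 D) @^-1` Z,
      src (star1 D) @^-1` G = tgt (star1 D) @^-1` G &
      src (star1 D) @^-1` Z `|` src (star1 D) @^-1` G = setT /\
      src (star1 D) @^-1` Z `&` src (star1 D) @^-1` G = set0].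
Proof.
move=> [_ one_neq0 fu] D Z G.
have ZG : Z `|` G = setT.
  apply/predeqP => -[x [s t]]; split=> // _.
  have [e|s0] := pselect (s = 0); first by left; rewrite /Z /= e mul0r.
  have [e|t0] := pselect (t = 0); first by left; rewrite /Z /= e mulr0.
  by right; split; exact: fu.
have ZG0 : Z `&` G = set0.
  apply/predeqP => -[x [s t]]; split=> // -[/= e [us ut]].
  have [b [eb _]] := unitsM us ut; apply: one_neq0.
  by rewrite -eb /= e mul0r.
split=> //; split.
  by rewrite -preimage_setU ZG preimage_setT.
by rewrite -preimage_setI ZG0 preimage_set0.
Qed.

End GluedProperties.

(** * Tangent bundle and fibers *)

Section Fibers.
Variables (K : topologicalRingType).
Variables (V : topologicalRmodType K) (M : topologicalType).
Variable A : set (chart M V).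
Hypothesis HA : good_atlas A.
Local Notation dom c := (cdom (\val c)).
Local Notation cod c := (ccod (\val c)).
Local Notation phi c := (cfun (\val c)).
Local Notation psi c := (cinv (\val c)).
Local Notation msrc := (msrc HA).
Local Notation mtgt := (mtgt HA).
Local Notation mkap := (mkap HA).
Local Notation mp0 := (mp0 HA).
Local Notation mpT := (mpT HA).
Local Notation mpar := (mpar HA).
Local Notation midt := (midt HA).
Local Notation minv := (minv HA).

Lemma mkap0_tgt z : mkap z = 0 -> mtgt z = msrc z.
Proof.
have [c [a az]] := at1_ex z; rewrite (mkapE HA az) => e.
by rewrite (mtgtE HA az) (msrcE HA az) e rscale0r addr0.
Qed.

Lemma mpT_tgt w : mtgt (mpT w) = msrc (mpT w).
Proof. by apply: mkap0_tgt; exact: mpT_kap. Qed.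

Lemma midtT_ex : exists f : M -> TM A, forall x, mpT (f x) = midt (x, 0).
Proof.
suff H (x : M) : exists w, mpT w = midt (x, 0) by exact: (choiceP H).
by apply: mpT_lift; rewrite midt_kap.
Qed.

Definition midtT := projT1 (cid midtT_ex).
Lemma midtT_mpT x : mpT (midtT x) = midt (x, 0).
Proof. by rewrite /midtT; case: cid. Qed.

Definition mtangent : catData (TM A) M :=
  CatData (fun w => msrc (mpT w)) (fun w => msrc (mpT w)) midtT
    (fun g f h => mcomp (mpT g) (mpT f) (mpT h)).

Lemma mtangent_cat : is_cat mtangent.
Proof.
apply: (functor_inj_cat (D := mstar0 HA) (F1 := mpT) (F0 := fun x => (x, 0))).
- exact: mstar0_cat.
- by move=> f /=; rewrite mpT_kap.
- by move=> f /=; rewrite mpT_kap mpT_tgt.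
- by move=> x /=; rewrite midtT_mpT.
- by [].
- move=> g f h H; have [|k <-] := @mpT_lift _ _ _ _ HA h; last by exists k.
  by have [_ ->] := mcomp_kap HA H; exact: mpT_kap.
- by move=> w w'; exact: mpT_inj.
- by move=> x y [].
Qed.

Lemma mtangent_groupoid : continuous_groupoid mtangent.
Proof.
have kT := mpT_cts (HA := HA).
have ks (w : TM A) : {for w, continuous (fun w => msrc (mpT w))}.
  by apply: (cts_comp (kT w)); exact: msrc_cts.
apply: (@continuous_groupoid_of _ _ _ _ HA _ _ M mtangent mpT (src mtangent)).
- exact: mtangent_cat.
- by move=> w; exact: ks.
- by move=> w; exact: ks.
- move=> x; apply: mpT_cts_lift.
  rewrite (_ : (fun x => _) = (fun x => midt (x, 0))).
    apply: (cts_comp (f := fun x : M => (x, 0 : K))); first by cts.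
    exact: midt_cts.
  by apply/funext => y; rewrite midtT_mpT.
- by move=> x; exact: kT.
- by move=> x; exact: ks.
- by move=> Y f y h _; exact: mpT_cts_lift h.
- by move=> g f h H; split=> //; exact: (mcomp_src HA H).
- move=> f; have [w ww] : exists w, mpT w = minv (mpT f).
    by apply: mpT_lift; rewrite minv_kap mpT_kap.
  have [i1 i2] := minvP HA (mpT f); rewrite /= mpT_kap in i1 i2.
  exists w; split=> //; last by rewrite /= ww minv_src mpT_tgt.
  split=> /=; rewrite ww midtT_mpT //.
  by rewrite -mpT_tgt.
Qed.

Lemma mtangent_bundle : is_tangent_bundle mtangent.
Proof.
split; first exact: mtangent_cat.
move=> c; have H (a : tangent_piece (cod c)) : at1 c (pT (\val a)) (mpT (chartT a)).
  by apply/atTP; exact: atT_chartT.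
have S (a : tangent_piece (cod c)) : msrc (mpT (chartT a)) = psi c (\val a).1.
  by rewrite (msrcE HA (H a)).
split.
- by move=> a /=; rewrite S.
- by move=> a /=; rewrite S.
- move=> x; apply: (mpT_inj (HA := HA)); rewrite midtT_mpT.
  apply: (at1_fun (H _)); apply: midt_at; exact: (set_valP x).
- move=> b a k [/= e1 e2]; exists c, (pT (\val a)), (pT (\val b)); split=> //=.
  + exact: H.
  + exact: H.
  + by rewrite e1 rscale0r addr0.
  + by have := H k; rewrite /pT /= e2.
Qed.

Section OneFiber.
Variables s t : K.

Local Notation Fb := [set a | (src (star1 (gdcat HA)) a).2 = (s, t)].

Lemma fiber_par (a : Fb) : mpar (\val a) = (s, t).
Proof. exact: (set_valP a). Qed.

Lemma fiber_kap (a : Fb) : mkap (mp0 (\val a)) = s * t.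
Proof. by rewrite mp0_kap fiber_par. Qed.

Lemma midt_fiber x : Fb (midt11 HA (x, (s, t))).
Proof. by rewrite /= midt11_par. Qed.

Definition gfiber : catData Fb M :=
  CatData (fun a => msrc (mp0 (\val a))) (fun a => mtgt (mp0 (\val a)))
    (fun x => to_sub (midt_fiber x))
    (fun g f h => mcomp (mp0 (\val g)) (mp0 (\val f)) (mp0 (\val h))).

Lemma fiber_lift z : mkap z = s * t -> exists a : Fb, mp0 (\val a) = z.
Proof.
move=> e; have [w [w1 w2]] := mp0_lift (p := (s, t)) e.
by exists (to_sub (w2 : Fb w)).
Qed.

Lemma fiber_inj (a b : Fb) : mp0 (\val a) = mp0 (\val b) -> a = b.
Proof.
move=> e; apply: val_sub_inj; apply: (mp0_inj e).
by rewrite !fiber_par.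
Qed.

Lemma gfiber_cat : is_cat gfiber.
Proof.
apply: (functor_inj_cat (D := mstar0 HA) (F1 := fun a : Fb => mp0 (\val a))
  (F0 := fun x => (x, s * t))).
- exact: mstar0_cat.
- by move=> f /=; rewrite fiber_kap.
- by move=> f /=; rewrite fiber_kap.
- by move=> x /=; rewrite midt11_mp0.
- by [].
- move=> g f h H; have [|k <-] := @fiber_lift h; last by exists k.
  by have [_ ->] := mcomp_kap HA H; exact: fiber_kap.
- exact: fiber_inj.
- by move=> x y [].
Qed.

Lemma gfiberP : is_fiber (gdcat HA) s t gfiber.
Proof.
split=> //.
- by move=> a; apply: prod_eq => //=; exact: fiber_par.
- by move=> a; apply: prod_eq => //=; exact: fiber_par.
- move=> b a c; split=> [H|[_ _ H]//].
  by split=> //=; rewrite ?fiber_par.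
Qed.

Lemma fiber_cts_lift (Y : topologicalType) (f : Y -> Fb) y :
  {for y, continuous (fun x => mp0 (\val (f x)))} -> {for y, continuous f}.
Proof.
move=> h; apply: cts_sub; apply: mp0_cts_lift => //.
rewrite (_ : (fun x => _) = (fun _ => (s, t))); first exact: cts_cst.
by apply/funext => x; exact: fiber_par.
Qed.

Lemma fiber_mp0_cts (a : Fb) : {for a, continuous (fun a : Fb => mp0 (\val a))}.
Proof. by apply: mp0_comp_cts; exact: cts_val. Qed.

Lemma fiber_src_cts (a : Fb) :
  {for a, continuous (fun a : Fb => msrc (mp0 (\val a)))}.
Proof. by apply: (cts_comp (fiber_mp0_cts (a := a))); exact: msrc_cts. Qed.

Lemma fiber_tgt_cts (a : Fb) :
  {for a, continuous (fun a : Fb => mtgt (mp0 (\val a)))}.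
Proof. by apply: (cts_comp (fiber_mp0_cts (a := a))); exact: mtgt_cts. Qed.

Lemma gfiber_groupoid : continuous_groupoid gfiber.
Proof.
apply: (@continuous_groupoid_of _ _ _ _ HA _ _ K gfiber
  (fun a => mp0 (\val a)) (fun _ => 0)).
- exact: gfiber_cat.
- by move=> a; exact: fiber_src_cts.
- by move=> a; exact: fiber_tgt_cts.
- move=> x; apply: fiber_cts_lift.
  rewrite (_ : (fun x => _) = (fun x => midt (x, s * t))).
    apply: (cts_comp (f := fun x : M => (x, s * t))); first by cts.
    exact: midt_cts.
  by apply/funext => y; rewrite /= midt11_mp0.
- by move=> x; exact: fiber_mp0_cts.
- by move=> x; exact: cts_cst.
- by move=> Y f y h _; exact: fiber_cts_lift h.
- by [].
- move=> f; have [w ww] : exists w : Fb, mp0 (\val w) = minv (mp0 (\val f)).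
    by apply: fiber_lift; rewrite minv_kap fiber_kap.
  have [i1 i2] := minvP HA (mp0 (\val f)); rewrite /= fiber_kap in i1 i2.
  by exists w; split=> //; split=> /=; rewrite midt11_mp0 -[sval w]/(\val w) ww.
Qed.

(** Via [mp0] and [mpT] both spaces are identified with the arrows of [M1] of parameter [0]; the
    isomorphism is the identity of [M1] seen through these two maps. *)
Lemma fiber_tangent : s * t = 0 -> exists h, [/\ homeomorphism h,
  is_functor gfiber mtangent h id &
  forall (z : Fb) (c : A) (a : ext11 (cod c)) (b : tangent_piece (cod c)),
    \val z = chart11 a -> \val b = (\val a).1 -> h z = chartT b].
Proof.
move=> st0.
have H (z : Fb) : exists w, mpT w = mp0 (\val z).
  by apply: mpT_lift; rewrite fiber_kap.
have [h hP] := choiceP H.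
have H' (w : TM A) : exists z : Fb, mp0 (\val z) = mpT w.
  by apply: fiber_lift; rewrite mpT_kap.
have [g gP] := choiceP H'.
exists h; split.
- split.
    move=> z; apply: mpT_cts_lift.
    rewrite (_ : (fun x => _) = (fun z => mp0 (\val z))); first exact: fiber_mp0_cts.
    by apply/funext => x; rewrite hP.
  exists g; split.
  + move=> w; apply: fiber_cts_lift.
    rewrite (_ : (fun x => _) = mpT); first exact: mpT_cts.
    by apply/funext => x; rewrite gP.
  + by move=> z; apply: fiber_inj; rewrite gP hP.
  + by move=> w; apply: (mpT_inj (HA := HA)); rewrite hP gP.
- split=> /=.
  + by move=> f; rewrite hP.
  + by move=> f; rewrite hP mkap0_tgt // fiber_kap.
  + move=> x; apply: (mpT_inj (HA := HA)).
    by rewrite hP midtT_mpT /= midt11_mp0 /= st0.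
  + by move=> x y z; rewrite !hP.
- move=> z c a b ez eb; apply: (mpT_inj (HA := HA)); rewrite hP ez.
  have A11 := at11_chart11 a.
  have := at11_at1 HA A11; have := fiber_kap z; rewrite ez mp0_kap (at11_par HA A11).
  rewrite st0 => e; rewrite /p11 e => h1; apply: (at1_fun h1).
  by rewrite -eb -/(pT _); apply/atTP; exact: atT_chartT.
Qed.

(** The homeomorphism sends an arrow to its endpoints. Its inverse exists by [marrow] and is
    continuous by [marrow_cts]. *)
Lemma fiber_pairs : units K (s * t) ->
  exists h, homeomorphism h /\ is_functor gfiber (pair_groupoid M) h id.
Proof.
move=> ust; exists (fun a => (mtgt (mp0 (\val a)), msrc (mp0 (\val a)))); split.
  have H (p : M * M) : exists a : Fb, msrc (mp0 (\val a)) = p.2 /\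
      mtgt (mp0 (\val a)) = p.1.
    have [z [[z1 z2 z3] _]] := marrow HA p.2 p.1 ust.
    by have [a ea] := fiber_lift z3; exists a; rewrite ea.
  have [g gP] := choiceP H; split.
    by move=> a; exact: (cts_pair (fiber_tgt_cts (a := a)) (fiber_src_cts (a := a))).
  exists g; split.
  - move=> p; apply: fiber_cts_lift; apply: (marrow_cts (HA := HA) ust).
    + by move=> x; exact: fiber_kap.
    + rewrite (_ : (fun x => _) = snd); first by cts.
      by apply/funext => x; case: (gP x).
    + rewrite (_ : (fun x => _) = fst); first by cts.
      by apply/funext => x; case: (gP x).
  - move=> a; apply: fiber_inj.
    set x := msrc _; set y := mtgt _.
    have [z [_ zu]] := marrow HA x y ust.
    have [g1 g2] := gP (y, x).
    rewrite -(zu (mp0 (\val (g (y, x))))); last by split=> //; exact: fiber_kap.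
    by apply: zu; split=> //; exact: fiber_kap.
  - by move=> [y x]; have [-> ->] := gP (y, x).
split=> //=.
- by move=> x; rewrite midt11_mp0 midt_src midt_tgt.
- move=> b a c H; rewrite (mcomp_mid HA H); split=> //.
  by rewrite (mcomp_src HA H) (mcomp_tgt HA H).
Qed.

End OneFiber.

Lemma gdcat_tangent : exists T : catData (TM A) M,
  [/\ is_tangent_bundle T, continuous_groupoid T &
    forall s t : K, exists E,
      [/\ is_fiber (gdcat HA) s t E,
          continuous_groupoid E,
          s * t = 0 -> exists h, [/\ homeomorphism h,
            is_functor E T h id &
            forall z (c : A) (a : ext11 (ccod (\val c)))
              (b : tangent_piece (ccod (\val c))),
              \val z = chart11 a -> \val b = (\val a).1 -> h z = chartT b] &
          units K (s * t) -> exists h, homeomorphism h /\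
            is_functor E (pair_groupoid M) h id]].
Proof.
exists mtangent; split.
- exact: mtangent_bundle.
- exact: mtangent_groupoid.
move=> s t; exists (gfiber s t); split.
- exact: gfiberP.
- exact: gfiber_groupoid.
- exact: fiber_tangent.
- exact: fiber_pairs.
Qed.

End Fibers.

(** * Charts over a topological division ring *)

Section Separation.
Variable T : topologicalType.
Hypothesis hT : hausdorff_space T.

Lemma hausdorff_sep (x y : T) : x <> y -> exists O O' : set T,
  [/\ open O, open O', O x, O' y & forall z, O z -> O' z -> False].
Proof.
move=> xy; have := hT; rewrite open_hausdorff => /(_ x y).
have -> : (x != y) = true by apply/eqP.
move=> /(_ erefl) [[O O'] /= [/set_mem Ox /set_mem O'y] [oO oO' /eqP e]].
exists O, O'; split=> // z Oz O'z.
by have : (O `&` O') z by []; rewrite e.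
Qed.

Lemma hausdorff_sep_seq (s : seq T) (y : T) : y \notin s -> exists O O' : set T,
  [/\ open O, open O', {in s, forall x, O x}, O' y &
      forall z, O z -> O' z -> False].
Proof.
elim: s => [_|x s IH].
  by exists set0, setT; split; rewrite //; [exact: open0|exact: openT].
rewrite inE negb_or => /andP [/eqP yx /IH [O [O' [oO oO' Os O'y d]]]].
have [|Q [Q' [oQ oQ' Qx Q'y d']]] := @hausdorff_sep x y; first by move=> e; apply: yx.
exists (O `|` Q), (O' `&` Q'); split=> //.
- exact: openU.
- exact: openI.
- by move=> z; rewrite inE => /orP [/eqP ->|/Os]; [right|left].
- by move=> z [Oz|Qz] [O'z Q'z]; [exact: d Oz O'z|exact: d' Qz Q'z].
Qed.

Lemma hausdorff_neq_near (x y : T) : x <> y -> \forall z \near x, z <> y.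
Proof.
move=> /hausdorff_sep [O [O' [oO oO' Ox O'y d]]].
apply: filterS (near_open oO Ox) => z Oz e; apply: (d y) => //.
by rewrite -e.
Qed.

End Separation.

Section DivisionRing.
Variable K : topologicalRingType.
Hypothesis dK : dense (units K).
Variables (inv : K -> K).
Hypothesis invr : forall a, a <> 0 -> a * inv a = 1.
Hypothesis invl : forall a, a <> 0 -> inv a * a = 1.
Hypothesis invc : {within units K, continuous inv}.
Variable V : topologicalRmodType K.
Hypothesis hV : hausdorff_space V.
Variable v0 : V.
Hypothesis v0_neq0 : v0 <> 0.

Lemma neq0_unit (a : K) : a <> 0 -> units K a.
Proof. by move=> a0; exists (inv a); rewrite invr ?invl. Qed.

(** The nonzero vector [v0] excludes the zero ring: if [0] were a unit, it could be cancelled from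
    [v0 ⋅ 0 = 0 ⋅ 0]. *)
Lemma unit_neq0 (a : K) : units K a -> a <> 0.
Proof.
by move=> ua a0; apply: v0_neq0; apply: (rscaleI ua); rewrite a0 !rscale0r.
Qed.

Lemma unitsE : units K = [set a : K | a <> 0].
Proof. by apply/predeqP => a; split; [exact: unit_neq0|exact: neq0_unit]. Qed.

(** Separation is available in [V], so the claim is pulled back along [b |-> v0 ⋅ b], which is
    continuous and vanishes at [0], but not at [a]. *)
Lemma neq0_open : open [set a : K | a <> 0].
Proof.
rewrite openE => a a0; rewrite /interior.
have va : v0 ⋅ a <> 0.
  move=> e; apply: v0_neq0; apply: (rscaleI (neq0_unit a0)).
  by rewrite e rscale0l.
have c : {for a, continuous (fun b : K => v0 ⋅ b)} by cts.
apply: filterS (cts_nbhs c (hausdorff_neq_near hV va)) => b h b0.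
by apply: h; rewrite b0 rscale0r.
Qed.

Lemma inv_cts a : a <> 0 -> {for a, continuous inv}.
Proof.
move=> a0; apply: (within_cts neq0_open) => //.
by rewrite -unitsE.
Qed.

(** In a finite Hausdorff [V] the point [0] would be isolated, yet the nonzero vectors [v0 ⋅ u] come
    arbitrarily close to it when the unit [u] is close to [0]. *)
Lemma module_infinite (s : seq V) : exists y, y \notin s.
Proof.
apply: contrapT => H.
have Hs y : y \in s by apply: contrapT => n; apply: H; exists y; apply/negP.
have [|O [O' [oO oO' Os O0 d]]] := @hausdorff_sep_seq _ hV [seq y <- s | y != 0] 0.
  by rewrite mem_filter eqxx.
have c : {for 0, continuous (fun b : K => v0 ⋅ b)} by cts.
have := cts_open c oO'; rewrite rscale0r => /(_ O0).
rewrite /prop_near1 nbhsE => -[B [oB B0] Bs].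
have [u [Bu uu]] := dK (ex_intro _ (0 : K) B0) oB.
have vu : v0 ⋅ u <> 0.
  move=> e; apply: v0_neq0; apply: (rscaleI uu); by rewrite e rscale0l.
apply: (d (v0 ⋅ u)); last exact: Bs Bu.
by apply: Os; rewrite mem_filter Hs andbT; apply/eqP.
Qed.

(* Over a topological division ring C^1 is a local property, as the quotient
   (f(x + vt) - f(x)) t^-1 is continuous where t <> 0. *)
Lemma fact_local (U : set V) (f : V -> V) : open U ->
  (forall x, U x -> exists (U' : set V) g,
    [/\ open U', U' x & is_fact (U `&` U') f g]) ->
  exists g, is_fact U f g.
Proof.
move=> oU H.
have H' (x : V) : exists Ug : set V * (V * V * K -> V), U x ->
    [/\ open Ug.1, Ug.1 `<=` U, Ug.1 x & is_fact Ug.1 f Ug.2].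
  have [Ux|n] := pselect (U x); last by exists (set0, fun _ => 0).
  have [U' [g [k1 k2 k3]]] := H _ Ux; exists (U `&` U', g) => _.
  by split=> //; [exact: openI|move=> ? []].
have [Ug UgP] := choiceP H'.
pose quot (a : V * V * K) := (f (a.1.1 + a.1.2 ⋅ a.2) - f a.1.1) ⋅ inv a.2.
(* For [t = 0] both endpoints are [x], so a factorizer on a neighbourhood of [x] covers the triple;
   otherwise the quotient is used. *)
exists (fun a => if pselect (a.2 = 0) is left _ then (Ug a.1.1).2 a else quot a).
have cf x : U x -> {for x, continuous f}.
  by move=> /UgP [h1 h2 h3 h4]; exact: (fact_cts h1 h4).
split=> a Ua.
  case: pselect => [a0|a0]; last first.
    by rewrite /quot rscaleA invl // rscale1.
  by rewrite a0 !rscale0r addr0 subrr.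
have [a0|a0] := pselect (a.2 = 0); last first.
  apply: (cts_near (f := quot)).
    have c1 : {for a, continuous (fun a : V * V * K => f a.1.1)}.
      apply: (cts_comp (f := fun a : V * V * K => a.1.1)); first by cts.
      by apply: cf; case: Ua.
    have c2 : {for a, continuous (fun a : V * V * K => f (a.1.1 + a.1.2 ⋅ a.2))}.
      apply: (cts_comp (f := fun a : V * V * K => a.1.1 + a.1.2 ⋅ a.2)).
        by cts.
      by apply: cf; case: Ua.
    have c3 : {for a, continuous (fun a : V * V * K => inv a.2)}.
      by apply: (cts_comp (f := snd)); [cts|exact: inv_cts].
    by rewrite /quot; cts.
  near=> b; have b0 : b.2 <> 0.
    by near: b; apply: (cts_open (f := snd) _ neq0_open) => //; cts.
  by case: pselect.
have Ux : U a.1.1 by case: Ua.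
have [h1 h2 h3 h4] := UgP _ Ux.
have Ea : ext1 (Ug a.1.1).1 a by split; rewrite // a0 rscale0r addr0.
apply: (cts_near (f := (Ug a.1.1).2)); first by case: h4 => _; exact.
near=> b; have Eb : ext1 (Ug a.1.1).1 b.
  by near: b; exact: (near_open (ext1_open h1) Ea).
(* Near a triple with [t = 0], the local factorizer chosen there accounts for both branches: for the
   quotient by cancellation, for [t = 0] by uniqueness. *)
case: pselect => [b0|b0]; last first.
  by rewrite /quot h4.1 // rscaleA invr // rscale1.
have [Ub _] := Eb; have [k1 k2 k3 k4] := UgP _ (h2 _ Ub).
apply: (fact_uniq dK hV h1 k1 h4 k4) => //.
by split; rewrite // b0 rscale0r addr0.
Unshelve. all: by end_near. Qed.

Lemma fact_shift_cod (U : set V) (f : V -> V) g w : is_fact U f g ->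
  is_fact U (fun x => f x + w) g.
Proof.
move=> [h1 h2]; split=> // a Ua; rewrite -h1 //.
by rewrite opprD addrACA subrr addr0.
Qed.

Lemma fact_shift_dom (U : set V) (f : V -> V) g w : is_fact U f g ->
  is_fact [set x | U (x - w)] (fun x => f (x - w))
    (fun a => g ((a.1.1 - w, a.1.2), a.2)).
Proof.
move=> [h1 h2]; have E (a : V * V * K) : ext1 [set x | U (x - w)] a ->
    ext1 U ((a.1.1 - w, a.1.2), a.2).
  by move=> [a1 a2]; split=> //=; rewrite addrAC.
split=> a Ea; have Ua := E _ Ea; first by rewrite -h1 //= addrAC.
apply: (cts_comp (f := fun a : V * V * K => ((a.1.1 - w, a.1.2), a.2))).
  by cts.
exact: h2.
Qed.

Variables (M : topologicalType) (A : set (chart M V)).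
Hypothesis hA : is_manifold A.

Section Join.
Variables (c d : chart M V) (O O' : set M) (Q Q' : set V) (w : V).
Hypotheses (Ac : A c) (Ad : A d).
Hypotheses (oO : open O) (oO' : open O') (oQ : open Q) (oQ' : open Q').
Hypothesis dO : forall p, O p -> O' p -> False.
Hypothesis dQ : forall x, Q x -> Q' x -> False.

Let D1 : set M := [set p | cdom c p /\ (O p /\ Q (cfun c p))].
Let D2 : set M := [set p | cdom d p /\ (O' p /\ Q' (cfun d p + w))].
Let E1 : set V := [set x | ccod c x /\ (O (cinv c x) /\ Q x)].
Let E2 : set V := [set x | ccod d (x - w) /\ (O' (cinv d (x - w)) /\ Q' x)].

(* The disjoint union of a restriction of [c] and a translate of a restriction
   of [d]. *)
Definition join_chart : chart M V :=
  Chart (D1 `|` D2) (E1 `|` E2)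
    (fun p => if pselect (D1 p) then cfun c p else cfun d p + w)
    (fun x => if pselect (E1 x) then cinv c x else cinv d (x - w)).

Let hc : is_chart c := atlas_chart hA Ac.
Let hd : is_chart d := atlas_chart hA Ad.

Let cfun1 p : D1 p -> cfun join_chart p = cfun c p.
Proof. by rewrite /=; case: pselect. Qed.

Let cfun2 p : D2 p -> cfun join_chart p = cfun d p + w.
Proof.
rewrite /=; case: pselect => //= -[_ [Op _]] [_ [O'p _]].
by case: (dO Op O'p).
Qed.

Let cinv1 x : E1 x -> cinv join_chart x = cinv c x.
Proof. by rewrite /=; case: pselect. Qed.

Let cinv2 x : E2 x -> cinv join_chart x = cinv d (x - w).
Proof.
rewrite /=; case: pselect => //= -[_ [_ Qx]] [_ [_ Q'x]].
by case: (dQ Qx Q'x).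
Qed.

Let D1E1 p : D1 p -> E1 (cfun c p).
Proof. by move=> [h1 [h2 h3]]; split; rewrite ?(cfunK hc) //; exact: (cfun_cod hc). Qed.

Let D2E2 p : D2 p -> E2 (cfun d p + w).
Proof.
by move=> [h1 [h2 h3]]; split; rewrite addrK ?(cfunK hd) //; exact: (cfun_cod hd).
Qed.

Let E1D1 x : E1 x -> D1 (cinv c x).
Proof. by move=> [h1 [h2 h3]]; split; rewrite ?(cinvK hc) //; exact: (cinv_dom hc). Qed.

Let E2D2 x : E2 x -> D2 (cinv d (x - w)).
Proof.
move=> [h1 [h2 h3]]; split; rewrite ?(cinvK hd) ?subrK //.
exact: (cinv_dom hd).
Qed.

Let oD1 : open D1.
Proof.
rewrite openE => p [h1 [h2 h3]]; rewrite /interior.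
near=> q; split; first by near: q; apply: near_open => //; exact: (cdom_open hc).
split; first by near: q; exact: near_open.
by near: q; exact: (cts_open (cfun_cts hc h1)).
Unshelve. all: by end_near. Qed.

Let oD2 : open D2.
Proof.
rewrite openE => p [h1 [h2 h3]]; rewrite /interior.
have h4 := cfun_cts hd h1.
have h5 : {for p, continuous (fun p => cfun d p + w)} by cts.
near=> q; split; first by near: q; apply: near_open => //; exact: (cdom_open hd).
split; first by near: q; exact: near_open.
by near: q; exact: (cts_open h5).
Unshelve. all: by end_near. Qed.

Let oE1 : open E1.
Proof.
rewrite openE => p [h1 [h2 h3]]; rewrite /interior.
near=> q; split; first by near: q; apply: near_open => //; exact: (ccod_open hc).
split; first by near: q; exact: (cts_open (cinv_cts hc h1)).
by near: q; exact: near_open.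
Unshelve. all: by end_near. Qed.

Let cinvw_cts x : ccod d (x - w) -> {for x, continuous (fun x => cinv d (x - w))}.
Proof.
move=> h; apply: (cts_comp (f := fun x => x - w)); first by cts.
exact: cinv_cts.
Qed.

Let oE2 : open E2.
Proof.
rewrite openE => p [h1 [h2 h3]]; rewrite /interior.
have h4 : {for p, continuous (fun x => x - w)} by cts.
near=> q; split; first by near: q; exact: (cts_open h4 (ccod_open hd)).
split; first by near: q; exact: (cts_open (cinvw_cts h1)).
by near: q; exact: near_open.
Unshelve. all: by end_near. Qed.

Lemma join_is_chart : D1 !=set0 -> is_chart join_chart.
Proof.
move=> [p0 D1p0]; split.
- by exists p0; left.
- exact: openU.
- exact: openU.
- move=> p [Dp|Dp]; first by left; rewrite cfun1 //; exact: D1E1.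
  by right; rewrite cfun2 //; exact: D2E2.
- move=> x [Ex|Ex]; first by left; rewrite cinv1 //; exact: E1D1.
  by right; rewrite cinv2 //; exact: E2D2.
- move=> p [Dp|Dp].
    by rewrite (cfun1 Dp) (cinv1 (D1E1 Dp)) (cfunK hc) //; case: Dp.
  by rewrite (cfun2 Dp) (cinv2 (D2E2 Dp)) addrK (cfunK hd) //; case: Dp.
- move=> x [Ex|Ex].
    by rewrite (cinv1 Ex) (cfun1 (E1D1 Ex)) (cinvK hc) //; case: Ex.
  by rewrite (cinv2 Ex) (cfun2 (E2D2 Ex)) (cinvK hd) ?subrK //; case: Ex.
- rewrite continuous_open_subspace; last exact: openU.
  move=> p /set_mem [Dp|Dp].
    apply: (@cts_near _ _ (cfun c)); first by apply: cfun_cts => //; case: Dp.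
    by near=> q; rewrite cfun1 //; near: q; exact: near_open.
  have h := cfun_cts hd (proj1 Dp).
  apply: (@cts_near _ _ (fun p => cfun d p + w)); first by cts.
  by near=> q; rewrite cfun2 //; near: q; exact: near_open.
- rewrite continuous_open_subspace; last exact: openU.
  move=> x /set_mem [Ex|Ex].
    apply: (@cts_near _ _ (cinv c)); first by apply: cinv_cts => //; case: Ex.
    by near=> q; rewrite cinv1 //; near: q; exact: near_open.
  apply: (@cts_near _ _ (fun x => cinv d (x - w))).
    by apply: cinvw_cts; case: Ex.
  by near=> q; rewrite cinv2 //; near: q; exact: near_open.
Unshelve. all: by end_near. Qed.

(** Around each point the transition maps are those of [c], or those of [d] up to a translation.
    Since C^1 is local here, these pieces combine. *)
Lemma join_compatible b : D1 !=set0 -> A b -> compatible join_chart b.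
Proof.
move=> D1n Ab; have hb := atlas_chart hA Ab; have hj := join_is_chart D1n.
apply/compatible_fact => //.
have /compatible_fact [//|//|[g1 G1] [g2 G2]] := atlas_compatible hA Ac Ab.
have /compatible_fact [//|//|[g3 G3] [g4 G4]] := atlas_compatible hA Ad Ab.
split.
  apply: fact_local; first exact: trans_dom_open.
  move=> x [[Ex|Ex] bx].
    exists E1, g1; split=> //; apply: (@fact_eq _ _ _ _ (tau c b)).
      by move=> y [_ Ey]; rewrite /tau cinv1.
    apply: fact_restrict G1 => y [[_ by_] Ey]; rewrite cinv1 // in by_.
    by split=> //; case: Ey.
  exists E2; eexists; split; [by []|by []|].
  apply: (@fact_eq _ _ _ _ (fun x => tau d b (x - w))).
    by move=> y [_ Ey]; rewrite /tau cinv2.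
  apply: fact_restrict (fact_shift_dom w G3) => y [[_ by_] Ey].
  by rewrite cinv2 // in by_; split=> //; case: Ey.
apply: fact_local; first exact: trans_dom_open.
move=> x [bx [Dx|Dx]].
  exists [set x | ccod b x /\ D1 (cinv b x)], g2; split=> //.
    exact: preim_chart_open.
  apply: (@fact_eq _ _ _ _ (tau b c)).
    by move=> y [_ [_ Dy]]; rewrite /tau cfun1.
  by apply: fact_restrict G2 => y [_ [by_ [Dy _]]]; split.
exists [set x | ccod b x /\ D2 (cinv b x)], g4; split=> //.
  exact: preim_chart_open.
apply: (@fact_eq _ _ _ _ (fun x => tau b d x + w)).
  by move=> y [_ [_ Dy]]; rewrite /tau cfun2.
apply: fact_restrict (fact_shift_cod w G4) => y [_ [by_ [Dy _]]].
by split.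
Qed.

End Join.

(** Induction on the points: a chart around one more point [q] is obtained by joining a translated
    chart at [q] to the chart already found, and maximality puts the result into the atlas. The
    point [p0] is carried along so that domains stay nonempty. *)
Lemma division_ring_charted : finitely_charted A.
Proof.
move=> S /finite_seqP [s ->] [p0 p0s].
suff [c Ac H] : exists2 c, A c & {in p0 :: s, forall p, cdom c p}.
  by exists c => // p ps; apply: H; rewrite inE; apply/orP; right.
elim: s {p0s} => [|q s [c Ac H]].
  have [c Ac cp] := atlas_cover hA p0; exists c => // p.
  by rewrite inE => /eqP ->.
have [cq|ncq] := pselect (cdom c q).
  exists c => // p; rewrite !inE orbCA => /orP [/eqP -> //|h].
  by apply: H; rewrite inE.
have qs : q \notin p0 :: s by apply/negP => /H.
have [O [O' [oO oO' Os O'q dO]]] := hausdorff_sep_seq (manifold_hausdorff hA) qs.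
have [d Ad dq] := atlas_cover hA q.
(* A point off the images of the points already charted is needed, to have somewhere to put the
   image of [q]. *)
have [y ys] := module_infinite [seq cfun c p | p <- p0 :: s].
have [Q [Q' [oQ oQ' Qs Q'y dQ]]] := hausdorff_sep_seq hV ys.
(* The translation by [w] moves the image of [q] to [y]. The sets [O], [O'] separate the domains of
   the two pieces, and [Q], [Q'] separate their images. *)
pose w := y - cfun d q; pose e := join_chart c d O O' Q Q' w.
have D1 p : p \in p0 :: s -> cdom c p /\ (O p /\ Q (cfun c p)).
  move=> ps; split; first exact: H.
  by split; [exact: Os|apply: Qs; exact: map_f].
have D1n : [set p | cdom c p /\ (O p /\ Q (cfun c p))] !=set0.
  by exists p0; apply: D1; rewrite inE eqxx.
exists e.
  apply: (atlas_maximal hA); first exact: join_is_chart.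
  by move=> b Ab; exact: join_compatible.
move=> p; rewrite !inE orbCA => /orP [/eqP ->|h]; last by left; apply: D1; rewrite inE.
by right; split=> //; split=> //; rewrite /w addrC subrK.
Qed.

End DivisionRing.

(** * Morphisms and C^1-maps *)

Section LocalMaps.
Variables (K : topologicalRingType).
Variables (V W : topologicalRmodType K) (M N : topologicalType).

(* [local_map] as a total function. *)
Definition lam (f : M -> N) (c : chart M V) (d : chart N W) (x : V) : W :=
  cfun d (f (cinv c x)).

Lemma local_dom_open f (c : chart M V) (d : chart N W) : is_chart c -> is_chart d ->
  continuous f -> open (local_dom f c d).
Proof.
move=> hc hd cf; apply: (preim_chart_open (O := f @^-1` cdom d) hc).
by apply: open_comp; [move=> p _; exact: cf|exact: cdom_open hd].
Qed.

(** For each pair of points it suffices to have intermediate charts around them in which [f] is C^1: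
    transition maps and the chain rule carry this to [c] and [d], and [fact_two_local] assembles the
    factorizers. *)
Lemma lam_two_local f (c : chart M V) (d : chart N W) :
  dense (units K) -> hausdorff_space W ->
  is_chart c -> is_chart d -> continuous f ->
  (forall p q, exists (c0 : chart M V) (d0 : chart N W),
    [/\ is_chart c0, is_chart d0, cdom c0 p /\ cdom c0 q,
        cdom d0 (f p) /\ cdom d0 (f q) &
        [/\ exists g, is_fact (trans_dom c c0) (tau c c0) g,
            exists g, is_fact (local_dom f c0 d0) (lam f c0 d0) g &
            exists g, is_fact (trans_dom d0 d) (tau d0 d) g]]) ->
  exists g, is_fact (local_dom f c d) (lam f c d) g.
Proof.
move=> dK hW hc hd cf H.
have oU := local_dom_open hc hd cf.
apply: (fact_two_local dK hW oU) => x y [cx dx] [cy dy].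
have [c0 [d0 [hc0 hd0 [px qx] [py qy] [[g1 G1] [g2 G2] [g3 G3]]]]] :=
  H (cinv c x) (cinv c y).
pose U' := [set x | ccod c x /\ (cdom c0 `&` f @^-1` cdom d0) (cinv c x)].
have oU' : open U'.
  apply: (preim_chart_open hc); apply: openI; first exact: (cdom_open hc0).
  by apply: open_comp; [move=> p _; exact: cf|exact: (cdom_open hd0)].
have s1 z : (local_dom f c d `&` U') z -> trans_dom c c0 z by move=> [_ [? [? _]]].
have e1 z : (local_dom f c d `&` U') z -> cinv c0 (tau c c0 z) = cinv c z.
  by move=> [_ [_ [h _]]]; rewrite /tau (cfunK hc0).
have s2 z : (local_dom f c d `&` U') z -> local_dom f c0 d0 (tau c c0 z).
  move=> Uz; case: (Uz) => _ [cz [h h']]; split; first exact: (cfun_cod hc0).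
  by rewrite e1.
have e2 z : (local_dom f c d `&` U') z ->
    cinv d0 (lam f c0 d0 (tau c c0 z)) = f (cinv c z).
  move=> Uz; rewrite /lam (cfunK hd0) e1 //.
  by case: Uz => _ [_ [_ h]].
have s3 z : (local_dom f c d `&` U') z -> trans_dom d0 d (lam f c0 d0 (tau c c0 z)).
  move=> Uz; split; last by rewrite e2 //; case: Uz => -[].
  by apply: (cfun_cod hd0); rewrite e1 //; case: Uz => _ [_ [_ h]].
have oUU : open (local_dom f c d `&` U') by exact: openI.
exists U'; eexists; split; [exact: oU'|by []|by []|].
apply: (@fact_eq _ _ _ _ (fun z => tau d0 d (lam f c0 d0 (tau c c0 z)))).
  by move=> z Uz; rewrite {1}/tau e2.
apply: (fact_comp (f := fun z => lam f c0 d0 (tau c c0 z)) oUU s3 _ G3).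
exact: (fact_comp oUU s2 (fact_restrict s1 G1) G2).
Qed.

End LocalMaps.

Section ManifoldMorphisms.
Variables (K : topologicalRingType).
Variables (V W : topologicalRmodType K) (M N : topologicalType).
Variables (A : set (chart M V)) (B : set (chart N W)).
Hypotheses (HA : good_atlas A) (HB : good_atlas B).
Local Notation dom c := (cdom (\val c)).
Local Notation cod c := (ccod (\val c)).
Local Notation phi c := (cfun (\val c)).
Local Notation psi c := (cinv (\val c)).
Let dK := good_dense HA.
Let hW := good_hausdorff HB.

Lemma C1_manifold_fact (f : M -> N) : continuous f ->
  C1_manifold A B f <-> forall (c : A) (d : B),
    exists g, is_fact (local_dom f (\val c) (\val d)) (lam f (\val c) (\val d)) g.
Proof.
move=> cf; have P (c : A) (d : B) := C1_fact (F := lam f (\val c) (\val d))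
  (local_dom_open (chartP HA c) (chartP HB d) cf) (fun _ => erefl).
split=> [[_ H] c d|H]; first by apply/P; apply: H; exact: set_valP.
split=> // c d Ac Bd; have := H (to_sub Ac) (to_sub Bd).
by move/P.
Qed.

Section FromMap.
Variable f : M -> N.
Hypothesis hf : C1_manifold A B f.
Let cf : continuous f. Proof. by case: hf. Qed.
Local Notation loc c d := (local_dom f (\val c) (\val d)).
Local Notation lm c d := (lam f (\val c) (\val d)).

Lemma loc_open (c : A) (d : B) : open (loc c d).
Proof. exact: (local_dom_open (chartP HA c) (chartP HB d) cf). Qed.

Lemma lfactor_ex : exists G : A -> B -> V * V * K -> W,
  forall c d, is_fact (loc c d) (lm c d) (G c d).
Proof.
have H (cd : A * B) : exists g, is_fact (loc cd.1 cd.2) (lm cd.1 cd.2) g.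
  by have /C1_manifold_fact := hf; apply.
by have [G GP] := choiceP H; exists (fun c d => G (c, d)) => c d; exact: (GP (c, d)).
Qed.

Definition lfactor := projT1 (cid lfactor_ex).
Lemma lfactorP c d : is_fact (loc c d) (lm c d) (lfactor c d).
Proof. by rewrite /lfactor; case: cid. Qed.

Definition lmap1 (c : A) (d : B) (a : V * V * K) : W * W * K :=
  ((lm c d a.1.1, lfactor c d a), a.2).

Lemma lmap1_end c d a : ext1 (loc c d) a ->
  (lmap1 c d a).1.1 + (lmap1 c d a).1.2 ⋅ (lmap1 c d a).2 =
    lm c d (a.1.1 + a.1.2 ⋅ a.2).
Proof. by move=> Da; rewrite /= -(lfactorP c d).1 // addrC subrK. Qed.

Lemma lm_psi (c : A) (d : B) x : loc c d x ->
  cod d (lm c d x) /\ psi d (lm c d x) = f (psi c x).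
Proof.
by move=> [_ h]; rewrite /lam psi_phi //; split=> //; exact: phi_cod.
Qed.

Lemma lmap1_cod c d a : ext1 (loc c d) a -> ext1 (cod d) (lmap1 c d a).
Proof.
move=> Da; case: (Da) => /lm_psi [h1 _] /lm_psi [h2 _].
by split=> //; rewrite lmap1_end.
Qed.

(** Independence of the charts on both sides: the two ways around the square are chain-rule
    factorizers of the same map on the common domain [U], so they agree. *)
Lemma lmap1_trans (c c' : A) (d d' : B) a :
  ext1 (loc c d) a -> dom1 c c' a -> ext1 (loc c' d') (tr1 HA c c' a) ->
  dom1 d d' (lmap1 c d a) /\
  tr1 HB d d' (lmap1 c d a) = lmap1 c' d' (tr1 HA c c' a).
Proof.
move=> Da Dc Dd; pose O := dom c `&` dom c' `&` (f @^-1` (dom d `&` dom d')).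
pose U := [set x | cod c x /\ O (psi c x)].
have oU : open U.
  apply: (preim_chart_open (chartP HA c)); apply: openI.
    by apply: openI; exact: dom_open.
  apply: open_comp; first by move=> p _; exact: cf.
  by apply: openI; exact: dom_open.
have s1 : U `<=` loc c d by move=> x [cx [_ []]].
have s2 : U `<=` trans_dom (\val c) (\val c') by move=> x [cx [[]]].
have e1 x : U x -> psi c' (tau (\val c) (\val c') x) = psi c x.
  by move=> /s2 /(tr_inv HA) [].
have s3 x : U x -> loc c' d' (tau (\val c) (\val c') x).
  move=> Ux; have e := e1 _ Ux; case: Ux => cx [[dx dx'] [fx fx']].
  by split; [exact: phi_cod|rewrite e].
have s4 x : U x -> trans_dom (\val d) (\val d') (lm c d x).
  move=> Ux; have [h1 h2] := lm_psi (s1 _ Ux).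
  by split; rewrite // h2; case: Ux => _ [_ []].
have Uin x : loc c d x -> trans_dom (\val c) (\val c') x ->
    loc c' d' (tau (\val c) (\val c') x) -> U x.
  move=> h1 /[dup] h2 /(tr_inv HA) [_ e] [_]; rewrite e => h3.
  case: h1 h2 => cx h4 [_ h5]; split=> //; split=> //; split=> //.
  exact: (cinv_dom (chartP HA c)).
have Ua : ext1 U a.
  case: Da Dc Dd => a1 a2 [b1 b2] [k1]; rewrite tr1_end // => k2.
  by split; apply: Uin.
split.
  by case: (Ua) => u1 u2; split; [exact: s4|rewrite lmap1_end //; exact: s4].
rewrite /tr1 /lmap1 /=; congr (_, _, _).
  case: (Ua) => u1 _; rewrite /tau; have [_ ->] := lm_psi (s1 _ u1).
  by rewrite /lam -[cinv _ (cfun _ _)]/(psi c' (tau (\val c) (\val c') _)) e1.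
apply: (fact_uniq dK hW oU oU
  (fact_comp oU s4 (fact_restrict s1 (lfactorP c d)) (factorP HB d d'))
  (fact_comp oU s3 (fact_restrict s2 (factorP HA c c')) (lfactorP c' d')) Ua Ua).
move=> x Ux _; rewrite /tau; have [_ ->] := lm_psi (s1 _ Ux).
by rewrite /lam -[cinv _ (cfun _ _)]/(psi c' (tau (\val c) (\val c') _)) e1.
Qed.

Lemma map1_ex : exists F : M1 A -> M1 B, forall z c d a, at1 c a z ->
  ext1 (loc c d) a -> at1 d (lmap1 c d a) (F z).
Proof.
suff H (z : M1 A) : exists w, forall c d a, at1 c a z ->
  ext1 (loc c d) a -> at1 d (lmap1 c d a) w by exact: (choiceP H).
have [c [a az]] := at1_ex z.
have [d [d1 d2]] := charted2 HB (f (msrc HA z)) (f (mtgt HA z)).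
have La : ext1 (loc c d) a.
  rewrite (msrcE HA az) in d1; rewrite (mtgtE HA az) in d2.
  by have [h1 h2] := at1_cod az.
have [w ww] := at1_mk (lmap1_cod La); exists w => c' d' a' az' La'.
have [D e] := at1_eq HA az az'; rewrite e in La' *.
have [D' <-] := lmap1_trans La D La'; exact: at1_trans.
Qed.

Definition map1 := projT1 (cid map1_ex).
Lemma map1P z c d a : at1 c a z -> ext1 (loc c d) a -> at1 d (lmap1 c d a) (map1 z).
Proof. by rewrite /map1; case: cid => F /= FP; exact: FP. Qed.

Lemma map1_chart z (c : A) : dom c (msrc HA z) -> dom c (mtgt HA z) ->
  exists (d : B) a, [/\ at1 c a z, ext1 (loc c d) a & at1 d (lmap1 c d a) (map1 z)].
Proof.
move=> h1 h2; have [a az] := at1_charted h1 h2.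
have [d [d1 d2]] := charted2 HB (f (msrc HA z)) (f (mtgt HA z)).
have La : ext1 (loc c d) a.
  rewrite (msrcE HA az) in d1; rewrite (mtgtE HA az) in d2.
  by have [k1 k2] := at1_cod az.
by exists d, a; split=> //; exact: map1P.
Qed.

Lemma map1_ex_chart z : exists (c : A) (d : B) a,
  [/\ at1 c a z, ext1 (loc c d) a & at1 d (lmap1 c d a) (map1 z)].
Proof.
have [c [c1 c2]] := charted2 HA (msrc HA z) (mtgt HA z).
by have [d [a H]] := map1_chart c1 c2; exists c, d, a.
Qed.

Lemma map1_src z : msrc HB (map1 z) = f (msrc HA z).
Proof.
have [c [d [a [h1 [h2 _] h3]]]] := map1_ex_chart z.
by rewrite (msrcE HB h3) (msrcE HA h1) /=; case: (lm_psi h2).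
Qed.

Lemma map1_tgt z : mtgt HB (map1 z) = f (mtgt HA z).
Proof.
have [c [d [a [h1 h2 h3]]]] := map1_ex_chart z.
rewrite (mtgtE HB h3) (mtgtE HA h1) lmap1_end //.
by case: h2 => _ /lm_psi [].
Qed.

Lemma map1_kap z : mkap HB (map1 z) = mkap HA z.
Proof.
have [c [d [a [h1 h2 h3]]]] := map1_ex_chart z.
by rewrite (mkapE HB h3) (mkapE HA h1).
Qed.

Lemma lfactor0 c d x t : loc c d x -> lfactor c d ((x, 0), t) = 0.
Proof.
move=> ox; have := fact_add dK hW (v := 0) (v' := 0) (t := t) (loc_open c d)
  (lfactorP c d) ox.
rewrite !rscale0l !addr0 => /(_ ox ox) /eqP.
by rewrite -[X in X == _]addr0 (inj_eq (addrI _)) eq_sym => /eqP.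
Qed.

Lemma map1_functor : is_functor (mstar0 HA) (mstar0 HB) map1 (fun x => (f x.1, x.2)).
Proof.
split=> /=.
- by move=> z; rewrite map1_src map1_kap.
- by move=> z; rewrite map1_tgt map1_kap.
- move=> [p t] /=; have [c [cp _]] := charted2 HA p p.
  have [d [dp _]] := charted2 HB (f p) (f p).
  have L : loc c d (phi c p) by split; [exact: phi_cod|rewrite psi_phi].
  have := @map1P (midt HA (p, t)) c d ((phi c p, 0), t) _ _.
  rewrite /lmap1 /= lfactor0 // /lam psi_phi // => H.
  apply: (@at1_fun _ _ _ B d ((phi d (f p), 0), t)).
    apply: H; first exact: (@midtE _ _ _ _ HA (_, _)).
    by split; rewrite /= ?rscale0l ?addr0.
  exact: (@midtE _ _ _ _ HB (_, _)).
- move=> g h k H.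
  have [c [c1 c2 c3 _]] := charted4 HA (msrc HA h) (mtgt HA h) (mtgt HA g) (msrc HA h).
  have [d [d1 d2 d3 _]] := charted4 HB (f (msrc HA h)) (f (mtgt HA h))
    (f (mtgt HA g)) (f (msrc HA h)).
  have [a ah] := at1_charted c1 c2.
  have [b bg] : exists b, at1 c b g.
    by apply: at1_charted; rewrite -?(mcomp_mid HA H).
  have [E1 E2 E3] := mcompE HA H ah bg.
  have [ka1 ka2] := at1_cod ah; have [kb1 kb2] := at1_cod bg.
  have La : ext1 (loc c d) a.
    by split; split; rewrite // -?(msrcE HA ah) -?(mtgtE HA ah).
  have Lb : ext1 (loc c d) b.
    split; split; rewrite // -?(msrcE HA bg) -?(mtgtE HA bg) //.
    by rewrite -(mcomp_mid HA H).
  have [La1 La2] := La; have [Lb1 Lb2] := Lb; rewrite E1 E2 in Lb2.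
  have Lk : ext1 (loc c d) ((a.1.1, a.1.2 + b.1.2), a.2).
    by split=> //=; rewrite rscaleDl addrA.
  exists d, (lmap1 c d a), (lmap1 c d b); split=> //.
  + exact: map1P.
  + exact: map1P.
  + by rewrite lmap1_end //= E1.
  + have := map1P E3 Lk; rewrite /lmap1 /=.
    rewrite (fact_add dK hW (loc_open c d) (lfactorP c d)) // addrC.
    have -> : ((a.1.1, a.1.2), a.2) = a by case: (a) => [[]].
    by rewrite -E1 -E2; case: (b) => [[]].
Qed.

Lemma lmap1_cts c d a : ext1 (loc c d) a -> {for a, continuous (lmap1 c d)}.
Proof.
move=> La; have c1 : {for a, continuous (lfactor c d)}.
  by case: (lfactorP c d) => _; exact.
have c2 : {for a, continuous (fun a : V * V * K => lm c d a.1.1)}.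
  apply: (cts_comp (f := fun a : V * V * K => a.1.1)); first by cts.
  by apply: (fact_cts (loc_open c d) (lfactorP c d)); case: La.
by rewrite /lmap1; cts.
Qed.

Lemma map1_cts z : {for z, continuous map1}.
Proof.
have [c [d [a [h1 h2 h3]]]] := map1_ex_chart z.
have cc := co1_cts HA h1.
apply: (at1_cts_to HB (c := d) (h := fun z => lmap1 c d (co1 c z))).
  by apply: (cts_comp cc); rewrite (co1E HA h1); exact: lmap1_cts.
near=> w; apply: map1P; first by near: w; exact: co1_near h1.
near: w; apply: (cts_open cc); first exact: ext1_open (loc_open c d).
by rewrite (co1E HA h1).
Unshelve. all: by end_near. Qed.

Lemma map11_ex : exists F : M11 A -> M11 B, forall w,
  mp0 HB (F w) = map1 (mp0 HA w) /\ mpar HB (F w) = mpar HA w.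
Proof.
suff H (w : M11 A) : exists w', mp0 HB w' = map1 (mp0 HA w) /\
  mpar HB w' = mpar HA w by exact: (choiceP H).
by apply: mp0_lift; rewrite map1_kap mp0_kap.
Qed.

Definition map11 := projT1 (cid map11_ex).
Lemma map11_mp0 w : mp0 HB (map11 w) = map1 (mp0 HA w).
Proof. by rewrite /map11; case: cid => F /= FP; case: (FP w). Qed.
Lemma map11_par w : mpar HB (map11 w) = mpar HA w.
Proof. by rewrite /map11; case: cid => F /= FP; case: (FP w). Qed.

(** Compatibility with the bullet target amounts to homogeneity of the factorizers of [f]. *)
Lemma map11_mp1 w : mp1 HB (map11 w) = map1 (mp1 HA w).
Proof.
have [c [d [a [h1 h2 h3]]]] := map1_ex_chart (mp0 HA w).
have h4 := mp1_at h1; rewrite -map11_mp0 in h3.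
have := mp1_at h3; rewrite map11_par /= => h5.
have Ea : a.2 = (mpar HA w).1 * (mpar HA w).2 by rewrite -mp0_kap (mkapE HA h1).
have [k1 k2] := h2; rewrite Ea -rscaleA in k2.
have := map1P (d := d) h4 (conj k1 k2); rewrite /lmap1 /=.
rewrite (fact_hom dK hW (loc_open c d) (lfactorP c d)) // -Ea => h6.
apply: (at1_fun h5); move: h6.
by have -> : ((a.1.1, a.1.2), a.2) = a by case: (a) => [[]].
Qed.

Definition map_dmap : mdmap A B :=
  Dmap map11 map1 (fun x => (f x.1, x.2)) (fun x => (f x.1, x.2)).

Lemma map_dmap_mor : is_cont_mor (gdcat HA) (gdcat HB) map_dmap.
Proof.
have [f1 f2 f3 f4] := map1_functor.
split; first split.
- split=> /=.
  + by move=> w; rewrite map11_mp0 map11_par map1_src.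
  + by move=> w; rewrite map11_mp0 map11_par map1_tgt.
  + move=> x; apply: (mp0_inj (HA := HB)).
      by rewrite map11_mp0 !midt11_mp0 (f3 (_, _)).
    by rewrite map11_par !midt11_par.
  + by move=> g h k [e1 e2 H]; rewrite !map11_par !map11_mp0; split=> //; exact: f4.
- exact: map1_functor.
- split=> /=.
  + by move=> w; rewrite map11_mp0.
  + by move=> w; rewrite map11_mp1.
  + move=> z; apply: (mp0_inj (HA := HB)); first by rewrite map11_mp0 !mz_mp0.
    by rewrite map11_par !mz_par map1_kap.
  + move=> g h k [e1 e2 e3].
    by rewrite map11_mp1 !map11_mp0 !map11_par e1 e2 e3.
- split=> //= g h k [e1 e2 e3]; split=> //=; by rewrite ?e1 ?e2.
have cT (T : topologicalType) (x : M * T) :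
    {for x, continuous (fun x : M * T => (f x.1, x.2))}.
  have h : {for x, continuous (fun x : M * T => f x.1)}.
    by apply: (cts_comp (f := fst)); [cts|exact: cf].
  by cts.
split=> x.
- apply: mp0_cts_lift.
    rewrite (_ : (fun x => _) = (fun w => map1 (mp0 HA w))).
      by apply: (cts_comp (mp0_cts (HA := HA) (w := x))); exact: map1_cts.
    by apply/funext => w; rewrite map11_mp0.
  rewrite (_ : (fun x => _) = mpar HA); first exact: mpar_cts.
  by apply/funext => w; rewrite map11_par.
- exact: map1_cts.
- exact: cT.
- exact: cT.
Qed.

End FromMap.

End ManifoldMorphisms.

(** * Continuous morphisms trivial on scalars and their base maps *)

Section MorphismClassification.
Variables (K : topologicalRingType).
Variables (V W : topologicalRmodType K) (M N : topologicalType).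
Variables (A : set (chart M V)) (B : set (chart N W)).
Hypotheses (HA : good_atlas A) (HB : good_atlas B).
Local Notation dom c := (cdom (\val c)).
Local Notation cod c := (ccod (\val c)).
Local Notation phi c := (cfun (\val c)).
Local Notation psi c := (cinv (\val c)).
Let dK := good_dense HA.
Let hW := good_hausdorff HB.

Section OneMorphism.
Variables (f : M -> N) (F : mdmap A B).
Hypotheses (hF : is_cont_mor (gdcat HA) (gdcat HB) F) (tF : trivial_over f F).
Local Notation loc c d := (local_dom f (\val c) (\val d)).
Local Notation lm c d := (lam f (\val c) (\val d)).

Lemma mor_src z : msrc HB (m10 F z) = f (msrc HA z).
Proof.
case: hF => -[_ [s _ _ _] _ _] _; case: tF => _ t0.
by have := congr1 fst (s z); rewrite t0.
Qed.

Lemma mor_tgt z : mtgt HB (m10 F z) = f (mtgt HA z).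
Proof.
case: hF => -[_ [_ s _ _] _ _] _; case: tF => _ t0.
by have := congr1 fst (s z); rewrite t0.
Qed.

Lemma mor_kap z : mkap HB (m10 F z) = mkap HA z.
Proof.
case: hF => -[_ [s _ _ _] _ _] _; case: tF => _ t0.
by have := congr1 snd (s z); rewrite t0.
Qed.

Lemma mor_mp0 w : mp0 HB (m11 F w) = m10 F (mp0 HA w).
Proof. by case: hF => -[_ _ [s _ _ _] _] _; exact: s. Qed.

Lemma mor_par w : mpar HB (m11 F w) = mpar HA w.
Proof.
case: hF => -[[s _ _ _] _ _ _] _; case: tF => t1 _.
by have := congr1 snd (s w); rewrite t1.
Qed.

Lemma mor_base_cts : continuous f.
Proof.
case: hF => _ [_ _ _ c0]; case: tF => _ t0 x.
have : {for x, continuous (fun x => (m00 F (x, 0)).1)}.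
  apply: cts_fst; apply: (cts_comp (f := fun x : M => (x, 0 : K))); first by cts.
  exact: c0.
by rewrite (_ : (fun x => _) = f) //; apply/funext => y; rewrite t0.
Qed.

(** The vector component of [m10 F] in charts is a factorizer of the local map: [F] acts on
    endpoints by [f] and preserves the parameter, so the image arrow joins the images of the
    endpoints. Its continuity comes from that of [F]. *)
Lemma mor_fact (c : A) (d : B) : exists g, is_fact (loc c d) (lm c d) g /\
  forall a z, at1 c a z -> ext1 (loc c d) a ->
    at1 d ((lm c d a.1.1, g a), a.2) (m10 F z).
Proof.
have cf := mor_base_cts.
have [p0 _] := cdom_neq0 (chartP HA c).
(* This yields a total section of the coordinates of [c]; a unit arrow serves as the irrelevant
   value outside of the chart. *)
have H a : exists z, ext1 (cod c) a -> at1 c a z.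
  have [h|n] := pselect (ext1 (cod c) a); last by exists (midt HA (p0, 0)).
  by have [z zP] := at1_mk h; exists z.
have [zc zcP] := choiceP H.
have zc_cts a : ext1 (cod c) a -> {for a, continuous zc}.
  move=> h; apply: (at1_cts_to HA (c := c) (h := id)); first exact: cts_id.
  near=> b; apply: zcP; near: b.
  exact: (near_open (ext1_open (cod_open HA c)) h).
have E a : ext1 (loc c d) a -> at1 d (co1 d (m10 F (zc a))) (m10 F (zc a)) /\
    at1 c a (zc a).
  move=> [[a1 a2] [a3 a4]]; have az := zcP a (conj a1 a3); split=> //.
  have [||v vP] := @at1_charted _ _ _ _ HB d (m10 F (zc a)).
  - by rewrite mor_src (msrcE HA az).
  - by rewrite mor_tgt (mtgtE HA az).
  by rewrite (co1E HB vP).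
exists (fun a => (co1 d (m10 F (zc a))).1.2); split; last first.
  move=> a z az La; have [h1 h2] := E _ La; rewrite (at1_fun az h2).
  have [_ s] := at1_src HB h1.
  rewrite /lam -(msrcE HA h2) -mor_src s -(mkapE HA h2) -mor_kap (mkapE HB h1).
  by case: (co1 _ _) h1 => [[]].
split.
  move=> a La; have [h1 h2] := E _ La.
  have [_ s] := at1_src HB h1; have [_ t] := at1_tgt HB h1.
  rewrite /lam -(msrcE HA h2) -(mtgtE HA h2) -mor_src -mor_tgt s t.
  by rewrite addrC addKr -(mkapE HB h1) mor_kap (mkapE HA h2).
move=> a La; have [h1 h2] := E _ La.
have cz : {for a, continuous zc}.
  by apply: zc_cts; exact: (at1_cod h2).
have cm : {for a, continuous (fun a => m10 F (zc a))}.
  by apply: (cts_comp cz); case: hF => _ [_ c0 _ _]; exact: c0.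
have ck : {for a, continuous (fun a => co1 d (m10 F (zc a)))}.
  by apply: (cts_comp cm); exact: (co1_cts HB h1).
by cts.
Unshelve. all: by end_near. Qed.

Lemma mor_C1 : C1_manifold A B f.
Proof.
apply/(C1_manifold_fact HA HB mor_base_cts) => c d.
by have [g [gF _]] := mor_fact c d; exists g.
Qed.

Lemma mor_at1 (c : A) (d : B) g a z : is_fact (loc c d) (lm c d) g ->
  at1 c a z -> ext1 (loc c d) a -> at1 d ((lm c d a.1.1, g a), a.2) (m10 F z).
Proof.
move=> gF az La; have [g' [gF' /(_ _ _ az La)]] := mor_fact c d.
have oU := local_dom_open (chartP HA c) (chartP HB d) mor_base_cts.
by rewrite (fact_uniq dK hW oU oU gF gF' La La).
Qed.

Lemma mor_given : given_in_charts f F.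
Proof.
move=> c d g dg cg.
have oU := local_dom_open (chartP HA c) (chartP HB d) mor_base_cts.
have gF := fact_total (F := lm c d) oU (fun _ => erefl) dg cg.
have H0 (a : ext1 (loc c d)) (a' : ext1 (cod c)) (b : ext1 (cod d)) :
    \val a' = \val a ->
    \val b = ext1_fun (@local_map _ _ _ _ _ f (\val c) (\val d)) g a ->
    m10 F (chart1 a') = chart1 b.
  move=> ea eb; apply/esym/chart1_eq; have := at1_chart1 a'; rewrite ea => az.
  have := mor_at1 gF az (set_valP a); rewrite total_extE eb.
  by [].
split=> // a a' b ea eb.
(* An arrow of [M11] is settled by its scalars and its arrow in [M1], so the claim follows from the
   one for [M1] applied to [partial0 a]. *)
apply: (mp0_inj (HA := HB)); last first.
  rewrite mor_par (at11_par HA (at11_chart11 a')) (at11_par HB (at11_chart11 b)).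
  by rewrite ea eb.
have Aa := at11_at1 HA (at11_chart11 a'); have Ab := at11_at1 HB (at11_chart11 b).
rewrite mor_mp0; have [a1 [ea1 ->]] := at1_chart Aa.
have [b1 [eb1 ->]] := at1_chart Ab.
apply: (H0 (partial0 a)); first by rewrite ea1 ea.
by rewrite eb1 eb; congr (_, _, _); congr (cfun _ (f _)).
Qed.

Lemma mor_map1 z : m10 F z = map1 HA HB mor_C1 z.
Proof.
have [c [d [a [h1 h2 h3]]]] := map1_ex_chart HA HB mor_C1 z.
by apply: at1_fun h3; exact: mor_at1 (lfactorP _ _ _ _ _) h1 h2.
Qed.

Lemma mor_map_dmap : F = map_dmap HA HB mor_C1.
Proof.
case: (tF) => t1 t0; apply: dmap_eq => x.
- apply: (mp0_inj (HA := HB)); first by rewrite mor_mp0 map11_mp0 mor_map1.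
  by rewrite mor_par map11_par.
- exact: mor_map1.
- exact: t1.
- exact: t0.
Qed.

End OneMorphism.

(** Any such morphism coincides with the one constructed from its base map. This also drives the
    naturality of the product isomorphism. *)
Lemma mor_uniq f (F F' : mdmap A B) :
  is_cont_mor (gdcat HA) (gdcat HB) F -> trivial_over f F ->
  is_cont_mor (gdcat HA) (gdcat HB) F' -> trivial_over f F' -> F = F'.
Proof.
move=> hF tF hF' tF'; rewrite (mor_map_dmap hF tF) (mor_map_dmap hF' tF').
(* The construction [map_dmap] takes a proof that [f] is of class C^1, and the two morphisms supply
   different ones. *)
by rewrite (Prop_irrelevance (mor_C1 hF tF) (mor_C1 hF' tF')).
Qed.

Lemma morphism_bijection :
  one_to_one [set f | C1_manifold A B f]
    [set F | is_cont_mor (gdcat HA) (gdcat HB) F /\ trivial_on_K F]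
    (fun f F => trivial_over f F /\ given_in_charts f F).
Proof.
split=> [f hf|F [hF [f tF]]].
  have h := map_dmap_mor HA HB hf.
  have t : trivial_over f (map_dmap HA HB hf) by split.
  exists (map_dmap HA HB hf); split.
    by split; [split=> //; exists f|split=> //; exact: mor_given].
  by move=> F [[hF _] [tF _]]; exact: mor_uniq h t hF tF.
exists f; split.
  by split; [exact: mor_C1 hF tF|split=> //; exact: mor_given].
move=> f' [_ [[_ t0'] _]]; case: tF => _ t0; apply/funext => p.
by have := congr1 fst (t0 (p, 0)); rewrite t0' /= => ->.
Qed.

(** Both anchors are read off from endpoints and scalars, on which [F] acts by [f] and by the
    identity. *)
Lemma anchor_natural EA EB PhiA PhiB (f : M -> N) (F : mdmap A B) :
  is_unit_part (gdcat HA) EA -> is_diso EA (pairs_dcat K M) PhiA ->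
  is_anchor (gdcat HA) PhiA ->
  is_unit_part (gdcat HB) EB -> is_diso EB (pairs_dcat K N) PhiB ->
  is_anchor (gdcat HB) PhiB ->
  is_cont_mor (gdcat HA) (gdcat HB) F -> trivial_over f F ->
  [/\ forall a, exists2 a', \val a' = m11 F (\val a) &
        m11 PhiB a' = ((f (m11 PhiA a).1.1, f (m11 PhiA a).1.2),
                       (m11 PhiA a).2),
      forall a, exists2 a', \val a' = m10 F (\val a) &
        m10 PhiB a' = ((f (m10 PhiA a).1.1, f (m10 PhiA a).1.2),
                       (m10 PhiA a).2),
      forall a, exists2 a', \val a' = m01 F (\val a) &
        m01 PhiB a' = (f (m01 PhiA a).1, (m01 PhiA a).2) &
      forall a, exists2 a', \val a' = m00 F (\val a) &
        m00 PhiB a' = (f (m00 PhiA a).1, (m00 PhiA a).2)].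
Proof.
move=> _ _ [a1 a2 a3 a4] _ _ [b1 b2 b3 b4] hF tF.
have [t1 t0] := tF.
split.
- move=> a; have Pa : unit_part11 (gdcat HB) (m11 F (\val a)).
    by rewrite /unit_part11 /= (mor_par hF tF); exact: (set_valP a).
  exists (to_sub Pa) => //.
  have [e1 [e2 e3]] := a1 a; have [k1 [k2 k3]] := b1 (to_sub Pa).
  apply: prod_eq; rewrite /= in e1 e2 e3 k1 k2 k3 *.
    by rewrite e1 k1 !(mor_mp0 hF) (mor_src hF tF) (mor_tgt hF tF).
  apply: prod_eq; apply: val_sub_inj; rewrite /= in e2 e3 k2 k3 *.
    by rewrite e2 k2 (mor_par hF tF).
  by rewrite e3 k3 (mor_par hF tF).
- move=> a; have Pa : unit_part10 (gdcat HB) (m10 F (\val a)).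
    by rewrite /unit_part10 /= (mor_kap hF tF); exact: (set_valP a).
  exists (to_sub Pa) => //.
  have [e1 e2] := a2 a; have [k1 k2] := b2 (to_sub Pa).
  apply: prod_eq; rewrite /= in e1 e2 k1 k2 *.
    by rewrite e1 k1 (mor_src hF tF) (mor_tgt hF tF).
  by apply: val_sub_inj; rewrite /= e2 k2 (mor_kap hF tF).
- move=> a; have Pa : unit_part01 K N (m01 F (\val a)).
    by rewrite t1; exact: (set_valP a).
  exists (to_sub Pa) => //.
  have [e1 [e2 e3]] := a3 a; have [k1 [k2 k3]] := b3 (to_sub Pa).
  rewrite /= in e1 e2 e3 k1 k2 k3.
  apply: prod_eq => /=; first by rewrite e1 k1 t1.
  apply: prod_eq; apply: val_sub_inj; first by rewrite /= e2 k2 t1.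
  by rewrite /= e3 k3 t1.
- move=> a; have Pa : unit_part00 K N (m00 F (\val a)).
    by rewrite t0; exact: (set_valP a).
  exists (to_sub Pa) => //.
  have [e1 e2] := a4 a; have [k1 k2] := b4 (to_sub Pa).
  rewrite /= in e1 e2 k1 k2.
  apply: prod_eq => /=; first by rewrite e1 k1 t0.
  by apply: val_sub_inj; rewrite /= e2 k2 t0.
Qed.

End MorphismClassification.

(** * Products *)

Section ProductCharts.
Variables (K : topologicalRingType).
Variables (V W : topologicalRmodType K) (M N : topologicalType).

Lemma hausdorff_prod (X Y : topologicalType) :
  hausdorff_space X -> hausdorff_space Y -> hausdorff_space (X * Y)%type.
Proof.
move=> hX hY [x y] [x' y'] H; congr pair.
  apply: hX => O O' Ox O'x.
  have [] := H [set p | O p.1] [set p | O' p.1].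
  - by apply: (cts_nbhs (f := @fst X Y)) => //; cts.
  - by apply: (cts_nbhs (f := @fst X Y)) => //; cts.
  by move=> p [h1 h2]; exists p.1.
apply: hY => O O' Oy O'y.
have [] := H [set p | O p.2] [set p | O' p.2].
- by apply: (cts_nbhs (f := @snd X Y)) => //; cts.
- by apply: (cts_nbhs (f := @snd X Y)) => //; cts.
by move=> p [h1 h2]; exists p.2.
Qed.

Lemma setX_open (X Y : topologicalType) (P : set X) (Q : set Y) :
  open P -> open Q -> open (P `*` Q).
Proof.
move=> oP oQ; rewrite openE => -[x y] [/= Px Qy]; rewrite /interior.
apply: filterI.
  by apply: (cts_open (f := @fst X Y)) => //; cts.
by apply: (cts_open (f := @snd X Y)) => //; cts.
Qed.

Lemma prod_is_chart (c : chart M V) (d : chart N W) : is_chart c -> is_chart d ->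
  is_chart (prod_chart c d).
Proof.
move=> hc hd; split.
- have [p cp] := cdom_neq0 hc; have [q dq] := cdom_neq0 hd.
  by exists (p, q).
- exact: setX_open (cdom_open hc) (cdom_open hd).
- exact: setX_open (ccod_open hc) (ccod_open hd).
- by move=> p [h1 h2]; split; [exact: (cfun_cod hc)|exact: (cfun_cod hd)].
- by move=> p [h1 h2]; split; [exact: (cinv_dom hc)|exact: (cinv_dom hd)].
- by move=> [p q] [h1 h2] /=; rewrite (cfunK hc) ?(cfunK hd).
- by move=> [p q] [h1 h2] /=; rewrite (cinvK hc) ?(cinvK hd).
- rewrite continuous_open_subspace;
    last exact: setX_open (cdom_open hc) (cdom_open hd).
  move=> [p q] /set_mem [h1 h2]; apply: (cts_pair (f := fun p : M * N => cfun c p.1)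
    (g := fun p : M * N => cfun d p.2)).
    by apply: (cts_comp (f := @fst M N)); [cts|exact: cfun_cts].
  by apply: (cts_comp (f := @snd M N)); [cts|exact: cfun_cts].
- rewrite continuous_open_subspace;
    last exact: setX_open (ccod_open hc) (ccod_open hd).
  move=> [p q] /set_mem [h1 h2]; apply: (cts_pair (f := fun p : V * W => cinv c p.1)
    (g := fun p : V * W => cinv d p.2)).
    by apply: (cts_comp (f := @fst V W)); [cts|exact: cinv_cts].
  by apply: (cts_comp (f := @snd V W)); [cts|exact: cinv_cts].
Qed.

Lemma fact_prod (U : set V) (U' : set W) (f : V -> V) (f' : W -> W) g g' :
  is_fact U f g -> is_fact U' f' g' ->
  is_fact (U `*` U' : set (V * W)%type) (fun x => (f x.1, f' x.2))
    (fun a : (V * W) * (V * W) * K => (g ((a.1.1.1, a.1.2.1), a.2),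
      g' ((a.1.1.2, a.1.2.2), a.2))).
Proof.
move=> [g1 g2] [h1 h2].
have E1 a : ext1 (U `*` U' : set (V * W)%type) a -> ext1 U ((a.1.1.1, a.1.2.1), a.2).
  by move=> [[a1 a2] [a3 a4]].
have E2 a : ext1 (U `*` U' : set (V * W)%type) a -> ext1 U' ((a.1.1.2, a.1.2.2), a.2).
  by move=> [[a1 a2] [a3 a4]].
split=> a Ua.
  have := g1 _ (E1 _ Ua); have := h1 _ (E2 _ Ua); rewrite /= => k1 k2.
  by apply: prod_eq => /=; [exact: k2|exact: k1].
apply: cts_pair.
  apply: (cts_comp (f := fun a : (V * W) * (V * W) * K => ((a.1.1.1, a.1.2.1), a.2)));
    first by cts.
  by apply: g2; exact: E1.
apply: (cts_comp (f := fun a : (V * W) * (V * W) * K => ((a.1.1.2, a.1.2.2), a.2)));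
  first by cts.
by apply: h2; exact: E2.
Qed.

Lemma prod_compatible (c c' : chart M V) (d d' : chart N W) :
  is_chart c -> is_chart c' -> is_chart d -> is_chart d' ->
  compatible c c' -> compatible d d' ->
  compatible (prod_chart c d) (prod_chart c' d').
Proof.
move=> hc hc' hd hd' /compatible_fact [//|//|[g1 G1] [g2 G2]].
move=> /compatible_fact [//|//|[g3 G3] [g4 G4]].
apply/compatible_fact; [exact: prod_is_chart|exact: prod_is_chart|split].
  eexists; apply: (fact_restrict _ (fact_prod G1 G3)).
  by move=> x [[/= h1 h2] [h3 h4]]; split; split.
eexists; apply: (fact_restrict _ (fact_prod G2 G4)).
by move=> x [[/= h1 h2] [h3 h4]]; split; split.
Qed.

End ProductCharts.

Section ProductAtlas.
Variables (K : topologicalRingType).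
Variables (V W : topologicalRmodType K) (M N : topologicalType).
Variables (A : set (chart M V)) (B : set (chart N W)).
Hypotheses (HA : good_atlas A) (HB : good_atlas B).
Let hA := good_manifold HA.
Let hB := good_manifold HB.
Let dK := good_dense HA.

Lemma hausdorff_VW : hausdorff_space (V * W)%type.
Proof. exact: hausdorff_prod (good_hausdorff HA) (good_hausdorff HB). Qed.

(** The maximal atlas generated by the product charts. *)
Definition product_atlas : set (chart (M * N)%type (V * W)%type) :=
  [set e | is_chart e /\ forall c d, A c -> B d -> compatible e (prod_chart c d)].

Lemma prod_chart2 (p q : M * N) : exists c d, [/\ A c, B d,
  (cdom c p.1 /\ cdom c q.1) & cdom d p.2 /\ cdom d q.2].
Proof.
have [c [c1 c2]] := charted2 HA p.1 q.1; have [d [d1 d2]] := charted2 HB p.2 q.2.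
by exists (\val c), (\val d); split=> //; exact: set_valP.
Qed.

Lemma prod_in_atlas c d : A c -> B d -> product_atlas (prod_chart c d).
Proof.
move=> Ac Bd; have hc := atlas_chart hA Ac; have hd := atlas_chart hB Bd.
split; first exact: prod_is_chart.
move=> c' d' Ac' Bd'; have hc' := atlas_chart hA Ac'; have hd' := atlas_chart hB Bd'.
apply: prod_compatible => //.
  exact: (atlas_compatible hA).
exact: (atlas_compatible hB).
Qed.

(** Any two points of [M * N] lie in a common product chart, through which the transition map
    factors. The two-point criterion is applied to the identity, whose local maps are the transition
    maps. *)
Lemma product_atlas_fact e e' : product_atlas e -> product_atlas e' ->
  exists g, is_fact (trans_dom e e') (tau e e') g.
Proof.
move=> [he He] [he' He'].
apply: (lam_two_local (f := id) dK hausdorff_VW he he') => [p|p q]; first exact: cts_id.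
have [c [d [Ac Bd [c1 c2] [d1 d2]]]] := prod_chart2 p q.
have [hcd Hcd] := prod_in_atlas Ac Bd.
exists (prod_chart c d), (prod_chart c d); split=> //; split.
- by have /compatible_fact [//|//|] := He _ _ Ac Bd.
- by have /compatible_fact [//|//|] := Hcd _ _ Ac Bd.
- by have /compatible_fact [//|//|] := He' _ _ Ac Bd.
Qed.

Lemma product_atlas_compatible e e' :
  product_atlas e -> product_atlas e' -> compatible e e'.
Proof.
move=> Pe Pe'; apply/compatible_fact; [by case: Pe|by case: Pe'|].
by split; exact: product_atlas_fact.
Qed.

Lemma product_atlas_manifold : is_manifold product_atlas.
Proof.
split.
- exact: hausdorff_prod (manifold_hausdorff hA) (manifold_hausdorff hB).
- by move=> e [].
- move=> p; have [c [d [Ac Bd [c1 _] [d1 _]]]] := prod_chart2 p p.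
  by exists (prod_chart c d) => //; exact: prod_in_atlas.
- exact: product_atlas_compatible.
- by move=> e he H; split=> // c d Ac Bd; apply: H; exact: prod_in_atlas.
Qed.

(** A competing atlas is contained in [product_atlas] by compatibility with the product charts, and
    its own maximality gives the reverse inclusion. *)
Lemma product_atlas_uniq : exists! P : set (chart (M * N)%type (V * W)%type),
  is_manifold P /\ forall c d, A c -> B d -> P (prod_chart c d).
Proof.
exists product_atlas; split.
  by split; [exact: product_atlas_manifold|exact: prod_in_atlas].
move=> P [hP HP]; have sub e : P e -> product_atlas e.
  move=> Pe; split; first exact: (atlas_chart hP).
  by move=> c d Ac Bd; apply: (atlas_compatible hP) => //; exact: HP.
apply/predeqP => e; split; last exact: sub.
move=> Pe; apply: (atlas_maximal hP); first by case: Pe.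
by move=> e' /sub; exact: product_atlas_compatible.
Qed.

Lemma product_charted (P : set (chart (M * N)%type (V * W)%type)) :
  (forall c d, A c -> B d -> P (prod_chart c d)) -> finitely_charted P.
Proof.
move=> HP S fS [p Sp].
have [||c Ac cS] := good_charted HA (S := fst @` S).
- exact: finite_image.
- by exists p.1, p.
have [||d Bd dS] := good_charted HB (S := snd @` S).
- exact: finite_image.
- by exists p.2, p.
exists (prod_chart c d); first exact: HP.
by move=> q Sq; split; [apply: cS; exists q|apply: dS; exists q].
Qed.

End ProductAtlas.

Lemma cont_mor_comp (K : topologicalRingType)
    (V1 V2 V3 : topologicalRmodType K) (X1 X2 X3 : topologicalType)
    (A1 : set (chart X1 V1)) (A2 : set (chart X2 V2)) (A3 : set (chart X3 V3))
    (D1 : mdcatData A1) (D2 : mdcatData A2) (D3 : mdcatData A3)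
    (F : mdmap A1 A2) (G : mdmap A2 A3) :
  is_cont_mor D1 D2 F -> is_cont_mor D2 D3 G ->
  is_cont_mor D1 D3 (Dmap (m11 G \o m11 F) (m10 G \o m10 F) (m01 G \o m01 F)
    (m00 G \o m00 F)).
Proof.
move=> [[a1 a2 a3 a4] [c1 c2 c3 c4]] [[b1 b2 b3 b4] [d1 d2 d3 d4]].
split; split.
- exact: functor_comp a1 b1.
- exact: functor_comp a2 b2.
- exact: functor_comp a3 b3.
- exact: functor_comp a4 b4.
- by move=> x; exact: (cts_comp (c1 x) (d1 _)).
- by move=> x; exact: (cts_comp (c2 x) (d2 _)).
- by move=> x; exact: (cts_comp (c3 x) (d3 _)).
- by move=> x; exact: (cts_comp (c4 x) (d4 _)).
Qed.

(** * The double category of a product manifold as a fibred product *)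

Section ProductIso.
Variables (K : topologicalRingType).
Variables (V W : topologicalRmodType K) (M N : topologicalType).
Variables (A : set (chart M V)) (B : set (chart N W)).
Variable P : set (chart (M * N)%type (V * W)%type).
Hypotheses (HA : good_atlas A) (HB : good_atlas B) (HP : good_atlas P).
Hypothesis PAB : forall c d, A c -> B d -> P (prod_chart c d).

Definition pchart (c : A) (d : B) : P :=
  to_sub (PAB (set_valP c) (set_valP d)).

Definition fst1 (a : (V * W) * (V * W) * K) : V * V * K :=
  ((a.1.1.1, a.1.2.1), a.2).
Definition snd1 (a : (V * W) * (V * W) * K) : W * W * K :=
  ((a.1.1.2, a.1.2.2), a.2).

(** In a product chart the projection is linear, and its factorizer takes the first component of the
    vector. *)
Lemma fst_fact (c : A) (d : B) :
  is_fact (local_dom fst (\val (pchart c d)) (\val c))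
    (lam fst (\val (pchart c d)) (\val c)) (fun a => a.1.2.1).
Proof.
apply: (@fact_eq _ _ _ _ fst).
  by move=> x [[cx _] _]; rewrite /lam /= (phi_psi HA).
by split=> a _; [rewrite /= addrC addKr|cts].
Qed.

Lemma snd_fact (c : A) (d : B) :
  is_fact (local_dom snd (\val (pchart c d)) (\val d))
    (lam snd (\val (pchart c d)) (\val d)) (fun a => a.1.2.2).
Proof.
apply: (@fact_eq _ _ _ _ snd).
  by move=> x [[_ dx] _]; rewrite /lam /= (phi_psi HB).
by split=> a _; [rewrite /= addrC addKr|cts].
Qed.

Lemma pcharted (p q : M * N) : exists (c : A) (d : B),
  [/\ cdom (\val c) p.1, cdom (\val c) q.1, cdom (\val d) p.2 & cdom (\val d) q.2].
Proof.
have [c [c1 c2]] := charted2 HA p.1 q.1; have [d [d1 d2]] := charted2 HB p.2 q.2.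
by exists c, d.
Qed.

Lemma fst_cts : continuous (@fst M N). Proof. by move=> ?; exact: cvg_fst. Qed.
Lemma snd_cts : continuous (@snd M N). Proof. by move=> ?; exact: cvg_snd. Qed.

Lemma atlas_fact (K' : topologicalRingType) (V' : topologicalRmodType K')
    (M' : topologicalType) (A' : set (chart M' V')) (c d : A') : good_atlas A' ->
  exists g, is_fact (trans_dom (\val c) (\val d)) (tau (\val c) (\val d)) g.
Proof. by move=> H; exists (factor H c d); exact: factorP. Qed.

(** A chart of [P] need not be a product chart. Any two points do lie in a product chart, where the
    projection is linear, and the two-point criterion extends this to all charts. *)
Lemma fst_C1 : C1_manifold P A fst.
Proof.
apply/(C1_manifold_fact HP HA fst_cts) => e c.
apply: lam_two_local => //.
- exact: good_dense HA.
- exact: good_hausdorff HA.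
- exact: (chartP HP).
- exact: (chartP HA).
- exact: fst_cts.
move=> p q; have [c' [d' [h1 h2 h3 h4]]] := pcharted p q.
exists (\val (pchart c' d')), (\val c'); split=> //.
- exact: (chartP HP).
- exact: (chartP HA).
split; [exact: atlas_fact HP|by eexists; exact: fst_fact|exact: atlas_fact HA].
Qed.

Lemma snd_C1 : C1_manifold P B snd.
Proof.
apply/(C1_manifold_fact HP HB snd_cts) => e c.
apply: lam_two_local => //.
- exact: good_dense HA.
- exact: good_hausdorff HB.
- exact: (chartP HP).
- exact: (chartP HB).
- exact: snd_cts.
move=> p q; have [c' [d' [h1 h2 h3 h4]]] := pcharted p q.
exists (\val (pchart c' d')), (\val d'); split=> //.
- exact: (chartP HP).
- exact: (chartP HB).
split; [exact: atlas_fact HP|by eexists; exact: snd_fact|exact: atlas_fact HB].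
Qed.

Let F1 := map_dmap HP HA fst_C1.
Let F2 := map_dmap HP HB snd_C1.
Let hF1 : is_cont_mor (gdcat HP) (gdcat HA) F1 := map_dmap_mor HP HA fst_C1.
Let hF2 : is_cont_mor (gdcat HP) (gdcat HB) F2 := map_dmap_mor HP HB snd_C1.
Let tF1 : trivial_over fst F1. Proof. by split. Qed.
Let tF2 : trivial_over snd F2. Proof. by split. Qed.

Lemma proj1_at (c : A) (d : B) a z : at1 (pchart c d) a z ->
  at1 c (fst1 a) (m10 F1 z) /\ at1 d (snd1 a) (m10 F2 z).
Proof.
move=> az; have [[h1 h2] [h3 h4]] := at1_cod az.
have L1 : ext1 (local_dom fst (\val (pchart c d)) (\val c)) a.
  by split; split=> //; [exact: (cinv_dom (chartP HA c))|
    exact: (cinv_dom (chartP HA c))].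
have L2 : ext1 (local_dom snd (\val (pchart c d)) (\val d)) a.
  by split; split=> //; [exact: (cinv_dom (chartP HB d))|
    exact: (cinv_dom (chartP HB d))].
have k1 := mor_at1 hF1 tF1 (fst_fact c d) az L1.
have k2 := mor_at1 hF2 tF2 (snd_fact c d) az L2.
rewrite /lam /= (phi_psi HA) // in k1; rewrite /lam /= (phi_psi HB) // in k2.
Qed.

Lemma pchart_at (c : A) (d : B) a b z : at1 c a (m10 F1 z) -> at1 d b (m10 F2 z) ->
  at1 (pchart c d) (((a.1.1, b.1.1), (a.1.2, b.1.2)), a.2) z.
Proof.
move=> az bz.
have [h1 _] := at1_src HA az; rewrite (mor_src hF1 tF1) in h1.
have [h2 _] := at1_src HB bz; rewrite (mor_src hF2 tF2) in h2.
have [h3 _] := at1_tgt HA az; rewrite (mor_tgt hF1 tF1) in h3.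
have [h4 _] := at1_tgt HB bz; rewrite (mor_tgt hF2 tF2) in h4.
have [v vz] := at1_charted (HA := HP) (c := pchart c d) (conj h1 h2) (conj h3 h4).
have [k1 k2] := proj1_at vz.
rewrite (at1_inj HA az k1) (at1_inj HB bz k2).
by case: (v) vz => [[[? ?] [? ?]] ?].
Qed.

(** With [pair_inj] and [pair_cts] this exhibits [M1] of the product as the fibred product over [K]
    of the two factors; the statement for [M11] follows by adding the scalars. *)
Lemma pair_lift z1 z2 : mkap HA z1 = mkap HB z2 ->
  exists z, m10 F1 z = z1 /\ m10 F2 z = z2.
Proof.
move=> e; have [c [a az]] := at1_ex z1; have [d [b bz]] := at1_ex z2.
rewrite (mkapE HA az) (mkapE HB bz) in e.
have [z zz] : exists z, at1 (pchart c d) (((a.1.1, b.1.1), (a.1.2, b.1.2)), a.2) z.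
  apply: at1_mk; have [h1 h2] := at1_cod az; have [h3 h4] := at1_cod bz.
  rewrite -e in h4; by split; split.
have [k1 k2] := proj1_at zz; exists z; split.
  by apply: (at1_fun k1); case: (a) az => [[]].
apply: (at1_fun k2); rewrite /snd1 /= e; by case: (b) bz => [[]].
Qed.

Lemma pair_inj z z' : m10 F1 z = m10 F1 z' -> m10 F2 z = m10 F2 z' -> z = z'.
Proof.
move=> e1 e2; have [c [a az]] := at1_ex (m10 F1 z).
have [d [b bz]] := at1_ex (m10 F2 z).
have k := pchart_at az bz; rewrite e1 in az; rewrite e2 in bz.
exact: (at1_fun k (pchart_at az bz)).
Qed.

Lemma pair_cts (Y : topologicalType) (f : Y -> M1 P) y :
  {for y, continuous (fun x => m10 F1 (f x))} ->
  {for y, continuous (fun x => m10 F2 (f x))} -> {for y, continuous f}.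
Proof.
move=> c1 c2; have [c [a az]] := at1_ex (m10 F1 (f y)).
have [d [b bz]] := at1_ex (m10 F2 (f y)).
have k1 : {for y, continuous (fun x => co1 c (m10 F1 (f x)))}.
  by apply: (cts_comp c1); exact: (co1_cts HA az).
have k2 : {for y, continuous (fun x => co1 d (m10 F2 (f x)))}.
  by apply: (cts_comp c2); exact: (co1_cts HB bz).
apply: (at1_cts_to HP (c := pchart c d) (h := fun x =>
  ((((co1 c (m10 F1 (f x))).1.1, (co1 d (m10 F2 (f x))).1.1),
    ((co1 c (m10 F1 (f x))).1.2, (co1 d (m10 F2 (f x))).1.2)),
    (co1 c (m10 F1 (f x))).2))); first by cts.
near=> x; apply: pchart_at.
  by near: x; exact: (cts_nbhs c1 (co1_near HA az)).
by near: x; exact: (cts_nbhs c2 (co1_near HB bz)).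
Unshelve. all: by end_near. Qed.

Lemma product_fiber z : fiber_product (gdcat HA) (gdcat HB) (m11 F1 z, m11 F2 z).
Proof. by rewrite /fiber_product /= (mor_par hF1 tF1) (mor_par hF2 tF2). Qed.

Definition product_theta (z : M11 P) : fiber_product (gdcat HA) (gdcat HB) :=
  to_sub (product_fiber z).

Lemma product_theta_iso :
  is_product_iso (gdcat HA) (gdcat HB) (gdcat HP) product_theta.
Proof.
have H (ab : fiber_product (gdcat HA) (gdcat HB)) : exists z,
    product_theta z = ab.
  have e : mpar HA (\val ab).1 = mpar HB (\val ab).2 := set_valP ab.
  have [z [z1 z2]] : exists z, m10 F1 z = mp0 HA (\val ab).1 /\
      m10 F2 z = mp0 HB (\val ab).2.
    by apply: pair_lift; rewrite !mp0_kap e.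
  have [w [w1 w2]] : exists w, mp0 HP w = z /\ mpar HP w = mpar HA (\val ab).1.
    by apply: mp0_lift; rewrite -(mor_kap hF1 tF1) z1 mp0_kap.
  exists w; apply: val_sub_inj; apply: prod_eq => /=.
    apply: (mp0_inj (HA := HA)); first by rewrite (mor_mp0 hF1) w1.
    by rewrite (mor_par hF1 tF1).
  apply: (mp0_inj (HA := HB)); first by rewrite (mor_mp0 hF2) w1.
  by rewrite (mor_par hF2 tF2) w2.
have [g gP] := choiceP H.
have g1 x : m11 F1 (g x) = (\val x).1 by have := congr1 (fun y => (\val y).1) (gP x).
have g2 x : m11 F2 (g x) = (\val x).2 by have := congr1 (fun y => (\val y).2) (gP x).
split.
- split.
    move=> z; apply: cts_sub; apply: (cts_pair (f := m11 F1) (g := m11 F2)).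
      by case: hF1 => _ [h _ _ _]; exact: h.
    by case: hF2 => _ [h _ _ _]; exact: h.
  have cv (x : fiber_product (gdcat HA) (gdcat HB)) :
    {for x, continuous (fun x : fiber_product (gdcat HA) (gdcat HB) => \val x)}.
    exact: cts_val.
  exists g; split=> //.
    move=> x; have cx := cv x; apply: mp0_cts_lift.
      apply: pair_cts.
        rewrite (_ : (fun x => _) = (fun x : fiber_product (gdcat HA) (gdcat HB) =>
          mp0 HA (\val x).1)); first by apply: mp0_comp_cts; cts.
        by apply/funext => y; rewrite -(mor_mp0 hF1) g1.
      rewrite (_ : (fun x => _) = (fun x : fiber_product (gdcat HA) (gdcat HB) =>
        mp0 HB (\val x).2)); first by apply: mp0_comp_cts; cts.
      by apply/funext => y; rewrite -(mor_mp0 hF2) g2.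
    rewrite (_ : (fun x => _) = (fun x : fiber_product (gdcat HA) (gdcat HB) =>
      mpar HA (\val x).1)); first by apply: mpar_comp_cts; cts.
    by apply/funext => y; rewrite -(mor_par hF1 tF1) g1.
  move=> z; apply: (mp0_inj (HA := HP)); last first.
    by rewrite -!(mor_par hF1 tF1) g1.
  by apply: pair_inj; rewrite -?(mor_mp0 hF1) -?(mor_mp0 hF2) ?g1 ?g2.
- move=> z /=; rewrite (mor_mp0 hF1) (mor_mp0 hF2) (mor_src hF1 tF1).
  by rewrite (mor_src hF2 tF2) (mor_par hF1 tF1); case: (msrc HP _).
- move=> z /=; rewrite (mor_mp0 hF1) (mor_mp0 hF2) (mor_tgt hF1 tF1).
  by rewrite (mor_tgt hF2 tF2) (mor_par hF1 tF1); case: (mtgt HP _).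
- by exists F1, F2; split.
Qed.

End ProductIso.

Section ProductNaturality.
Variables (K : topologicalRingType).
Variables (V W V' W' : topologicalRmodType K) (M N M' N' : topologicalType).
Variables (A : set (chart M V)) (B : set (chart N W)).
Variables (A' : set (chart M' V')) (B' : set (chart N' W')).
Variables (P : set (chart (M * N)%type (V * W)%type)).
Variables (P' : set (chart (M' * N')%type (V' * W')%type)).
Hypotheses (HA : good_atlas A) (HB : good_atlas B) (HP : good_atlas P).
Hypotheses (HA' : good_atlas A') (HB' : good_atlas B') (HP' : good_atlas P').

(** In each component the two sides are values of continuous morphisms over the same base map,
    [f \o fst] or [g \o snd], so [mor_uniq] identifies them. *)
Lemma product_theta_natural
    (Theta : M11 P -> fiber_product (gdcat HA) (gdcat HB))
    (Theta' : M11 P' -> fiber_product (gdcat HA') (gdcat HB'))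
    (f : M -> M') (g : N -> N')
    (F : mdmap A A') (G : mdmap B B') (H : mdmap P P') :
  is_product_iso (gdcat HA) (gdcat HB) (gdcat HP) Theta ->
  is_product_iso (gdcat HA') (gdcat HB') (gdcat HP') Theta' ->
  is_cont_mor (gdcat HA) (gdcat HA') F -> trivial_over f F ->
  is_cont_mor (gdcat HB) (gdcat HB') G -> trivial_over g G ->
  is_cont_mor (gdcat HP) (gdcat HP') H ->
  trivial_over (fun p => (f p.1, g p.2)) H ->
  forall z, \val (Theta' (m11 H z)) =
    (m11 F (\val (Theta z)).1, m11 G (\val (Theta z)).2).
Proof.
move=> [_ _ _ [F1 [F2 [[h1 t1] [h2 t2] E]]]].
move=> [_ _ _ [F1' [F2' [[h1' t1'] [h2' t2'] E']]]] hF tF hG tG hH tH z.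
have T (X Y Z : Type) (P1 P2 P3 Q1 Q2 Q3 : Type)
    (D : dmap P1 Q1 (X * (K * K)) (X * K) P2 Q2 (Y * (K * K)) (Y * K))
    (D' : dmap P2 Q2 (Y * (K * K)) (Y * K) P3 Q3 (Z * (K * K)) (Z * K)) u v w :
    trivial_over u D -> trivial_over v D' -> (forall x, v (u x) = w x) ->
    trivial_over w (Dmap (m11 D' \o m11 D) (m10 D' \o m10 D) (m01 D' \o m01 D)
      (m00 D' \o m00 D)).
  move=> [a1 a2] [b1 b2] e; split=> x /=.
    by rewrite a1 b1 /= e.
  by rewrite a2 b2 /= e.
rewrite E' E /=; congr pair.
  have := mor_uniq (cont_mor_comp hH h1') (T _ _ _ _ _ _ _ _ _ _ _ _ _
      (f \o fst) tH t1' (fun _ => erefl))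
    (cont_mor_comp h1 hF) (T _ _ _ _ _ _ _ _ _ _ _ _ _
      (f \o fst) t1 tF (fun _ => erefl)).
  by move=> /(congr1 (fun D => m11 D z)).
have := mor_uniq (cont_mor_comp hH h2') (T _ _ _ _ _ _ _ _ _ _ _ _ _
    (g \o snd) tH t2' (fun _ => erefl))
  (cont_mor_comp h2 hG) (T _ _ _ _ _ _ _ _ _ _ _ _ _
    (g \o snd) t2 tG (fun _ => erefl)).
by move=> /(congr1 (fun D => m11 D z)).
Qed.

End ProductNaturality.

Theorem theorem3p6 :
  (forall (K : pzRingType) (V : lmodType K^c) (U : set V), U !=set0 ->
    [/\ is_dcat (lin_dcat U),
        forall W : lmodType K^c,
          one_to_one
            [set p : (U -> W) * (ext1 U -> W) |
              [/\ difference_factorizer p.1 p.2,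
                  factorizer_additive p.2 & factorizer_homogeneous p.2]]
            [set F : lin_dmap U [set: W] |
              is_dmor (lin_dcat U) (lin_dcat [set: W]) F /\ trivial_on_K F]
            (fun p F => given_by p.1 p.2 F),
        [/\ forall Z : lmodType K^c, (forall z : Z, z = 0) ->
              [/\ exists! F : lin_dmap U [set: Z],
                    is_dmor (lin_dcat U) (lin_dcat [set: Z]) F /\
                    trivial_on_K F,
                  is_cat_iso (lin_bul1 [set: Z]) (left_action_cat K)
                    (fun a => (\val a).2) (fun a => (\val a).2) &
                  is_cat_iso (lin_bul0 [set: Z]) (left_action_cat K)
                    snd snd],
            is_functor (lin_bul1 U) (left_action_cat K)
              (fun a => (\val a).2) (fun a => (\val a).2),
            is_functor (lin_bul0 U) (left_action_cat K) snd snd &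
            (forall a : ext11 U, (src (lin_star1 U) a).2 = (\val a).2) /\
            (forall a : ext1 U, (src (lin_star0 U) a).2 = (\val a).2)],
        is_diso (lin_dcat U) (dcat_star_op (lin_dcat U)) (lin_inversion U) &
        exists E, [/\ is_unit_part (lin_dcat U) E, is_dgroupoid E &
          exists Phi, is_diso E (pairs_dcat K U) Phi]]) /\
  (forall K : topologicalRingType, dense (units K) ->
    [/\ forall (V : topologicalRmodType K) (M : topologicalType)
          (A : set (chart M V)),
          hausdorff_space V -> is_manifold A -> finitely_charted A ->
          (exists! D : mdcatData A, is_glued_dcat D) /\
          forall D : mdcatData A, is_glued_dcat D ->
          [/\ continuous_dcat D,
              continuous_groupoid (star1 D) /\
                (forall a, (src (star1 D) a).2 = (tgt (star1 D) a).2),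
              exists T : catData (TM A) M,
                [/\ is_tangent_bundle T, continuous_groupoid T &
                    forall s t : K, exists E,
                      [/\ is_fiber D s t E,
                          continuous_groupoid E,
                          s * t = 0 -> exists h, [/\ homeomorphism h,
                            is_functor E T h id &
                            forall z (c : A) (a : ext11 (ccod (\val c)))
                              (b : tangent_piece (ccod (\val c))),
                              \val z = chart11 a -> \val b = (\val a).1 -> h z = chartT b] &
                          units K (s * t) -> exists h, homeomorphism h /\
                            is_functor E (pair_groupoid M) h id]],
              exists E, [/\ is_unit_part D E, is_dgroupoid E &
                exists Phi, is_diso E (pairs_dcat K M) Phi /\
                            is_anchor D Phi] &
              is_field K ->
                let Z := [set x : M * (K * K) | x.2.1 * x.2.2 = 0] in
                let G := unit_part01 K M in
                [/\ Z `|` G = setT, Z `&` G = set0,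
                    src (star1 D) @^-1` Z = tgt (star1 D) @^-1` Z,
                    src (star1 D) @^-1` G = tgt (star1 D) @^-1` G &
                    src (star1 D) @^-1` Z `|` src (star1 D) @^-1` G = setT /\
                    src (star1 D) @^-1` Z `&` src (star1 D) @^-1` G = set0]],
        forall (V : topologicalRmodType K) (M : topologicalType)
          (A : set (chart M V)),
          (exists v : V, v <> 0) ->
          (exists inv : K -> K, [/\ forall a, a <> 0 -> a * inv a = 1,
              forall a, a <> 0 -> inv a * a = 1 &
              {within units K, continuous inv}]) ->
          hausdorff_space V -> is_manifold A -> finitely_charted A,
        forall (V W : topologicalRmodType K) (U : set V) (f : U -> W),
          hausdorff_space V -> hausdorff_space W -> open U -> C1 f ->
          exists f1 : ext1 U -> W,
            [/\ difference_factorizer f f1, continuous f1,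
                forall g, difference_factorizer f g -> continuous g -> g = f1 &
                exists F : lin_dmap U [set: W],
                  [/\ is_dmor (lin_dcat U) (lin_dcat [set: W]) F,
                      continuous_dmap F & given_by f f1 F]],
        forall (V W : topologicalRmodType K) (M N : topologicalType)
          (A : set (chart M V)) (B : set (chart N W))
          (DA : mdcatData A) (DB : mdcatData B),
          hausdorff_space V -> is_manifold A -> finitely_charted A ->
          is_glued_dcat DA ->
          hausdorff_space W -> is_manifold B -> finitely_charted B ->
          is_glued_dcat DB ->
          [/\ one_to_one [set f | C1_manifold A B f]
                [set F | is_cont_mor DA DB F /\ trivial_on_K F]
                (fun f F => trivial_over f F /\ given_in_charts f F),
              forall EA EB PhiA PhiB (f : M -> N) (F : mdmap A B),
                is_unit_part DA EA -> is_diso EA (pairs_dcat K M) PhiA ->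
                is_anchor DA PhiA ->
                is_unit_part DB EB -> is_diso EB (pairs_dcat K N) PhiB ->
                is_anchor DB PhiB ->
                is_cont_mor DA DB F -> trivial_over f F ->
                [/\ forall a, exists2 a', \val a' = m11 F (\val a) &
                      m11 PhiB a' = ((f (m11 PhiA a).1.1, f (m11 PhiA a).1.2),
                                     (m11 PhiA a).2),
                    forall a, exists2 a', \val a' = m10 F (\val a) &
                      m10 PhiB a' = ((f (m10 PhiA a).1.1, f (m10 PhiA a).1.2),
                                     (m10 PhiA a).2),
                    forall a, exists2 a', \val a' = m01 F (\val a) &
                      m01 PhiB a' = (f (m01 PhiA a).1, (m01 PhiA a).2) &
                    forall a, exists2 a', \val a' = m00 F (\val a) &
                      m00 PhiB a' = (f (m00 PhiA a).1, (m00 PhiA a).2)],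
              exists! P : set (chart (M * N)%type (V * W)%type),
                is_manifold P /\
                forall c d, A c -> B d -> P (prod_chart c d) &
              forall P : set (chart (M * N)%type (V * W)%type),
                is_manifold P ->
                (forall c d, A c -> B d -> P (prod_chart c d)) ->
                finitely_charted P /\
                forall DP : mdcatData P, is_glued_dcat DP ->
                exists Theta : M11 P -> fiber_product DA DB,
                  is_product_iso DA DB DP Theta] &
        forall (V W V' W' : topologicalRmodType K)
          (M N M' N' : topologicalType)
          (A : set (chart M V)) (B : set (chart N W))
          (A' : set (chart M' V')) (B' : set (chart N' W'))
          (P : set (chart (M * N)%type (V * W)%type))
          (P' : set (chart (M' * N')%type (V' * W')%type))
          (DA : mdcatData A) (DB : mdcatData B) (DP : mdcatData P)
          (DA' : mdcatData A') (DB' : mdcatData B') (DP' : mdcatData P')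
          (Theta : M11 P -> fiber_product DA DB)
          (Theta' : M11 P' -> fiber_product DA' DB') (f : M -> M') (g : N -> N')
          (F : mdmap A A') (G : mdmap B B') (H : mdmap P P'),
          [/\ hausdorff_space V, is_manifold A, finitely_charted A &
              is_glued_dcat DA] ->
          [/\ hausdorff_space W, is_manifold B, finitely_charted B &
              is_glued_dcat DB] ->
          [/\ hausdorff_space V', is_manifold A', finitely_charted A' &
              is_glued_dcat DA'] ->
          [/\ hausdorff_space W', is_manifold B', finitely_charted B' &
              is_glued_dcat DB'] ->
          [/\ is_manifold P, is_glued_dcat DP &
              forall c d, A c -> B d -> P (prod_chart c d)] ->
          [/\ is_manifold P', is_glued_dcat DP' &
              forall c d, A' c -> B' d -> P' (prod_chart c d)] ->
          is_product_iso DA DB DP Theta ->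
          is_product_iso DA' DB' DP' Theta' ->
          is_cont_mor DA DA' F -> trivial_over f F ->
          is_cont_mor DB DB' G -> trivial_over g G ->
          is_cont_mor DP DP' H ->
          trivial_over (fun p => (f p.1, g p.2)) H ->
          forall z, \val (Theta' (m11 H z)) =
            (m11 F (\val (Theta z)).1, m11 G (\val (Theta z)).2)]).
Proof.
split.
  move=> K V U _; split.
  - exact: lin_dcat_is_dcat.
  - by move=> W; exact: linear_morphisms.
  - split.
    + move=> Z Z0; split; first exact: morphism_to_zero.
        exact: zero_bul1_iso.
      exact: zero_bul0_iso.
    + exact: lin_bul1_action.
    + exact: lin_bul0_action.
    + by [].
  - exact: lin_inversion_diso.
  - exact: lin_unit_part.
move=> K dK; split.
- move=> V M A hV hA fA; have HA := GoodAtlas dK hV hA fA.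
  split.
    exists (gdcat HA); split; first exact: gdcat_glued.
    by move=> D hD; rewrite (glued_uniq HA hD).
  move=> D hD; rewrite (glued_uniq HA hD); split.
  + exact: gdcat_continuous.
  + split; first exact: mstar1_groupoid.
    by [].
  + exact: gdcat_tangent.
  + exact: gdcat_unit_part.
  + exact: gdcat_field.
- move=> V M A [v v0] [inv [invr invl invc]] hV hA.
  exact: (division_ring_charted dK invr invl invc hV v0 hA).
- by move=> V W U f _ hW oU; exact: C1_morphism.
- move=> V W M N A B DA DB hV hA fA gA hW hB fB gB.
  have HA := GoodAtlas dK hV hA fA; have HB := GoodAtlas dK hW hB fB.
  rewrite (glued_uniq HA gA) (glued_uniq HB gB); split.
  + exact: morphism_bijection.
  + exact: anchor_natural.
  + exact: product_atlas_uniq.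
  move=> P hP PAB; have fP := product_charted HA HB PAB; split=> // DP gP.
  have HP := GoodAtlas dK (hausdorff_VW HA HB) hP fP.
  rewrite (glued_uniq HP gP); exists (product_theta HA HB HP PAB).
  exact: product_theta_iso.
move=> V W V' W' M N M' N' A B A' B' P P' DA DB DP DA' DB' DP' Theta Theta' f g.
move=> F G H [hV hA fA gA] [hW hB fB gB] [hV' hA' fA' gA'] [hW' hB' fB' gB'].
move=> [hP gP PAB] [hP' gP' PAB'].
have HA := GoodAtlas dK hV hA fA; have HB := GoodAtlas dK hW hB fB.
have HA' := GoodAtlas dK hV' hA' fA'; have HB' := GoodAtlas dK hW' hB' fB'.
have HP := GoodAtlas dK (hausdorff_VW HA HB) hP (product_charted HA HB PAB).
have HP' := GoodAtlas dK (hausdorff_VW HA' HB') hP' (product_charted HA' HB' PAB').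
(* The types of [Theta] and [Theta'] mention the glued structures that are about to be replaced by
   the model, so both are generalized beforehand. *)
move: Theta Theta'; rewrite (glued_uniq HA gA) (glued_uniq HB gB).
rewrite (glued_uniq HP gP) (glued_uniq HA' gA') (glued_uniq HB' gB').
rewrite (glued_uniq HP' gP') => Theta Theta'; exact: product_theta_natural.
Qed.
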